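(* Assume (A1)–(A5) (stated in the context). For $x_0\in\mathcal X$ let $\hat\theta_{n,x_0}$ denote a maximizer over $\theta\in\Theta$ of the conditional log likelihood $l_n(\theta,x_0)$. Then, for any $x_0\in\mathcal X$, $\lim_{n\to\infty}\hat\theta_{n,x_0}=\theta^*$, $\overline{\mathbb P}_{\theta^*}$-almost surely.
   Context: Setting. $\mathcal X$ is a separable compact set with a metrizable topology and Borel $\sigma$-field $\mathcal B(\mathcal X)$; $\mu$ is a probability measure on $\mathcal X$. $\mathcal Y$ is a set that is separable and metrizable by a complete metric, with its Borel $\sigma$-field; $\nu$ is a $\sigma$-finite measure on it. $s\ge 1$ is an integer. $\Theta$ is a compact subset of a Euclidean space and $\theta^*\in\Theta$ is the true parameter. For each $\theta\in\Theta$, $\{X_k\}$ is a homogeneous Markov chain on $\mathcal X$ with transition kernel $Q_\theta(x,dx')=q_\theta(x,x')\mu(dx')$; writing $\overline{\mathbf Y}_k=(Y_k,Y_{k-1},\dots,Y_{k-s+1})$, $Y_n$ is, given $\overline{\mathbf Y}_{n-1}$ and $X_n$, conditionally independent of the remaining past and has conditional density $g_\theta(\cdot\mid\overline{\mathbf Y}_{n-1},X_n)$ with respect to $\nu$. Thus $Z_k=(X_k,\overline{\mathbf Y}_k)$ is a Markov chain on $\mathcal X\times\mathcal Y^s$ with kernel $\Pi_\theta f(x,y_s,\dots,y_1)=\int f(x',y',y_s,\dots,y_2)q_\theta(x,x')g_\theta(y'\mid y_s,\dots,y_1,x')\mu(dx')\nu(dy')$. It is assumed throughout that $\Pi_\theta$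 has a unique invariant distribution $\pi_\theta$; $\overline{\mathbb P}_\theta$, $\overline{\mathbb E}_\theta$ denote the law and expectation of the stationary chain, extended to time index $\mathbb Z$. For functions on $\mathcal X$, $\sup$ and $\inf$ over $x$ mean essential supremum and infimum with respect to $\mu$. Conditional log likelihood: for $n\ge1$, $l_n(\theta,x_0)=\log\int\prod_{k=1}^n q_\theta(x_{k-1},x_k)g_\theta(Y_k\mid\overline{\mathbf Y}_{k-1},x_k)\,\mu^{\otimes n}(dx_1\cdots dx_n)$. Assumptions. (A1) (a) $0<\sigma_-:=\inf_{\theta}\inf_{x,x'}q_\theta(x,x')$ and $\sigma_+:=\sup_{\theta}\sup_{x,x'}q_\theta(x,x')<\infty$. (b) For all $y'\in\mathcal Y$, $\bar{\mathbf y}\in\mathcal Y^s$: $0<\inf_\theta\int g_\theta(y'\mid\bar{\mathbf y},x)\mu(dx)$ and $\sup_\theta\int g_\theta(y'\mid\bar{\mathbf y},x)\mu(dx)<\infty$. (A2) For all $\theta\in\Theta$, $\Pi_\theta$ is positive Harris recurrent and aperiodic with invariant distribution $\pi_\theta$. (A3) $b_+:=\sup_\theta\sup_{\bar{\mathbf y}_0,y_1,x}g_\theta(y_1\mid\bar{\mathbf y}_0,x)<\infty$ and $\overline{\mathbb E}_{\theta^*}|\log b_-(\overline{\mathbf Y}_0,Y_1)|<\infty$, where $b_-(\bar{\mathbf y}_0,y_1):=\inf_\theta\int g_\theta(y_1\mid\bar{\mathbf y}_0,x)\mu(dx)$. (A4) For all $x,x'\in\mathcal X$ and $(\bar{\mathbf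 y},y')\in\mathcal Y^s\times\mathcal Y$, $\theta\mapsto q_\theta(x,x')$ and $\theta\mapsto g_\theta(y'\mid\bar{\mathbf y},x)$ are continuous. (A5) For $\theta\in\Theta$: $\theta=\theta^*$ if and only if $\overline{\mathbb P}^Y_\theta=\overline{\mathbb P}^Y_{\theta^*}$, where $\overline{\mathbb P}^Y_\theta$ is the law of the process $\{Y_k\}$ under $\overline{\mathbb P}_\theta$.
   Formalization: In (A1)(a) the bounds on q_θ(x,x') are essential only in x' and hold uniformly over every starting point x; with essential bounds in x too, the claim for every x_0 fails, as the transition density from a single null point x_0 could make the likelihood vanish for all θ. *)

(* Defs.v *)
From HB Require Import structures.
From mathcomp Require Import all_boot all_order all_algebra.
From mathcomp Require Import all_classical all_reals all_analysis ess_sup_inf.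

Set Implicit Arguments.
Unset Strict Implicit.
Unset Printing Implicit Defensive.

Import Order.TTheory GRing.Theory Num.Theory.
Import numFieldNormedType.Exports.

Local Open Scope classical_set_scope.
Local Open Scope ring_scope.
Local Open Scope ereal_scope.

Definition separable_space (T : topologicalType) : Prop :=
  exists2 D : set T, countable D & dense D.

Notation borel T := (g_sigma_algebraType (@open T)).

(** A transition kernel on [Z] is represented by its action [Pi f z] on
    functions; the mass it gives to [A] from [z] is [Pi (\1_A) z]. *)
Section markov_chains.
Context {R : realType} {d : measure_display} {Z : measurableType d}.
Variable Pi : (Z -> \bar R) -> Z -> \bar R.

Definition kernel_mass (z : Z) (A : set Z) : \bar R :=
  Pi (fun w => (\1_A w)%:E) z.

Definition invariant (pi : probability Z R) : Prop :=
  forall A, measurable A -> \int[pi]_z kernel_mass z A = pi A.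

Definition unique_invariant (pi : probability Z R) : Prop :=
  invariant pi /\
  forall pi' : probability Z R, invariant pi' ->
    forall A, measurable A -> pi' A = pi A.

(** [visits_ge A N m z] is the probability that the chain started at [z]
    satisfies #{1 <= k <= N | Z_k \in A} >= m, obtained by conditioning on
    the first step; the Boolean [w \in A] is coerced to 0 or 1. *)
Fixpoint visits_ge (A : set Z) (N m : nat) (z : Z) : \bar R :=
  if N is N'.+1 then Pi (fun w => visits_ge A N' (m - (w \in A))%N w) z
  else if m is 0%N then 1 else 0.

(** The limit in [N] is P_z(eta_A >= m), eta_A being the total number of
    visits to [A], so the conclusion for all [m] is P_z(eta_A = oo) = 1.
    Irreducibility with respect to [phi] is part of the condition. *)
Definition harris_recurrent : Prop :=
  exists phi : {sigma_finite_measure set Z -> \bar R},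
    0 < phi [set: Z] /\
    forall A, measurable A -> 0 < phi A ->
      forall z m, visits_ge A N m z @[N --> \oo] --> (1 : \bar R).

Definition positive_harris_recurrent (pi : probability Z R) : Prop :=
  harris_recurrent /\ invariant pi.

(** No cycle of length at least 2 carries the chain; for a positive Harris
    chain the invariant distribution is a maximal irreducibility measure, so
    "full" means of full [pi] measure. *)
Definition aperiodic (pi : probability Z R) : Prop :=
  ~ exists n (D : nat -> set Z),
      [/\ (2 <= n)%N,
          forall i, (i < n)%N -> measurable (D i),
          trivIset `I_n D,
          forall i z, (i < n)%N -> D i z ->
            kernel_mass z (D (i.+1 %% n)%N) = 1 &
          pi (~` (\bigcup_(i < n) D i)) = 0].

Context {d' : measure_display} {Omega : measurableType d'}.

Definition past (Zs : int -> Omega -> Z) (k : int) : set (set Omega) :=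
  <<s [set B | exists j A, [/\ (j <= k)%R, measurable A & B = Zs j @^-1` A]] >>.

Definition stationary_chain (pi : probability Z R) (P : probability Omega R)
    (Zs : int -> Omega -> Z) : Prop :=
  (forall k A, measurable A -> P (Zs k @^-1` A) = pi A) /\
  (forall k A B, measurable A -> past Zs k B ->
     P (B `&` Zs (k + 1)%R @^-1` A) = \int[P]_(w in B) kernel_mass (Zs k w) A).

End markov_chains.

Definition process_sigma_algebra {d} {T : measurableType d} :
    set (set (int -> T)) :=
  <<s [set C | exists k A, measurable A /\ C = (fun y => y k) @^-1` A] >>.

Definition same_process_law {R : realType} {d d'} {Omega : measurableType d}
    {T : measurableType d'} (P P' : probability Omega R)
    (Y : int -> Omega -> T) : Prop :=
  forall A, process_sigma_algebra A ->
    P ((fun w k => Y k w) @^-1` A) = P' ((fun w k => Y k w) @^-1` A).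

(** [(y_k, y_(k-1), ..., y_(k-s+1))], most recent value first. *)
Definition lagged {T : Type} (s : nat) (y : int -> T) (k : int) : s.-tuple T :=
  [tuple y (k - (i : nat)%:Z)%R | i < s].

(** Prepends the new value and drops the oldest one. *)
Definition push {T : Type} {s : nat} (y : T) (t : s.-tuple T) : s.-tuple T :=
  [tuple of belast y t].

Section model.
Context {R : realType} {dX dY : measure_display}.
Context {X : measurableType dX} {Y : measurableType dY} {s p : nat}.
Variables (mu : probability X R) (nu : {sigma_finite_measure set Y -> \bar R}).
Variable Theta : set 'rV[R]_p.
Variables (q : 'rV[R]_p -> X -> X -> R).
(** [g theta ybar x y] is g_theta(y | ybar, x). *)
Variables (g : 'rV[R]_p -> s.-tuple Y -> X -> Y -> R).

Definition transition_densities : Prop :=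
  forall theta, Theta theta ->
  [/\ measurable_fun [set: X * X] (fun z => q theta z.1 z.2),
      forall x x', (0 <= q theta x x')%R &
      forall x, \int[mu]_x' (q theta x x')%:E = 1].

Definition observation_densities : Prop :=
  forall theta, Theta theta ->
  [/\ measurable_fun [set: s.-tuple Y * X * Y]
        (fun z => g theta z.1.1 z.1.2 z.2),
      forall yb x y, (0 <= g theta yb x y)%R &
      forall yb x, \int[nu]_y (g theta yb x y)%:E = 1].

Definition ar_kernel (theta : 'rV[R]_p) (f : X * s.-tuple Y -> \bar R)
    (z : X * s.-tuple Y) : \bar R :=
  \int[mu \x nu]_w
    (f (w.1, push w.2 z.2) * (q theta z.1 w.1 * g theta z.2 w.1 w.2)%:E).

(** For each starting point [x], [q theta x] is a density, determined up to
    mu-null sets, and the bounds on it are essential bounds; they are uniform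
    over all [x], so that [sigma_minus * mu A] bounds from below the
    probability of moving from any [x] to [A]. *)
Definition sigma_minus : \bar R :=
  ereal_inf [set r | exists theta x, Theta theta /\
    r = ess_inf mu (fun x' => (q theta x x')%:E)].

Definition sigma_plus : \bar R :=
  ereal_sup [set r | exists theta x, Theta theta /\
    r = ess_sup mu (fun x' => (q theta x x')%:E)].

Definition g_bar (theta : 'rV[R]_p) (yb : s.-tuple Y) (y : Y) : \bar R :=
  \int[mu]_x (g theta yb x y)%:E.

Definition b_minus (yb : s.-tuple Y) (y : Y) : \bar R :=
  ereal_inf [set g_bar theta yb y | theta in Theta].

Definition b_plus : \bar R :=
  ereal_sup [set r | exists theta yb y, Theta theta /\
    r = ess_sup mu (fun x => (g theta yb x y)%:E)].

(** The integral of a nonnegative function of [(x_1, ..., x_n)] with respect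
    to the n-fold product of [mu], as an iterated integral. *)
Fixpoint iter_integral (n : nat) (F : seq X -> \bar R) : \bar R :=
  if n is n'.+1 then \int[mu]_x iter_integral n' (fun xs => F (x :: xs))
  else F [::].

(** In the [k]-th factor, [nth x0 (x0 :: xs) k] is x_k and [nth x0 xs k] is
    x_(k+1). *)
Definition likelihood (y : int -> Y) (n : nat) (theta : 'rV[R]_p) (x0 : X) :
    \bar R :=
  iter_integral n (fun xs =>
    (\prod_(k < n)
      (q theta (nth x0 (x0 :: xs) k) (nth x0 xs k) *
       g theta (lagged s y (k : nat)%:Z) (nth x0 xs k) (y k.+1%:Z)))%:E).

Definition log_likelihood (y : int -> Y) (n : nat) (theta : 'rV[R]_p) (x0 : X) :
    \bar R :=
  lne (likelihood y n theta x0).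

Definition is_mle (y : int -> Y) (n : nat) (x0 : X) (theta : 'rV[R]_p) : Prop :=
  Theta theta /\
  forall theta', Theta theta' ->
    log_likelihood y n theta' x0 <= log_likelihood y n theta x0.

End model.

(* Main.v *)
(** The bounds [sigma_- <= q <= sigma_+] make the likelihoods given different
    initial hidden states comparable up to the factor
    [kappa = sigma_+ / sigma_-], so the log-likelihood of a block of
    observations is additive up to [log kappa]. Wald's method then only needs,
    for each [theta <> theta_star], a block length [m] with
    [E_*(l_m(theta) - l_m(theta_star)) + 2 log kappa < 0]: by continuity and
    dominated convergence the same holds for the supremum over a small ball, and
    subadditivity with Birkhoff's theorem gives
    [l_n(theta') < l_n(theta_star)] eventually, uniformly on the ball.

    If no such [m] exists, the likelihood ratios of all lengths have relative
    entropy at most [2 log kappa]. Harris recurrence makes the Cesaro averages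
    of a local function under [theta] converge from every starting point, in
    particular from the past of the chain run under [theta_star]; with the
    entropy bound this forces the averages under [theta_star] to have the same
    limit, hence both laws of [Y] coincide, against (A5).

    Ergodicity of the stationary chain comes from uniqueness of the invariant
    distribution: conditioning on a shift-invariant event gives a Markov law
    whose marginals are again invariant. *)
Require Import Defs.
From HB Require Import structures.
From mathcomp Require Import all_boot all_order all_algebra.
From mathcomp Require Import all_classical all_reals all_analysis measurable_realfun ess_sup_inf.
From mathcomp Require Import finmap zify ring lra.

Set Implicit Arguments.
Unset Strict Implicit.
Unset Printing Implicit Defensive.

Import Order.TTheory GRing.Theory Num.Theory.
Import numFieldNormedType.Exports.
Import HBSimple HBNNSimple.

Local Open Scope classical_set_scope.
Local Open Scope ring_scope.
Local Open Scope ereal_scope.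

(** * Kernels with a density *)

(** The change of measure restarts the chain of [theta] at a fixed hidden state [x0] and a past
    drawn under the true parameter. Such a point may be exceptional for the invariant law of
    [theta], so statements valid almost surely under that law do not apply to it: this is where
    Harris recurrence enters. Only one inequality is needed from every starting point, a lower bound
    on the lower limit of Cesaro averages along a subsequence; for [1 - f] it gives the upper bound
    used by the entropy argument.

    That argument yields [M * E_* f <= C + D M * E_theta f] for every [M > 0] and every local [f]
    with values in [0, 1], where [C] and [D] do not depend on how many observations [f] reads.
    Taking for [f] the deviation of a long average from its [theta]-mean makes the last term vanish,
    and [M] is then free to grow.

    The observations alone are not Markov, so the chain is enlarged to the hidden state together
    with the whole history. In Wald's method ergodicity is known for the shift, not for its [m]-th
    power; hence the [m]-step inequalities are summed over overlapping blocks instead of being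
    iterated along multiples of [m]. *)

Section nonneg_induction.
Context {R : realType} {d : measure_display} {T : measurableType d}.

Lemma nonneg_fun_ind (P : (T -> \bar R) -> Prop) :
  (forall A, measurable A -> P (fun x => (\1_A x)%:E)) ->
  (forall f g : T -> \bar R, measurable_fun setT f -> measurable_fun setT g ->
     (forall x, 0 <= f x) -> (forall x, 0 <= g x) ->
     P f -> P g -> P (fun x => f x + g x)) ->
  (forall (c : R) (f : T -> \bar R), (0 <= c)%R -> measurable_fun setT f ->
     (forall x, 0 <= f x) -> P f -> P (fun x => c%:E * f x)) ->
  (forall F : nat -> T -> \bar R, (forall n, measurable_fun setT (F n)) ->
     (forall n x, 0 <= F n x) ->
     (forall x, {homo F^~ x : n m / (n <= m)%N >-> n <= m}) ->
     (forall n, P (F n)) -> P (fun x => limn (F^~ x))) ->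
  forall f : T -> \bar R, measurable_fun setT f -> (forall x, 0 <= f x) -> P f.
Proof.
move=> Pind PD PZ Plim f mf f0.
pose F n := EFin \o nnsfun_approx measurableT mf n.
have mF n : measurable_fun setT (F n).
  by apply/measurable_EFinP; exact: measurable_funTS.
have F0 n x : 0 <= F n x by rewrite lee_fin.
have ndF x : {homo F^~ x : n m / (n <= m)%N >-> n <= m}.
  by move=> n m nm; rewrite lee_fin; exact/lefP/nd_nnsfun_approx.
have -> : f = fun x => limn (F^~ x).
  apply/funext => x; apply/esym/cvg_lim => //.
  by apply: (cvg_nnsfun_approx measurableT mf).
apply: Plim => // n.
have -> : F n = fun x => \sum_(r <- fset_set (range (nnsfun_approx measurableT mf n)))
    r%:E * (\1_(nnsfun_approx measurableT mf n @^-1` [set r]) x)%:E.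
  apply/funext => x; rewrite /F /= fimfunE fsbig_finite//= -sumEFin.
  by apply: eq_bigr => r _; rewrite EFinM.
have : forall r, r \in (fset_set (range (nnsfun_approx measurableT mf n)) : seq R) -> (0 <= r)%R.
  by move=> r; rewrite in_fset_set// => /set_mem[x _ <-].
elim: (fset_set _ : seq R) => [_|r s ih rs].
  (* The induction principle has no case for the zero function, so the empty sum is written as 0
     times an indicator. *)
  have -> : (fun x => \sum_(r <- [::]) r%:E *
      (\1_(nnsfun_approx measurableT mf n @^-1` [set r]) x)%:E) =
      fun x => 0%R%:E * (\1_(@setT T) x)%:E.
    by apply/funext => x; rewrite big_nil -EFinM mul0r.
  by apply: PZ => //; [exact/measurable_EFinP|exact: Pind].
under eq_fun do rewrite big_cons.
have mI r' : measurable (nnsfun_approx measurableT mf n @^-1` [set r']).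
  exact: measurable_sfunP.
apply: PD.
- by apply: measurable_funeM; apply/measurable_EFinP; exact: measurable_indic.
- apply: emeasurable_sum => r'; apply: measurable_funeM; apply/measurable_EFinP.
  exact: measurable_indic.
- by move=> x; rewrite mule_ge0// lee_fin// rs// mem_head.
- move=> x; rewrite big_seq; apply: sume_ge0 => r' r's.
  by rewrite mule_ge0// lee_fin// rs// in_cons r's orbT.
- apply: PZ => //; first by rewrite rs// mem_head.
  + by apply/measurable_EFinP; exact: measurable_indic.
  + exact: Pind.
- by apply: ih => r' r's; rewrite rs// in_cons r's orbT.
Qed.

(* Only equality in law of [V] against a kernel on sets is needed to transfer
   to functions, so the kernel enters through an abstract operator. *)
Lemma integral_operator_ext {d' d''} {O : measurableType d'} {O' : measurableType d''}
    (m : {measure set O -> \bar R}) (m' : {measure set O' -> \bar R})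
    (V : O -> T) (L : (T -> \bar R) -> O' -> \bar R) :
  measurable_fun setT V ->
  (forall f, measurable_fun setT f -> (forall x, 0 <= f x) ->
     measurable_fun setT (L f) /\ forall x, 0 <= L f x) ->
  (forall f g, measurable_fun setT f -> measurable_fun setT g ->
     (forall x, 0 <= f x) -> (forall x, 0 <= g x) ->
     forall x, L (fun y => f y + g y) x = L f x + L g x) ->
  (forall (c : R) f, (0 <= c)%R -> measurable_fun setT f ->
     (forall x, 0 <= f x) -> forall x, L (fun y => c%:E * f y) x = c%:E * L f x) ->
  (forall F : nat -> T -> \bar R, (forall n, measurable_fun setT (F n)) ->
     (forall n x, 0 <= F n x) ->
     (forall x, {homo F^~ x : n m / (n <= m)%N >-> n <= m}) ->
     forall x, {homo (fun n => L (F n) x) : n m / (n <= m)%N >-> n <= m} /\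
     L (fun y => limn (F^~ y)) x = limn (fun n => L (F n) x)) ->
  (forall A, measurable A -> m (V @^-1` A) = \int[m']_x L (fun y => (\1_A y)%:E) x) ->
  forall f, measurable_fun setT f -> (forall x, 0 <= f x) ->
  \int[m]_x f (V x) = \int[m']_x L f x.
Proof.
move=> mV mL LD LZ Llim LI.
apply: nonneg_fun_ind.
- move=> A mA; rewrite -LI//.
  transitivity (\int[m]_x (\1_(V @^-1` A) x)%:E); first exact: eq_integral.
  by rewrite integral_indic// ?setIT// -[X in measurable X]setTI; exact: mV.
- move=> f g mf mg f0 g0 If Ig.
  rewrite ge0_integralD//; last 2 first.
  + exact: measurableT_comp.
  + exact: measurableT_comp.
  rewrite If Ig -ge0_integralD//; last 4 first.
  + by move=> x _; have [] := mL f mf f0.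
  + by have [] := mL f mf f0.
  + by move=> x _; have [] := mL g mg g0.
  + by have [] := mL g mg g0.
  by apply: eq_integral => x _; rewrite LD.
- move=> c f c0 mf f0 If.
  rewrite ge0_integralZl//; last exact: measurableT_comp.
  rewrite If -ge0_integralZl//; last 2 first.
  + by have [] := mL f mf f0.
  + by move=> x _; have [] := mL f mf f0.
  by apply: eq_integral => x _; rewrite LZ.
- move=> F mF F0 ndF IF.
  rewrite monotone_convergence//; last by move=> n; exact: measurableT_comp.
  transitivity (limn (fun n => \int[m']_x L (F n) x)).
    by congr (limn _); apply/funext => n; exact: IF.
  rewrite -(monotone_convergence _ measurableT (g' := fun n x => L (F n) x)).
  + by apply: eq_integral => x _; have [_ ->] := Llim F mF F0 ndF x.
  + by move=> n; have [] := mL _ (mF n) (F0 n).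
  + by move=> n x _; exact: (mL _ (mF n) (F0 n)).2.
  + by move=> x _; have [] := Llim F mF F0 ndF x.
Qed.

Lemma ge0_integral_mrestr (m : {measure set T -> \bar R}) (B : set T)
    (mB : measurable B) (f : T -> \bar R) :
  measurable_fun setT f -> (forall x, 0 <= f x) ->
  \int[mrestr m mB]_x f x = \int[m]_(x in B) f x.
Proof.
move=> mf f0; rewrite integral_mkcond.
apply: (integral_operator_ext (V := id) (L := fun f => f \_ B)) => //.
- move=> g mg g0; split; first by apply/(measurable_restrictT _ mB); exact: measurable_funTS.
  by move=> x; exact: erestrict_ge0.
- by move=> g h _ _ _ _ x; rewrite !patchE; case: ifPn; rewrite ?adde0.
- by move=> c g _ _ _ x; rewrite !patchE; case: ifPn; rewrite ?mule0.
- move=> F mF F0 ndF x; rewrite !patchE; split.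
    by move=> n k nk; rewrite !patchE; case: ifPn => // _; exact: ndF.
  case: ifPn => xB.
    by congr (limn _); apply/funext => n; rewrite patchE xB.
  apply/esym/cvg_lim => //; under eq_fun do rewrite patchE (negbTE xB).
  exact: cvg_cst.
- by move=> A mA; rewrite -integral_mkcond integral_indic.
Qed.

End nonneg_induction.

Section density_kernel.
Context {R : realType} {dZ dX dY : measure_display}.
Context {Z : measurableType dZ} {X : measurableType dX} {Y : measurableType dY}.
Variables (mu : probability X R) (nu : {sigma_finite_measure set Y -> \bar R}).
Variables (phi : Z -> X * Y -> Z) (rho : Z -> X * Y -> R).
Hypothesis mphi : measurable_fun [set: Z * (X * Y)] (fun u => phi u.1 u.2).
Hypothesis mrho : measurable_fun [set: Z * (X * Y)] (fun u => rho u.1 u.2).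
Hypothesis rho0 : forall z w, (0 <= rho z w)%R.
Hypothesis rho1 : forall z, \int[mu \x nu]_w (rho z w)%:E = 1.

(** From [z] the chain draws [w] with density [rho z] and moves to [phi z w]. Keeping the
    deterministic update apart from the density lets the same lemmas serve the chain with finitely
    many lags and the chain with the whole history. *)
Definition dker (f : Z -> \bar R) (z : Z) : \bar R :=
  \int[mu \x nu]_w (f (phi z w) * (rho z w)%:E).

Lemma measurable_dker_integrand f : measurable_fun setT f ->
  measurable_fun [set: Z * (X * Y)] (fun u => f (phi u.1 u.2) * (rho u.1 u.2)%:E).
Proof.
move=> mf; apply: emeasurable_funM; first exact: (measurableT_comp mf).
exact/measurable_EFinP.
Qed.

Lemma measurable_dker_integrandr f z : measurable_fun setT f ->
  measurable_fun setT (fun w => f (phi z w) * (rho z w)%:E).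
Proof.
move=> mf.
exact: (measurableT_comp (measurable_dker_integrand mf) (measurable_pair1 z)).
Qed.

Lemma dker_ge0 f z : (forall x, 0 <= f x) -> 0 <= dker f z.
Proof. by move=> f0; apply: integral_ge0 => w _; rewrite mule_ge0// lee_fin. Qed.

Lemma measurable_dker f : measurable_fun setT f -> (forall x, 0 <= f x) ->
  measurable_fun setT (dker f).
Proof.
move=> mf f0.
pose h (u : (Z * X) * Y) := f (phi u.1.1 (u.1.2, u.2)) * (rho u.1.1 (u.1.2, u.2))%:E.
have mh : measurable_fun setT h.
  apply: (measurableT_comp (f := fun u => f (phi u.1 u.2) * (rho u.1 u.2)%:E)
    (g := fun u : (Z * X) * Y => (u.1.1, (u.1.2, u.2)))).
    exact: measurable_dker_integrand.
  apply: measurable_fun_pair; first exact: measurableT_comp.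
  by apply: measurable_fun_pair => //; exact: measurableT_comp.
have h0 u : 0 <= h u by rewrite mule_ge0// lee_fin.
have -> : dker f = fun z => \int[mu]_x fubini_F nu h (z, x).
  apply/funext => z; rewrite /dker fubini_tonelli1//.
    exact: measurable_dker_integrandr.
  by move=> w; rewrite mule_ge0// lee_fin.
apply: (measurable_fun_fubini_tonelli_F (m2 := mu) (fubini_F nu h)).
  exact: measurable_fun_fubini_tonelli_F.
by move=> x; apply: integral_ge0.
Qed.

Lemma dker_cst c : 0 <= c -> forall z, dker (cst c) z = c.
Proof.
move=> c0 z; rewrite /dker ge0_integralZl ?rho1 ?mule1// => [|w _]; last by rewrite lee_fin.
apply/measurable_EFinP.
exact: (measurableT_comp mrho (measurable_pair1 z)).
Qed.

Lemma dkerD f g z : measurable_fun setT f -> measurable_fun setT g ->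
  (forall x, 0 <= f x) -> (forall x, 0 <= g x) ->
  dker (fun y => f y + g y) z = dker f z + dker g z.
Proof.
move=> mf mg f0 g0; rewrite /dker -ge0_integralD//.
- by apply: eq_integral => w _; rewrite ge0_muleDl.
- by move=> w _; rewrite mule_ge0// lee_fin.
- exact: measurable_dker_integrandr.
- by move=> w _; rewrite mule_ge0// lee_fin.
- exact: measurable_dker_integrandr.
Qed.

Lemma dkerZ (c : R) f z : (0 <= c)%R -> measurable_fun setT f ->
  (forall x, 0 <= f x) -> dker (fun y => c%:E * f y) z = c%:E * dker f z.
Proof.
move=> c0 mf f0; rewrite /dker -ge0_integralZl//.
- by apply: eq_integral => w _; rewrite muleA.
- exact: measurable_dker_integrandr.
- by move=> w _; rewrite mule_ge0// lee_fin.
Qed.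

Lemma dker_le f g z : measurable_fun setT f -> measurable_fun setT g ->
  (forall x, 0 <= f x) -> (forall x, f x <= g x) -> dker f z <= dker g z.
Proof.
move=> mf mg f0 fg; apply: ge0_le_integral => //.
- by move=> w _; rewrite mule_ge0// lee_fin.
- exact: measurable_dker_integrandr.
- exact: measurable_dker_integrandr.
- by move=> w _; rewrite lee_wpmul2r// lee_fin.
Qed.

Lemma dker_nd_lim (F : nat -> Z -> \bar R) z : (forall n, measurable_fun setT (F n)) ->
  (forall n x, 0 <= F n x) ->
  (forall x, {homo F^~ x : n m / (n <= m)%N >-> n <= m}) ->
  {homo (fun n => dker (F n) z) : n m / (n <= m)%N >-> n <= m} /\
  dker (fun y => limn (F^~ y)) z = limn (fun n => dker (F n) z).
Proof.
move=> mF F0 ndF; split; first by move=> n m nm; apply: dker_le => // x; exact: ndF.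
rewrite /dker -monotone_convergence//.
- apply: eq_integral => w _; apply/esym/cvg_lim => //.
  apply: cvgeZr; first by rewrite fin_numE.
  exact/ereal_nondecreasing_is_cvgn.
- by move=> n; exact: measurable_dker_integrandr.
- by move=> n w _; rewrite mule_ge0// lee_fin.
- by move=> w _ n m nm; rewrite lee_wpmul2r ?lee_fin//; exact: ndF.
Qed.

(** Fatou's lemma for the kernel; it will make the lower limit of Cesaro averages superharmonic. *)
Lemma dker_fatou (F : nat -> Z -> \bar R) z : (forall n, measurable_fun setT (F n)) ->
  (forall n x, 0 <= F n x) ->
  dker (fun y => limn_einf (F^~ y)) z <= limn_einf (fun n => dker (F n) z).
Proof.
move=> mF F0; have ndE x := nondecreasing_einfs (F^~ x).
have mE n : measurable_fun setT (fun x => einfs (F^~ x) n) by exact: measurable_fun_einfs.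
have E0 n x : 0 <= einfs (F^~ x) n by apply: le_ereal_inf_tmp => _ [k _ <-].
under [X in dker X]eq_fun do rewrite limn_einf_lim.
have [_ ->] := dker_nd_lim z mE E0 ndE.
rewrite limn_einf_lim; apply: lee_lim.
- apply: ereal_nondecreasing_is_cvgn => n m nm; apply: dker_le => // x; exact: ndE.
- exact/ereal_nondecreasing_is_cvgn/nondecreasing_einfs.
- apply: nearW => n; apply: le_ereal_inf_tmp => _ [k nk <-]; apply: dker_le => // x.
  by apply: ereal_inf_lbound; exists k.
Qed.

(** Restricting [m] to [B] puts the conditioning event into the measure, after which a one-step
    Markov identity for sets extends to functions through [integral_operator_ext]. *)
Lemma dker_transfer {d'} {O : measurableType d'} (m : {measure set O -> \bar R})
    (B : set O) (U V : O -> Z) :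
  measurable B -> measurable_fun setT U -> measurable_fun setT V ->
  (forall A, measurable A -> m (B `&` V @^-1` A) = \int[m]_(w in B) kernel_mass dker (U w) A) ->
  forall f, measurable_fun setT f -> (forall x, 0 <= f x) ->
  \int[m]_(w in B) f (V w) = \int[m]_(w in B) dker f (U w).
Proof.
move=> mB mU mV H f mf f0.
rewrite -!(ge0_integral_mrestr _ mB); last 4 first.
- exact: (measurableT_comp (measurable_dker mf f0)).
- by move=> x; exact: dker_ge0.
- exact: measurableT_comp.
- by [].
apply: (integral_operator_ext (L := fun f x => dker f (U x))) => //.
- move=> g mg g0; split; last by move=> x; exact: dker_ge0.
  exact: (measurableT_comp (measurable_dker mg g0)).
- by move=> g h mg mh g0 h0 x; exact: dkerD.
- by move=> c g c0 mg g0 x; exact: dkerZ.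
- by move=> F mF F0 ndF x; exact: dker_nd_lim.
- move=> A mA; rewrite ge0_integral_mrestr.
  + by rewrite /= /mrestr setIC H.
  + apply: (measurableT_comp (measurable_dker _ _)) => //.
    by apply/measurable_EFinP; exact: measurable_indic.
  + by move=> x; exact: dker_ge0.
Qed.

End density_kernel.

(** * Maximal inequality and Birkhoff's theorem *)

Section law.
Context {R : realType} {d d' : measure_display}.
Context {O : measurableType d} {E : measurableType d'}.
Variables (m : {measure set O -> \bar R}) (m' : {measure set E -> \bar R}).
Variable (V : O -> E).
Hypothesis mV : measurable_fun setT V.
Hypothesis lawV : forall A, measurable A -> m (V @^-1` A) = m' A.

Lemma ge0_integral_law f : measurable_fun setT f -> (forall x, 0 <= f x) ->
  \int[m]_x f (V x) = \int[m']_x f x.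
Proof.
move=> mf f0.
rewrite -(ge0_integral_pushforward mV m measurableT mf) => [|x _]; last exact: f0.
by apply: eq_measure_integral => A mA _; exact: lawV.
Qed.

Lemma integrable_law f : m'.-integrable setT f ->
  m.-integrable setT (fun x => f (V x)).
Proof.
move=> /integrableP[mf If]; apply/integrableP; split; first exact: measurableT_comp.
rewrite (ge0_integral_law (f := fun x => `|f x|))//.
exact: measurableT_comp.
Qed.

Lemma integral_law f : m'.-integrable setT f ->
  \int[m]_x f (V x) = \int[m']_x f x.
Proof.
move=> If; have [mf _] := integrableP _ _ _ If.
rewrite -(integral_pushforward mV mf (integrable_law If) measurableT).
by apply: eq_measure_integral => A mA _; exact: lawV.
Qed.

End law.

Lemma bounded_integrable {R : realType} {d} {E : measurableType d}
    (P : probability E R) (f : E -> R) (c : R) :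
  measurable_fun setT f -> (forall x, `|f x| <= c)%R ->
  P.-integrable setT (fun x => (f x)%:E).
Proof.
move=> mf fc; apply: (le_integrable measurableT (g := EFin \o cst c)).
- exact/measurable_EFinP.
- by move=> x _ /=; rewrite lee_fin (le_trans (fc x))// ler_norm.
- exact: finite_measure_integrable_cst.
Qed.

Section ergodic.
Context {R : realType} {d : measure_display} {E : measurableType d}.
Variables (P : probability E R) (T : E -> E).
Hypothesis mT : measurable_fun setT T.
Hypothesis PT : forall A, measurable A -> P (T @^-1` A) = P A.

Definition birkhoff_sum (f : E -> R) (n : nat) (x : E) : R :=
  (\sum_(i < n) f (iter i T x))%R.

Lemma measurable_iter n : measurable_fun setT (iter n T).
Proof. by elim: n => [|n ih]; [exact: measurable_id | exact: (measurableT_comp mT ih)]. Qed.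

Lemma measurable_birkhoff_sum f n : measurable_fun setT f ->
  measurable_fun setT (birkhoff_sum f n).
Proof.
move=> mf; apply: measurable_sum => i.
exact: (measurableT_comp mf (measurable_iter i)).
Qed.

Lemma birkhoff_sumS f n x : birkhoff_sum f n.+1 x = (f x + birkhoff_sum f n (T x))%R.
Proof.
rewrite /birkhoff_sum big_ord_recl/=; congr (_ + _)%R.
by apply: eq_bigr => i _; rewrite /= add0n -iterS iterSr.
Qed.

(* [max_{0 <= n <= N} birkhoff_sum f n], see [birkhoff_sum_le_max] *)
Fixpoint birkhoff_max (f : E -> R) (N : nat) (x : E) : R :=
  if N is N'.+1 then (Num.max 0 (f x + birkhoff_max f N' (T x)))%R else 0%R.

Lemma birkhoff_max_ge0 f N x : (0 <= birkhoff_max f N x)%R.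
Proof. by case: N => //= N; rewrite le_max lexx. Qed.

Lemma birkhoff_max_nd f N x : (birkhoff_max f N x <= birkhoff_max f N.+1 x)%R.
Proof.
elim: N x => [x|N ih x]; first exact: birkhoff_max_ge0.
rewrite /= in ih *; rewrite ge_max le_max lexx/= le_max; apply/orP; right.
by rewrite lerD2l; exact: ih.
Qed.

Lemma birkhoff_max_homo f x : {homo (birkhoff_max f ^~ x) : n m / (n <= m)%N >-> (n <= m)%R}.
Proof. by apply/nondecreasing_seqP => n; exact: birkhoff_max_nd. Qed.

Lemma birkhoff_sum_le_max f n x : (birkhoff_sum f n x <= birkhoff_max f n x)%R.
Proof.
elim: n x => [x|n ih x]; first by rewrite /birkhoff_sum big_ord0.
by rewrite birkhoff_sumS /= le_max lerD2l ih orbT.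
Qed.

Lemma measurable_birkhoff_max f N : measurable_fun setT f ->
  measurable_fun setT (birkhoff_max f N).
Proof.
move=> mf; elim: N => [|N ih]; first exact: measurable_cst.
apply: (measurable_maxr (f := cst 0%R) (g := fun x => (f x + birkhoff_max f N (T x))%R)) => //.
by apply: measurable_funD => //; exact: measurableT_comp.
Qed.

Lemma integrable_birkhoff_max f N : P.-integrable setT (EFin \o f) ->
  P.-integrable setT (EFin \o birkhoff_max f N).
Proof.
move=> If; have [/measurable_EFinP mf _] := integrableP _ _ _ If.
elim: N => [|N ih]; first exact: integrable0.
have IT := integrable_law mT PT ih.
apply: (le_integrable measurableT _ _ (integrableD measurableT
  (integrable_abse If) IT)).
- by apply/measurable_EFinP; exact: measurable_birkhoff_max.
- move=> x _ /=; have M0 := birkhoff_max_ge0 f N (T x).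
  rewrite lee_fin ger0_norm; last by rewrite le_max lexx.
  rewrite [X in (_ <= X)%R]ger0_norm ?addr_ge0//.
  by rewrite ge_max addr_ge0//= lerD2r ler_norm.
Qed.

Local Notation pos_max f N := [set x | (0 < birkhoff_max f N x)%R].

Lemma measurable_pos_max f N : measurable_fun setT f -> measurable (pos_max f N).
Proof.
move=> /(measurable_birkhoff_max N) mM.
rewrite (_ : [set _ | _] = birkhoff_max f N @^-1` `]0%R, +oo[).
  by rewrite -[X in measurable X]setTI; exact: mM.
by apply/seteqP; split=> x /=; rewrite in_itv/= andbT.
Qed.

(* Garsia: on [M_(N+1) > 0] one has [f = M_(N+1) - M_N o T >= M_(N+1) - M_(N+1) o T]. *)
Lemma maximal_ergodic f N : P.-integrable setT (EFin \o f) ->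
  0 <= \int[P]_(x in pos_max f N.+1) (f x)%:E.
Proof.
move=> If; have [/measurable_EFinP mf _] := integrableP _ _ _ If.
have mS := measurable_pos_max N.+1 mf.
have IM := integrable_birkhoff_max N.+1 If.
have IMT := integrable_law mT PT IM.
have -> : 0 = \int[P]_x ((birkhoff_max f N.+1 x)%:E - (birkhoff_max f N.+1 (T x))%:E).
  rewrite integralB_EFin// (integral_law mT PT IM) subee//.
  exact: (integrable_fin_num measurableT IM).
rewrite [leRHS]integral_mkcond; apply: le_integral => //.
- exact: integrableB.
- by rewrite -integrable_mkcond//; exact: integrableS If.
- move=> x _; rewrite patchE; case: ifPn => [/set_mem xM|/negP xM].
    rewrite -EFinB lee_fin; rewrite /= lt_max ltxx/= in xM.
    have := birkhoff_max_nd f N (T x).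
    rewrite [X in (X - _)%R]/= (max_idPr (ltW xM)).
    by move: (birkhoff_max f N.+1 (T x)) => a; lra.
  have {}xM : ~ (0 < birkhoff_max f N.+1 x)%R by move=> H; apply: xM; exact: mem_set.
  have /eqP -> : birkhoff_max f N.+1 x == 0%R.
    by rewrite eq_le birkhoff_max_ge0 andbT leNgt; exact/negP.
  by rewrite (_ : point = 0)// sub0e leeNl oppe0 lee_fin birkhoff_max_ge0.
Qed.

Hypothesis ergT : forall A, measurable A -> T @^-1` A = A -> P A = 0 \/ P A = 1.

(** Unboundedness above of the sums is shift-invariant, hence has probability 0 or 1. If it were 1,
    the indicators of the events in the maximal inequality would increase to 1 almost surely, and in
    the limit the mean of [f] would be nonnegative. *)
Lemma birkhoff_sum_bounded f : P.-integrable setT (EFin \o f) ->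
  \int[P]_x (f x)%:E < 0 ->
  {ae P, forall x, exists M, forall n, (birkhoff_sum f n x <= M)%R}.
Proof.
move=> If Ef; have [/measurable_EFinP mf _] := integrableP _ _ _ If.
pose A := [set x | forall M : nat, exists n, (M%:R < birkhoff_sum f n x)%R].
have mA : measurable A.
  have -> : A = \bigcap_M \bigcup_n [set x | (M%:R < birkhoff_sum f n x)%R].
    apply/seteqP; split => [x Ax M _|x Ax M]; first by have [n ?] := Ax M; exists n.
    by have [n _ ?] := Ax M I; exists n.
  apply: bigcapT_measurable => M; apply: bigcupT_measurable => n.
  rewrite (_ : [set _ | _] = birkhoff_sum f n @^-1` `]M%:R, +oo[).
    by rewrite -[X in measurable X]setTI; exact: measurable_birkhoff_sum.
  by apply/seteqP; split=> x /=; rewrite in_itv/= andbT.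
have AT : T @^-1` A = A.
  apply/seteqP; split => x Ax M.
    (* Going from [T x] to [x] adds [f x] to the sum, so the threshold is lowered by [f x]
       beforehand and rounded up. *)
    have [n Hn] := Ax (Num.truncn (M%:R - f x)).+1; exists n.+1.
    rewrite birkhoff_sumS -ltrBlDl (le_lt_trans _ Hn)//.
    by rewrite ltW// Num.Theory.truncnS_gt.
  have [n Hn] := Ax (Num.truncn (M%:R + `|f x|)).+1.
  case: n Hn => [|n]; first by rewrite /birkhoff_sum big_ord0 ltNge ler0n.
  move=> Hn; exists n.
  rewrite birkhoff_sumS in Hn.
  have := Num.Theory.truncnS_gt (M%:R + `|f x|); have := ler_norm (f x).
  by move: Hn; move: (Num.truncn _).+1%:R => a; lra.
suff PA : P A = 0.
  exists A; split => // x; apply: contra_notP => nA.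
  move: nA => /existsNP[M HM]; exists M%:R => n.
  by rewrite leNgt; apply/negP => ?; apply: HM; exists n.
have [//|PA1] := ergT mA AT; exfalso.
have : 0 <= \int[P]_x (f x)%:E; last by rewrite leNgt Ef.
pose g N x := (f x * \1_(pos_max f N.+1) x)%R.
have [] := @dominated_convergence _ _ _ P setT measurableT (fun N => EFin \o g N)
  (EFin \o f) (fun x => `|(f x)%:E|).
- move=> N; apply/measurable_EFinP/measurable_funM => //.
  exact/measurable_indic/measurable_pos_max.
- exact/measurable_EFinP.
- exists (~` A); split; first exact: measurableC.
    by transitivity (1 - P A); [exact: probability_setC | rewrite PA1 subee].
  move=> x; apply: contra_not => Ax _.
  have {}Ax : A x by apply: contrapT.
  have [n Hn] := Ax 0%N.
  apply: cvg_near_cst; exists n => // N /= nN.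
  rewrite /g indicE mem_set ?mulr1//=.
  apply: (lt_le_trans Hn); apply: (le_trans (birkhoff_sum_le_max _ _ _)).
  exact: (birkhoff_max_homo f x (leq_trans nN (leqnSn N))).
- exact: integrable_abse.
- apply/aeW => x N _ /=; rewrite lee_fin normrM ler_piMr// indicE.
  by case: (_ \in _); rewrite ?normr1 ?normr0.
move=> _ _ cv; apply: (cvge_ge _ cv); apply: nearW => N.
have := maximal_ergodic N If; rewrite integral_mkcond.
rewrite (eq_integral (fun x => (EFin \o g N) x))// => x _.
by rewrite patchE /g /= indicE; case: ifPn => _; rewrite ?mulr1 ?mulr0.
Qed.

Lemma birkhoff_sumB_cst f c n x :
  birkhoff_sum (fun x => f x - c)%R n x = (birkhoff_sum f n x - c * n%:R)%R.
Proof. by rewrite /birkhoff_sum sumrB sumr_const card_ord mulr_natr. Qed.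

Lemma birkhoff_sumN f n x :
  birkhoff_sum (fun x => - f x)%R n x = (- birkhoff_sum f n x)%R.
Proof. by rewrite /birkhoff_sum sumrN. Qed.

(** Both [f - (m + 1/(k+1))] and [(m - 1/(k+1)) - f] have negative mean, so their sums stay bounded
    above; divided by [n], these bounds pinch the averages around [m]. *)
Theorem birkhoff f : P.-integrable setT (EFin \o f) ->
  {ae P, forall x, (birkhoff_sum f n x / n%:R)%R @[n --> \oo] -->
     fine (\int[P]_x (f x)%:E)}.
Proof.
move=> If; have [/measurable_EFinP mf _] := integrableP _ _ _ If.
set m := fine _.
have mE : \int[P]_x (f x)%:E = m%:E by rewrite fineK// (integrable_fin_num measurableT If).
have Ic (c : R) : P.-integrable setT (EFin \o cst c) by exact: finite_measure_integrable_cst.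
have intc (c : R) : \int[P]_x c%:E = c%:E.
  by rewrite integral_cst//= probability_setT mule1.
have IB (c : R) : \int[P]_x (f x - c)%:E = (m - c)%:E.
  transitivity (\int[P]_x (f x)%:E - \int[P]_x c%:E); last by rewrite mE intc.
  under eq_integral do rewrite EFinB.
  exact: (integralB measurableT If (Ic c)).
have up k : {ae P, forall x, exists M, forall n,
    (birkhoff_sum (fun x => f x - (m + k.+1%:R^-1)) n x <= M)%R}.
  apply: birkhoff_sum_bounded; first exact: (integrableB measurableT If (Ic _)).
  rewrite IB lte_fin.
  by have : (0 < k.+1%:R^-1 :> R)%R by []; move: (k.+1%:R^-1)%R => e; lra.
have lo k : {ae P, forall x, exists M, forall n,
    (birkhoff_sum (fun x => - (f x - (m - k.+1%:R^-1))) n x <= M)%R}.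
  apply: birkhoff_sum_bounded.
    exact: (integrableN (integrableB measurableT If (Ic _))).
  rewrite (_ : \int[P]_x _ = - \int[P]_x (f x - (m - k.+1%:R^-1))%:E).
    rewrite IB -EFinN lte_fin.
    by have : (0 < k.+1%:R^-1 :> R)%R by []; move: (k.+1%:R^-1)%R => e; lra.
  rewrite -integralN//.
  by apply: integrable_add_def => //; exact: (integrableB measurableT If (Ic _)).
move: up lo => /ae_foralln + /ae_foralln; apply: filterS2 => x Hu Hl.
apply/cvgrPdist_le => e e0.
have [k ke] : exists k, (k.+1%:R^-1 <= e / 2)%R.
  exists (Num.truncn (e / 2)^-1).
  rewrite -[leRHS]invrK lef_pV2 ?posrE ?invr_gt0 ?divr_gt0//.
  by rewrite ltW// Num.Theory.truncnS_gt.
have [M1 H1] := Hu k; have [M2 H2] := Hl k.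
pose M := (`|M1| + `|M2|)%R.
near=> n.
have n0 : (0 < n%:R :> R)%R by rewrite ltr0n; near: n; exists 1%N.
have Mn : (M <= e / 2 * n%:R)%R.
  rewrite mulrC -ler_pdivrMr ?divr_gt0//.
  near: n; exists (Num.truncn (M / (e / 2))).+1 => // n /= Hn.
  rewrite ltW// (lt_le_trans (Num.Theory.truncnS_gt _))// ler_nat.
  exact: Hn.
have := H1 n; have := H2 n.
rewrite birkhoff_sumN !birkhoff_sumB_cst => h2 h1.
have kn : (k.+1%:R^-1 * n%:R <= e / 2 * n%:R)%R by rewrite ler_wpM2r// ltW.
have m1 : (M1 <= M)%R by rewrite /M (le_trans (ler_norm _))// lerDl.
have m2 : (M2 <= M)%R by rewrite /M (le_trans (ler_norm _))// lerDr.
have : (birkhoff_sum f n x = birkhoff_sum f n x / n%:R * n%:R)%R by rewrite mulfVK// gt_eqF.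
move: (_ / _)%R => r Sr; rewrite Sr in h1 h2.
move: (k.+1%:R^-1%R) (n%:R : R) n0 (le_trans m1 Mn) (le_trans m2 Mn) h1 h2 kn => a N N0 n1 n2 h1 h2 kn.
by rewrite ler_norml; apply/andP; split; rewrite -(ler_pM2r N0); lra.
Unshelve. all: by end_near.
Qed.

Lemma birkhoff_L1 (f : E -> R) : measurable_fun setT f -> (forall x, (0 <= f x <= 1)%R) ->
  \int[P]_x `|birkhoff_sum f n x / n%:R - fine (\int[P]_x (f x)%:E)|%:E
    @[n --> \oo] --> 0.
Proof.
move=> mf f01; set m := fine _.
have If : P.-integrable setT (EFin \o f).
  apply: (@bounded_integrable _ _ _ _ _ 1%R) => // x.
  by have /andP[? ?] := f01 x; rewrite ger0_norm.
have [] := @dominated_convergence _ _ _ P setT measurableT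
  (fun n x => (birkhoff_sum f n x / n%:R)%:E) (cst m%:E) (cst 1).
- move=> n; apply/measurable_EFinP/measurable_funM => //.
  exact: measurable_birkhoff_sum.
- exact: measurable_cst.
- apply: filterS (birkhoff If) => x Hx _; by apply: (cvg_EFin _ Hx); exact: nearW.
- exact: finite_measure_integrable_cst.
- apply/aeW => x n _; rewrite lee_fin ger0_norm.
    case: n => [|n]; first by rewrite invr0 mulr0.
    rewrite ler_pdivrMr// mul1r /birkhoff_sum.
    apply: (@le_trans _ _ (\sum_(i < n.+1) 1)%R).
      by apply: ler_sum => i _; have /andP[] := f01 (iter i T x).
    by rewrite sumr_const card_ord.
  apply: divr_ge0 => //; apply: sumr_ge0 => i _.
  by have /andP[] := f01 (iter i T x).
by [].
Qed.

End ergodic.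

(** * Path spaces *)

Section density_kernel_measure.
Context {R : realType} {dZ dX dY d : measure_display}.
Context {Z : measurableType dZ} {X : measurableType dX} {Y : measurableType dY}.
Context {O : measurableType d}.
Variables (mu : probability X R) (nu : {sigma_finite_measure set Y -> \bar R}).
Variables (phi : Z -> X * Y -> Z) (rho : Z -> X * Y -> R).
Hypothesis mphi : measurable_fun [set: Z * (X * Y)] (fun u => phi u.1 u.2).
Hypothesis mrho : measurable_fun [set: Z * (X * Y)] (fun u => rho u.1 u.2).
Hypothesis rho0 : forall z w, (0 <= rho z w)%R.
Hypothesis rho1 : forall z, \int[mu \x nu]_w (rho z w)%:E = 1.
Variables (m : {measure set O -> \bar R}) (U : O -> Z).
Hypothesis mU : measurable_fun setT U.

Local Notation K := (dker mu nu phi rho).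

Lemma kernel_massE z A : measurable A ->
  kernel_mass K z A = \int[mu \x nu]_(w in phi z @^-1` A) (rho z w)%:E.
Proof.
move=> mA; rewrite [RHS]integral_mkcond; apply: eq_integral => w _.
rewrite patchE (_ : (w \in phi z @^-1` A) = (phi z w \in A))// indicE.
by case: ifPn => _; rewrite ?mul1e ?mul0e.
Qed.

Lemma measurable_kernel_mass A : measurable A ->
  measurable_fun setT (fun z => kernel_mass K z A).
Proof.
move=> mA; apply: measurable_dker => //.
by apply/measurable_EFinP; exact: measurable_indic.
Qed.

Lemma kernel_mass_ge0 z A : 0 <= kernel_mass K z A.
Proof. exact: dker_ge0. Qed.

Lemma kernel_mass_bigcup z (F : nat -> set Z) : (forall n, measurable (F n)) ->
  trivIset setT F -> kernel_mass K z (\bigcup_n F n) = \sum_(0 <= n <oo) kernel_mass K z (F n).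
Proof.
move=> mF tF.
have mphiz : measurable_fun setT (phi z).
  exact: (measurableT_comp mphi (measurable_pair1 z)).
rewrite kernel_massE ?preimage_bigcup; last exact: bigcupT_measurable.
rewrite ge0_integral_bigcup//.
- by apply: eq_eseriesr => n _; rewrite kernel_massE.
- by move=> n; rewrite -[X in measurable X]setTI; exact: mphiz.
- apply/measurable_EFinP/measurable_funTS.
  exact: (measurableT_comp mrho (measurable_pair1 z)).
- by move=> w _; rewrite lee_fin.
- move=> i j _ _ [w [Fi Fj]]; apply: (tF i j) => //; by exists (phi z w).
Qed.

(** The law of the state one step after [U]. It is made a measure so that an identity between laws
    can be checked on a generating pi-system. *)
Definition dker_measure (A : set Z) : \bar R := \int[m]_w kernel_mass K (U w) A.

Let dker_measure0 : dker_measure set0 = 0.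
Proof.
rewrite /dker_measure; under eq_integral do rewrite kernel_massE// preimage_set0 integral_set0.
exact: integral0.
Qed.

Let dker_measure_ge0 A : 0 <= dker_measure A.
Proof. by apply: integral_ge0 => w _; exact: kernel_mass_ge0. Qed.

Lemma dker_measure_bigcup (F : nat -> set Z) : (forall n, measurable (F n)) ->
  trivIset setT F ->
  dker_measure (\bigcup_n F n) = \sum_(0 <= n <oo) dker_measure (F n).
Proof.
move=> mF tF; rewrite /dker_measure.
under eq_integral do rewrite kernel_mass_bigcup//.
rewrite integral_nneseries// => n.
- exact: measurableT_comp (measurable_kernel_mass (mF n)) mU.
- by move=> x _; exact: kernel_mass_ge0.
Qed.

Let dker_measure_additive : semi_sigma_additive dker_measure.
Proof.
move=> F mF tF _; rewrite dker_measure_bigcup//.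
by apply: is_cvg_nneseries => n _ _; exact: dker_measure_ge0.
Qed.

Definition dker_measureM : {measure set Z -> \bar R} :=
  HB.pack dker_measure (isMeasure.Build _ _ _ dker_measure
    dker_measure0 dker_measure_ge0 dker_measure_additive).

End density_kernel_measure.

Section paths.
Context {d : measure_display}.

Definition coord_sets (I : Type) (T : measurableType d) : set (set (I -> T)) :=
  [set C | exists k A, measurable A /\ C = (fun y => y k) @^-1` A].

End paths.

Notation paths I T := (g_sigma_algebraType (@coord_sets _ I T)).

Section paths_theory.
Context {d : measure_display} {I : Type} {T : measurableType d}.

Lemma measurable_coord (k : I) : measurable_fun setT (fun y : paths I T => y k).
Proof.
move=> _ A mA; rewrite setTI; apply: sub_sigma_algebra.
by exists k, A.
Qed.

Lemma measurable_to_paths {d'} {U : measurableType d'} (f : U -> paths I T) :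
  (forall k, measurable_fun setT (fun u => f u k)) -> measurable_fun setT f.
Proof.
move=> mf; refine (@measurability _ _ U (paths I T) setT f (@coord_sets _ I T) _ _) => //.
move=> _ [_ [k [A [mA ->]]] <-]; rewrite setTI.
by rewrite -[X in measurable X]setTI; exact: mf.
Qed.

End paths_theory.

Section paths_measure_unique.
Context {R : realType} {d : measure_display} {T : measurableType d}.

Let rect_sets : set (set (paths int T)) := [set C | exists (B : int -> set T) (N : nat),
  [/\ forall i, measurable (B i), forall i, (N < `|i|)%N -> B i = setT &
      C = [set e | forall i, B i (e i)]]].

Let measurable_rect_sets : measurable = <<s rect_sets >>.
Proof.
apply/seteqP; split.
  apply: smallest_sub; first exact: smallest_sigma_algebra.
  move=> _ [k [A [mA ->]]]; apply: sub_sigma_algebra.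
  exists (fun i => if i == k then A else setT), `|k|%N; split.
  - by move=> i; case: ifP.
  - by move=> i; case: ifP => // /eqP ->; rewrite ltnn.
  - apply/seteqP; split => e /=.
      by move=> Ae i; case: ifP => // /eqP ->.
    by move=> /(_ k); rewrite eqxx.
apply: smallest_sub; first exact: sigma_algebra_measurable.
move=> _ [B [N [mB BT ->]]].
have mBi i : measurable ((fun e : paths int T => e i) @^-1` B i).
  by rewrite -[X in measurable X]setTI; exact: measurable_coord.
rewrite (_ : [set _ | _] = \bigcap_n ((fun e : paths int T => e (Posz n)) @^-1` B (Posz n) `&`
    (fun e : paths int T => e (Negz n)) @^-1` B (Negz n))).
  by apply: bigcapT_measurable => n; exact: measurableI.
by apply/seteqP; split => [e H n _|e H [n|n]]; [split; exact: H|exact: (H n I).1|exact: (H n I).2].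
Qed.

Lemma paths_measure_unique (m1 m2 : {measure set (paths int T) -> \bar R}) : m1 setT < +oo ->
  (forall (B : int -> set T) (N : nat), (forall i, measurable (B i)) ->
     (forall i, (N < `|i|)%N -> B i = setT) ->
     m1 [set e | forall i, B i (e i)] = m2 [set e | forall i, B i (e i)]) ->
  forall A, measurable A -> m1 A = m2 A.
Proof.
move=> m1fin m12.
apply: (measure_unique rect_sets (fun=> setT) measurable_rect_sets) => //.
- move=> _ _ [B [N [mB BT ->]]] [B' [N' [mB' BT' ->]]].
  exists (fun i => B i `&` B' i), (maxn N N'); split.
  + by move=> i; exact: measurableI.
  + by move=> i; rewrite gtn_max => /andP[? ?]; rewrite BT ?BT' ?setTI.
  + by apply/seteqP; split => e /=; [move=> [? ?] i; split|move=> H; split => i; have [] := H i].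
- by move=> _; exists (fun=> setT), 0%N; split => //; apply/seteqP; split.
- by rewrite bigcup_const//; exists 0%N.
- by move=> _ [B [N [mB BT ->]]]; exact: m12 BT.
Qed.

End paths_measure_unique.

(** Histories are read backwards in time, with the latest observation at index 0: [consp] records a
    new observation, and [dropp n] goes [n] steps into the past. *)
Definition consp {T : Type} (y : T) (h : nat -> T) (j : nat) : T :=
  if j is j'.+1 then h j' else y.

Definition dropp {T : Type} (n : nat) (h : nat -> T) (j : nat) : T := h (n + j)%N.

Definition lag {T : Type} (s : nat) (h : nat -> T) : s.-tuple T :=
  [tuple h i | i < s].

(* pads with the most recent value beyond the lag window *)
Definition ext {T : Type} (s : nat) (t : s.+1.-tuple T) : nat -> T :=
  fun j => nth (thead t) t j.

Lemma ext_lag {T : Type} (s : nat) (h : nat -> T) j : (j < s.+1)%N ->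
  ext (lag s.+1 h) j = h j.
Proof.
move=> js; rewrite /ext (_ : j = Ordinal js)// -tnth_nth tnth_mktuple//.
Qed.

Lemma dropp0 {T : Type} (h : nat -> T) : dropp 0 h = h.
Proof. by []. Qed.

Lemma droppD {T : Type} n m (h : nat -> T) : dropp n (dropp m h) = dropp (m + n) h.
Proof. by apply/funext => j; rewrite /dropp addnA. Qed.

Lemma consp_dropp {T : Type} (h : nat -> T) : consp (h 0%N) (dropp 1 h) = h.
Proof. by apply/funext => -[]. Qed.

Lemma tnth_push {T : Type} s (y : T) (t : s.-tuple T) (i : 'I_s) :
  tnth (push y t) i = tnth [tuple of y :: t] (widen_ord (leqnSn s) i).
Proof.
rewrite !(tnth_nth y)/= lastI nth_rcons size_belast size_tuple.
by rewrite ltn_ord.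
Qed.

Lemma lag_consp {T : Type} (s : nat) (y : T) (h : nat -> T) :
  lag s (consp y h) = push y (lag s h).
Proof.
apply: eq_from_tnth => i; rewrite tnth_push tnth_mktuple (tnth_nth y)/=.
case: i => -[|i] //= si.
by rewrite (nth_map (Ordinal (ltnW si))) ?size_enum_ord ?nth_enum_ord// ltnW.
Qed.

Section path_measurability.
Context {d : measure_display} {T : measurableType d}.

Lemma measurable_consp :
  measurable_fun setT (fun u : T * paths nat T => consp u.1 u.2 : paths nat T).
Proof.
apply: measurable_to_paths => -[|k] /=; first exact: measurable_fst.
exact: (measurableT_comp (measurable_coord k) measurable_snd).
Qed.

Lemma measurable_dropp n :
  measurable_fun setT (dropp n : paths nat T -> paths nat T).
Proof. by apply: measurable_to_paths => k; exact: measurable_coord. Qed.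

Lemma measurable_lag s : measurable_fun setT (lag s : paths nat T -> s.-tuple T).
Proof.
apply/measurable_fun_tnthP => i.
rewrite (_ : _ \o _ = fun h : paths nat T => h i); first exact: measurable_coord.
by apply/funext => h /=; rewrite tnth_mktuple.
Qed.

Lemma measurable_thead s : measurable_fun setT (fun t : s.+1.-tuple T => thead t).
Proof. exact: measurable_tnth. Qed.

Lemma measurable_ext s : measurable_fun setT (fun t : s.+1.-tuple T => ext t : paths nat T).
Proof.
apply: measurable_to_paths => k; rewrite /ext.
have [ks|ks] := ltnP k s.+1.
  rewrite (_ : (fun _ => _) = fun t => tnth t (Ordinal ks)); first exact: measurable_tnth.
  by apply/funext => t; rewrite (tnth_nth (thead t)).
rewrite (_ : (fun _ => _) = fun t => thead t); first exact: measurable_thead.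
by apply/funext => t; rewrite nth_default// size_tuple.
Qed.

Lemma measurable_push s :
  measurable_fun setT (fun u : T * s.-tuple T => push u.1 u.2).
Proof.
apply/measurable_fun_tnthP => i.
rewrite (_ : _ \o _ = fun u : T * s.-tuple T => tnth [the s.+1.-tuple T of u.1 :: u.2] (widen_ord (leqnSn s) i)).
  apply: (measurableT_comp (measurable_tnth _)).
  exact: measurable_cons.
by apply/funext => u /=; rewrite tnth_push.
Qed.

End path_measurability.

(** * The chain recording the whole past of the observations *)

Section ar_chain.
Context {R : realType} {dX dY : measure_display}.
Context {X : measurableType dX} {Y : measurableType dY} {s : nat}.
Variables (mu : probability X R) (nu : {sigma_finite_measure set Y -> \bar R}).
Variables (q : X -> X -> R) (g : s.+1.-tuple Y -> X -> Y -> R).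

Definition ar_density : Prop :=
  [/\ measurable_fun [set: X * X] (fun z => q z.1 z.2),
      forall x x', (0 <= q x x')%R,
      forall x, \int[mu]_x' (q x x')%:E = 1,
      measurable_fun [set: s.+1.-tuple Y * X * Y] (fun z => g z.1.1 z.1.2 z.2) &
      (forall yb x y, (0 <= g yb x y)%R) /\
      forall yb x, \int[nu]_y (g yb x y)%:E = 1].

Hypothesis qgP : ar_density.

Local Notation Z := (X * s.+1.-tuple Y)%type.
Local Notation S := (X * paths nat Y)%type.
Local Notation E := (paths int (X * Y)%type).

Definition lagS (u : S) : Z := (u.1, lag s.+1 u.2).

Definition phiZ (z : Z) (w : X * Y) : Z := (w.1, push w.2 z.2).
Definition rhoZ (z : Z) (w : X * Y) : R := (q z.1 w.1 * g z.2 w.1 w.2)%R.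
(** The chain on [S] never forgets an observation, so that a function of arbitrarily many
    observations is a function of its current state. *)
Definition phiS (u : S) (w : X * Y) : S := (w.1, consp w.2 u.2).
Definition rhoS (u : S) (w : X * Y) : R := rhoZ (lagS u) w.

Definition kerZ : (Z -> \bar R) -> Z -> \bar R := dker mu nu phiZ rhoZ.
Definition kerS : (S -> \bar R) -> S -> \bar R := dker mu nu phiS rhoS.

Lemma measurable_phiZ : measurable_fun [set: Z * (X * Y)] (fun u => phiZ u.1 u.2).
Proof.
apply: measurable_fun_pair; first exact: (measurableT_comp measurable_fst measurable_snd).
apply: (measurableT_comp (f := fun u : Y * s.+1.-tuple Y => push u.1 u.2)
  (g := fun u : Z * (X * Y) => (u.2.2, u.1.2))); first exact: measurable_push.
by apply: measurable_fun_pair; exact: (measurableT_comp measurable_snd).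
Qed.

Lemma measurable_rhoZ : measurable_fun [set: Z * (X * Y)] (fun u => rhoZ u.1 u.2).
Proof.
have [mq _ _ mg _] := qgP; apply: measurable_funM.
  apply: (measurableT_comp mq (g := fun u : Z * (X * Y) => (u.1.1, u.2.1))).
  by apply: measurable_fun_pair; exact: (measurableT_comp measurable_fst).
apply: (measurableT_comp mg (g := fun u : Z * (X * Y) => (u.1.2, u.2.1, u.2.2))).
apply: measurable_fun_pair; last exact: (measurableT_comp measurable_snd).
apply: measurable_fun_pair; first exact: (measurableT_comp measurable_snd).
exact: (measurableT_comp measurable_fst).
Qed.

Lemma rhoZ_ge0 z w : (0 <= rhoZ z w)%R.
Proof. by have [_ q0 _ _ [g0 _]] := qgP; rewrite mulr_ge0. Qed.

Lemma rhoZ_int1 z : \int[mu \x nu]_w (rhoZ z w)%:E = 1.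
Proof.
have [mq q0 q1 mg [g0 g1]] := qgP.
rewrite fubini_tonelli1; last 2 first.
- by apply/measurable_EFinP; exact: (measurableT_comp measurable_rhoZ (measurable_pair1 z)).
- by move=> w; rewrite lee_fin rhoZ_ge0.
rewrite -(q1 z.1); apply: eq_integral => x _; rewrite /fubini_F /rhoZ/=.
under eq_integral do rewrite EFinM.
rewrite ge0_integralZl ?g1 ?mule1//.
- apply/measurable_EFinP.
  exact: (measurableT_comp mg (measurable_pair1 (z.2, x))).
- by move=> y _; rewrite lee_fin.
- by rewrite lee_fin.
Qed.

Lemma measurable_lagS : measurable_fun setT lagS.
Proof.
apply: measurable_fun_pair; first exact: measurable_fst.
apply: (measurableT_comp (f := lag s.+1 : paths nat Y -> s.+1.-tuple Y) (g := snd)).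
  exact: measurable_lag.
exact: measurable_snd.
Qed.

Lemma measurable_phiS : measurable_fun [set: S * (X * Y)] (fun u => phiS u.1 u.2).
Proof.
apply: measurable_fun_pair; first exact: (measurableT_comp measurable_fst measurable_snd).
apply: (measurableT_comp (f := fun u : Y * paths nat Y => consp u.1 u.2 : paths nat Y)
  (g := fun u : S * (X * Y) => (u.2.2, u.1.2))); first exact: measurable_consp.
by apply: measurable_fun_pair; exact: (measurableT_comp measurable_snd).
Qed.

Lemma measurable_rhoS : measurable_fun [set: S * (X * Y)] (fun u => rhoS u.1 u.2).
Proof.
apply: (measurableT_comp measurable_rhoZ (g := fun u : S * (X * Y) => (lagS u.1, u.2))).
apply: measurable_fun_pair; last exact: measurable_snd.
exact: (measurableT_comp measurable_lagS measurable_fst).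
Qed.

Lemma rhoS_ge0 u w : (0 <= rhoS u w)%R. Proof. exact: rhoZ_ge0. Qed.

Lemma rhoS_int1 u : \int[mu \x nu]_w (rhoS u w)%:E = 1.
Proof. exact: rhoZ_int1. Qed.

(** The density of a step sees the history through [lagS] only, so [lagS] maps the large chain onto
    the small one. *)
Lemma kerS_lagS (f : Z -> \bar R) u : kerS (f \o lagS) u = kerZ f (lagS u).
Proof.
apply: eq_integral => w _; congr (f _ * _).
by rewrite /phiS /phiZ /lagS/= lag_consp.
Qed.

Lemma kerS_dropp (F : paths nat Y -> \bar R) u : (forall h, 0 <= F h) ->
  kerS (fun v => F (dropp 1 v.2)) u = F u.2.
Proof.
move=> F0; rewrite -[RHS](dker_cst phiS measurable_rhoS rhoS_ge0 rhoS_int1 (F0 _) u).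
by [].
Qed.

Lemma kerS_ge0 f u : (forall x, 0 <= f x) -> 0 <= kerS f u.
Proof. by move=> f0; apply: dker_ge0 => //; exact: rhoS_ge0. Qed.

Lemma measurable_kerS f : measurable_fun setT f -> (forall x, 0 <= f x) ->
  measurable_fun setT (kerS f).
Proof.
by apply: measurable_dker; [exact: measurable_phiS|exact: measurable_rhoS|exact: rhoS_ge0].
Qed.

Lemma kerZ_ge0 f u : (forall x, 0 <= f x) -> 0 <= kerZ f u.
Proof. by move=> f0; apply: dker_ge0 => //; exact: rhoZ_ge0. Qed.

Lemma measurable_kerZ f : measurable_fun setT f -> (forall x, 0 <= f x) ->
  measurable_fun setT (kerZ f).
Proof.
by apply: measurable_dker; [exact: measurable_phiZ|exact: measurable_rhoZ|exact: rhoZ_ge0].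
Qed.

Definition past_obs (e : E) (k : int) : paths nat Y := fun j => (e (k - j%:Z)%R).2.
Definition stateS (k : int) (e : E) : S := ((e k).1, past_obs e k).
Definition stateZ (k : int) (e : E) : Z := lagS (stateS k e).

Definition past_gen (k : int) : set (set E) :=
  [set C | exists j A, [/\ (j <= k)%R, measurable A & C = (fun e => e j) @^-1` A]].

Local Notation pastE k := (g_sigma_algebraType (past_gen k)).

Lemma measurable_past_coord k j : (j <= k)%R ->
  measurable_fun [set: pastE k] (fun e : pastE k => (e : E) j).
Proof.
move=> jk _ A mA; rewrite setTI; apply: sub_sigma_algebra.
by exists j, A.
Qed.

Lemma measurable_past_obs k : measurable_fun [set: pastE k]
  (fun e : pastE k => past_obs e k).
Proof.
apply: measurable_to_paths => j.
apply: (measurableT_comp measurable_snd); apply: measurable_past_coord.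
by rewrite gerBl.
Qed.

Lemma measurable_past_stateS k : measurable_fun [set: pastE k] (stateS k : pastE k -> S).
Proof.
apply: measurable_fun_pair; last exact: measurable_past_obs.
exact: (measurableT_comp measurable_fst (measurable_past_coord (lexx k))).
Qed.

Lemma past_measurable k C : <<s past_gen k >> C -> measurable (C : set E).
Proof.
apply: smallest_sub; first exact: sigma_algebra_measurable.
move=> _ [j [A [_ mA ->]]].
by rewrite -[X in measurable X]setTI; exact: measurable_coord.
Qed.

Lemma past_sub k l : (k <= l)%R -> <<s past_gen k >> `<=` <<s past_gen l >>.
Proof.
move=> kl; apply: smallest_sub; first exact: smallest_sigma_algebra.
move=> _ [j [A [jk mA ->]]]; apply: sub_sigma_algebra.
by exists j, A; rewrite (le_trans jk).
Qed.

Lemma pastI k C D : <<s past_gen k >> C -> <<s past_gen k >> D ->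
  <<s past_gen k >> (C `&` D).
Proof. exact: (@measurableI _ (pastE k)). Qed.

Lemma measurable_stateS k : measurable_fun setT (stateS k).
Proof.
move=> mT A mA; rewrite setTI; apply: (@past_measurable k).
by rewrite -[X in <<s _ >> X]setTI; exact: measurable_past_stateS.
Qed.

Lemma measurable_stateZ k : measurable_fun setT (stateZ k).
Proof. exact: (measurableT_comp measurable_lagS (measurable_stateS k)). Qed.

Lemma past_stateS k A : measurable A -> <<s past_gen k >> (stateS k @^-1` A).
Proof.
by move=> mA; rewrite -[X in <<s _ >> X]setTI; exact: measurable_past_stateS.
Qed.

Lemma past_coord k j A : (j <= k)%R -> measurable A ->
  <<s past_gen k >> ((fun e : E => e j) @^-1` A).
Proof. by move=> jk mA; apply: sub_sigma_algebra; exists j, A. Qed.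

Definition markov (m : {measure set E -> \bar R}) : Prop :=
  forall k C A, <<s past_gen k >> C -> measurable A ->
    m (C `&` stateZ (k + 1)%R @^-1` A) = \int[m]_(e in C) kernel_mass kerZ (stateZ k e) A.

Section markov_property.
Variable m : {measure set E -> \bar R}.
Hypothesis markov_m : markov m.

Lemma markovZ k C f : <<s past_gen k >> C -> measurable_fun setT f ->
  (forall x, 0 <= f x) ->
  \int[m]_(e in C) f (stateZ (k + 1)%R e) = \int[m]_(e in C) kerZ f (stateZ k e).
Proof.
move=> Ck mf f0; apply: (dker_transfer measurable_phiZ measurable_rhoZ rhoZ_ge0) => //.
- exact: past_measurable Ck.
- exact: measurable_stateZ.
- exact: measurable_stateZ.
- by move=> A mA; exact: markov_m.
Qed.

Lemma past_obsS e k : past_obs e (k + 1)%R = consp (e (k + 1)%R).2 (past_obs e k).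
Proof.
apply/funext => -[|j] /=; rewrite /past_obs ?subr0//.
by congr (e _).2; rewrite -addn1 PoszD; ring.
Qed.

Hypothesis mfin : m setT < +oo.

Let split_state (u : S) : (X * Y) * paths nat Y := ((u.1, u.2 0%N), dropp 1 u.2).
Let join_state (v : (X * Y) * paths nat Y) : S := (v.1.1, consp v.1.2 v.2).

Let split_stateK : cancel split_state join_state.
Proof. by move=> [x h]; rewrite /join_state/= consp_dropp. Qed.

Let measurable_split : measurable_fun setT split_state.
Proof.
apply: measurable_fun_pair.
  apply: measurable_fun_pair; first exact: measurable_fst.
  exact: (measurableT_comp (measurable_coord 0%N) measurable_snd).
exact: (measurableT_comp (measurable_dropp 1) measurable_snd).
Qed.

Let measurable_join : measurable_fun setT join_state.
Proof.
apply: measurable_fun_pair; first exact: (measurableT_comp measurable_fst measurable_fst).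
apply: (measurableT_comp (f := fun u : Y * paths nat Y => consp u.1 u.2 : paths nat Y)
  (g := fun v : (X * Y) * paths nat Y => (v.1.2, v.2))); first exact: measurable_consp.
apply: measurable_fun_pair; last exact: measurable_snd.
exact: (measurableT_comp measurable_snd measurable_fst).
Qed.

(** The next history is the current one, known at time [k], with a new observation in front. It
    therefore suffices to treat events that constrain the new pair and the old history separately,
    and the second constraint can be moved into the past event. *)
Lemma markovS k C f : <<s past_gen k >> C -> measurable_fun setT f ->
  (forall x, 0 <= f x) ->
  \int[m]_(e in C) f (stateS (k + 1)%R e) = \int[m]_(e in C) kerS f (stateS k e).
Proof.
move=> Ck mf f0; have mC := past_measurable Ck.
apply: (dker_transfer measurable_phiS measurable_rhoS rhoS_ge0) => //.
- exact: measurable_stateS.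
- exact: measurable_stateS.
have mm : mrestr m mC setT < +oo.
  apply: le_lt_trans mfin; rewrite /mrestr setTI.
  by apply: le_measure => //; apply/mem_set.
pose mr : {measure set E -> \bar R} := mrestr m mC.
pose m2 := dker_measureM mu nu measurable_phiS measurable_rhoS rhoS_ge0 mr (measurable_stateS k).
pose G := [set split_state @^-1` (A `*` B) | A in measurable & B in measurable].
(* Splitting a state into its newest pair and its older history is a measurable bijection with
   measurable inverse, so rectangles in the split coordinates generate. *)
have mG : measurable `<=` <<s G >>.
  move=> A mA; have -> : A = split_state @^-1` (join_state @^-1` A).
    by apply/seteqP; split => u; rewrite /preimage/= split_stateK.
  have : measurable (join_state @^-1` A).
    by rewrite -[X in measurable X]setTI; exact: measurable_join.
  rewrite measurable_prod_measurableType.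
  suff H : <<s [set B `*` D | B in measurable & D in measurable] >> `<=`
      image_set_system setT split_state <<s G >>.
    by move=> /H; rewrite /image_set_system/= setTI.
  apply: smallest_sub; first exact/sigma_algebra_image/smallest_sigma_algebra.
  move=> _ [B mB [D mD <-]]; rewrite /image_set_system/= setTI.
  by apply: sub_sigma_algebra; exists B => //; exists D.
have Gm : G `<=` measurable.
  move=> _ [A mA [B mB <-]]; rewrite -[X in measurable X]setTI.
  by apply: measurable_split => //; exact: measurableX.
have mE : measurable = <<s G >>.
  apply/seteqP; split => //; apply: smallest_sub => //; exact: sigma_algebra_measurable.
move=> A mA.
have -> : \int[m]_(e in C) kernel_mass (dker mu nu phiS rhoS) (stateS k e) A = m2 A.
  rewrite -ge0_integral_mrestr//.
  - apply: (measurableT_comp _ (measurable_stateS k)).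
    exact: (measurable_kernel_mass mu nu measurable_phiS measurable_rhoS rhoS_ge0).
  - by move=> e; apply: kernel_mass_ge0; exact: rhoS_ge0.
have -> : m (C `&` stateS (k + 1)%R @^-1` A) = pushforward mr (stateS (k + 1)%R) A.
  by rewrite /pushforward /mr /= /mrestr setIC.
apply: (measure_unique G (fun=> setT) mE) => //.
- move=> _ _ [A1 mA1 [B1 mB1 <-]] [A2 mA2 [B2 mB2 <-]].
  exists (A1 `&` A2); first exact: measurableI.
  exists (B1 `&` B2); first exact: measurableI.
  by rewrite setXI.
- by move=> _; exists setT => //; exists setT => //; rewrite setXTT.
- by rewrite bigcup_const//; exists 0%N.
- exact: measurable_stateS.
- move=> ? _ [D mD [B mB <-]].
  (* The head of the lag window is the newest observation, so the constraint on the new pair is an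
     event of the small chain. *)
  pose D' := [set z : Z | D (z.1, thead z.2)].
  have mD' : measurable D'.
    rewrite -[X in measurable X]setTI.
    apply: (measurable_fun_pair measurable_fst (measurableT_comp (measurable_thead (s := s)) measurable_snd)) => //.
  pose C' := C `&` (stateS k @^-1` [set u : S | B u.2]).
  have C'k : <<s past_gen k >> C'.
    apply: pastI => //; apply: past_stateS.
    by rewrite -[X in measurable X]setTI; exact: measurable_snd.
  transitivity (m (C' `&` stateZ (k + 1)%R @^-1` D')).
    rewrite /pushforward /mr/= /mrestr; congr (m _).
    rewrite setIC -setIA; congr (_ `&` _); apply/seteqP; split => e.
      move=> [/= De Be]; split => /=.
        by move: Be; rewrite past_obsS.
      by rewrite /D'/= /thead tnth_mktuple.
    move=> [/= Be De]; split => /=; last by rewrite past_obsS.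
    by move: De; rewrite /D'/= /thead tnth_mktuple.
  rewrite markov_m// /m2/= /dker_measure.
  rewrite ge0_integral_mrestr; last 2 first.
  + apply: (measurableT_comp _ (measurable_stateS k)).
    apply: (measurable_kernel_mass mu nu measurable_phiS measurable_rhoS rhoS_ge0) => //.
    by apply: Gm; exists D => //; exists B.
  + by move=> e; apply: kernel_mass_ge0; exact: rhoS_ge0.
  rewrite /C' integral_mkcondr; apply: eq_integral => e _.
  rewrite patchE; case: ifPn => [/set_mem Be|/negP nBe].
    rewrite -[LHS](kerS_lagS (fun w => (\1_D' w)%:E) (stateS k e)); apply: eq_integral => w _; congr (_ * _).
    rewrite /= !indicE; congr (_%:R%:E); congr (nat_of_bool _).
    apply/idP/idP => /set_mem Dw; apply/mem_set.
      by split => //; move: Dw; rewrite /D'/= /thead tnth_mktuple.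
    by case: Dw => Dw _; rewrite /D'/= /thead tnth_mktuple.
  (* If the old history violates [B], no successor lies in the rectangle. *)
  apply/esym; rewrite (_ : point = 0)//; apply: integral0_eq => w _.
  rewrite indicE memNset ?mul0e// => -[_ Be]; apply: nBe; exact/mem_set.
Qed.

End markov_property.

End ar_chain.

(** * Uniqueness and ergodicity of the stationary law *)

Section approximation.
Context {R : realType} {d : measure_display} {T : measurableType d}.
Variables (P : probability T R) (F : nat -> set (set T)).
Hypothesis Fm : forall n, F n `<=` measurable.
Hypothesis Fnd : forall n m, (n <= m)%N -> F n `<=` F m.
Hypothesis FC : forall n A, F n A -> F n (~` A).
Hypothesis FU : forall n A B, F n A -> F n B -> F n (A `|` B).

Lemma measurable_setY (A B : set T) : measurable A -> measurable B -> measurable (A `+` B).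
Proof. by move=> mA mB; apply: measurableU; exact: measurableD. Qed.

Definition approximable (A : set T) : Prop :=
  measurable A /\ forall e : R, (0 < e)%R -> exists n C, F n C /\ P (A `+` C) <= e%:E.

Lemma approximable_setC A : approximable A -> approximable (~` A).
Proof.
move=> [mA H]; split; first exact: measurableC.
move=> e e0; have [n [C [FnC PC]]] := H e e0; exists n, (~` C); split; first exact: FC.
rewrite (_ : ~` A `+` ~` C = A `+` C)//.
by rewrite /setY !setDE !setCK setUC (setIC (~` C)) (setIC (~` A)).
Qed.

Lemma approximable_setU A B : approximable A -> approximable B -> approximable (A `|` B).
Proof.
move=> [mA HA] [mB HB]; split; first exact: measurableU.
move=> e e0; have e20 : (0 < e / 2)%R by rewrite divr_gt0.
have [n [C [FnC PC]]] := HA _ e20; have [m [D [FmD PD]]] := HB _ e20.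
exists (maxn n m), (C `|` D); split.
  by apply: FU; [exact: (Fnd (leq_maxl n m) FnC)|exact: (Fnd (leq_maxr n m) FmD)].
have mC := Fm FnC; have mD := Fm FmD.
apply: (@le_trans _ _ (P ((A `+` C) `|` (B `+` D)))).
  apply: le_measure; [apply/mem_set|apply/mem_set|].
  - by apply: measurable_setY; exact: measurableU.
  - by apply: measurableU; exact: measurable_setY.
  move=> x [[[Ax|Bx] /not_orP[nC nD]]|[[Cx|Dx] /not_orP[nA nB]]].
  - by left; left.
  - by right; left.
  - by left; right.
  - by right; right.
apply: le_trans (measureU2 _ _ _) _; [exact: measurable_setY|exact: measurable_setY|].
by rewrite (splitr e) EFinD leeD.
Qed.

(** Finite unions are approximable by induction, and what they miss decreases to the empty set, so
    one of them is already within [e / 2] of the whole union. *)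
Lemma approximable_bigcup (A : nat -> set T) : F 0%N set0 ->
  (forall n, approximable (A n)) -> approximable (\bigcup_n A n).
Proof.
move=> F0 HA; have mA n : measurable (A n) by have [] := HA n.
have mU : measurable (\bigcup_n A n) by exact: bigcupT_measurable.
split => // e e0; have e20 : (0 < e / 2)%R by rewrite divr_gt0.
pose U n := \bigcup_(i < n) A i.
have aU n : approximable (U n).
  elim: n => [|n ih].
    rewrite /U bigcup_mkord big_ord0; split => // r r0; exists 0%N, set0; split => //.
    by rewrite /setY setDv setU0 measure0 lee_fin ltW.
  rewrite /U bigcup_mkord big_ord_recr/= -bigcup_mkord.
  exact: approximable_setU.
have mUn n : measurable (U n) by have [] := aU n.
pose D n := \bigcup_n A n `\` U n.
have mD n : measurable (D n) by exact: measurableD.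
have : (P \o D) x @[x --> \oo] --> P (\bigcap_n D n).
  apply: nonincreasing_cvg_mu => //.
  - by apply: le_lt_trans (probability_le1 _ _) _ => //; rewrite ltry.
  - exact: bigcapT_measurable.
  - move=> n m nm; apply/subsetPset => x [Ax nU]; split => // -[i /= im Aix].
    by apply: nU; exists i => //=; exact: leq_trans nm.
have -> : \bigcap_n D n = set0.
  rewrite -subset0 => x Dx; have [[n _ Anx] _] := Dx 0%N I.
  by have [_] := Dx n.+1 I; apply; exists n => /=.
rewrite measure0 => /fine_cvgP[_ /cvgrPdist_lt /(_ _ e20)[n _ /(_ n (leqnn n)) /=]].
rewrite sub0r normrN => Dn.
have {}Dn : P (D n) <= (e / 2)%:E.
  rewrite -[X in X <= _]fineK ?fin_num_measure// lee_fin.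
  exact: le_trans (ler_norm _) (ltW Dn).
have [m [C [FmC PC]]] := (aU n).2 _ e20.
exists m, C; split => //; have mC := Fm FmC.
apply: (@le_trans _ _ (P (D n `|` (U n `+` C)))).
  apply: le_measure; [apply/mem_set|apply/mem_set|].
  - exact: measurable_setY.
  - by apply: measurableU => //; exact: measurable_setY.
  move=> x [[Ax nC]|[Cx nA]].
    by have [Ux|nU] := pselect (U n x); [right; left|left].
  by right; right; split => // -[i /= im Aix]; apply: nA; exists i.
apply: le_trans (measureU2 _ _ _) _ => //; first exact: measurable_setY.
by rewrite (splitr e) EFinD leeD.
Qed.

End approximation.

Lemma exists_pushforward {R : realType} {d d'} {O : measurableType d}
    {T : measurableType d'} (m : {measure set O -> \bar R}) (V : O -> T) :
  measurable_fun setT V ->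
  exists m' : {measure set T -> \bar R}, forall A, m' A = m (V @^-1` A).
Proof. by move=> mV; unshelve eexists (pushforward m V). Qed.

Section ar_stationary.
Context {R : realType} {dX dY : measure_display}.
Context {X : measurableType dX} {Y : measurableType dY} {s : nat}.
Variables (mu : probability X R) (nu : {sigma_finite_measure set Y -> \bar R}).
Variables (q : X -> X -> R) (g : s.+1.-tuple Y -> X -> Y -> R).
Hypothesis qgP : ar_density mu nu q g.

Local Notation Z := (X * s.+1.-tuple Y)%type.
Local Notation E := (paths int (X * Y)%type).
Local Notation stZ := (@stateZ _ _ X Y s).
Local Notation markov := (markov mu nu q g).
Local Notation kerZ := (kerZ mu nu q g).

Lemma measurable_kerZ_mass A : measurable A ->
  measurable_fun setT (fun z : Z => kernel_mass kerZ z A).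
Proof.
move=> mA; apply: measurable_kerZ => //.
by apply/measurable_EFinP; exact: measurable_indic.
Qed.

Lemma kerZ_mass_ge0 A z : 0 <= kernel_mass kerZ z A.
Proof. exact: kerZ_ge0. Qed.

Lemma kerZ_mass_le1 A z : measurable A -> kernel_mass kerZ z A <= 1.
Proof.
move=> mA; rewrite -(dker_cst phiZ (measurable_rhoZ qgP) (rhoZ_ge0 qgP) (rhoZ_int1 qgP) lee01 z).
apply: dker_le; [exact: measurable_phiZ|exact: (measurable_rhoZ qgP)|exact: (rhoZ_ge0 qgP)| | | |] => //.
- by apply/measurable_EFinP; exact: measurable_indic.
- by move=> x; rewrite lee_fin indicE lern1 leq_b1.
Qed.

Definition rectE (k : int) (n : nat) (B : nat -> set (X * Y)) : set E :=
  [set e | forall i, (i < n)%N -> B i (e (k + i%:Z)%R)].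

Lemma rectES k n B :
  rectE k n.+1 B = rectE k n B `&` (fun e => e (k + n%:Z)%R) @^-1` B n.
Proof.
apply/seteqP; split => e.
  by move=> H; split => [i ni|]; apply: H => //; rewrite ltnS ltnW.
by move=> [H1 H2] i; rewrite ltnS leq_eqVlt => /orP[/eqP->//|]; exact: H1.
Qed.

Lemma rectE0 k B : rectE k 0 B = setT.
Proof. by apply/seteqP; split. Qed.

Lemma past_rectE k n B l : (forall i, measurable (B i)) ->
  (forall i, (i < n)%N -> (k + i%:Z <= l)%R) -> <<s past_gen l >> (rectE k n B).
Proof.
move=> mB; elim: n => [_|n ih nl].
  rewrite rectE0; exact: (@measurableT _ (g_sigma_algebraType (past_gen l))).
rewrite rectES; apply: pastI; last by apply: past_coord; [exact: nl|].
by apply: ih => i ni; apply: nl; rewrite ltnS ltnW.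
Qed.

Lemma measurable_rectE k n B : (forall i, measurable (B i)) -> measurable (rectE k n B).
Proof.
move=> mB; apply: (@past_measurable _ _ _ _ (k + n%:Z)%R).
by apply: past_rectE => // i ni; lia.
Qed.

Lemma stateZ_head k e : ((stZ k e).1, thead (stZ k e).2) = e k.
Proof.
by rewrite /stateZ /lagS/= /thead tnth_mktuple/= /past_obs subr0 -surjective_pairing.
Qed.

(** The last time is integrated out by one kernel step, and the constraint at the preceding time is
    absorbed into the integrand. A Markov measure is thus determined by its kernel and its one-time
    marginals. *)
Lemma markov_rect (m1 m2 : {measure set E -> \bar R}) :
  (forall k A, measurable A -> m1 (stZ k @^-1` A) = m2 (stZ k @^-1` A)) ->
  markov m1 -> markov m2 ->
  forall n k B f, (forall i, measurable (B i)) ->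
    measurable_fun setT f -> (forall x, 0 <= f x) ->
  \int[m1]_(e in rectE k n B) f (stZ (k + n%:Z)%R e) =
  \int[m2]_(e in rectE k n B) f (stZ (k + n%:Z)%R e).
Proof.
move=> m12 M1 M2; elim => [|n ih] k B f mB mf f0.
  rewrite rectE0 addr0.
  have [m' m'E] := exists_pushforward m2 (@measurable_stateZ _ _ X Y s k).
  rewrite !(ge0_integral_law (m' := m') (measurable_stateZ k))//.
  by move=> A mA; rewrite m12// m'E.
have pR : <<s past_gen (k + n%:Z)%R >> (rectE k n.+1 B).
  by apply: past_rectE => // i ni; lia.
have -> : (k + n.+1%:Z)%R = (k + n%:Z + 1)%R by lia.
rewrite (markovZ qgP M1)// (markovZ qgP M2)// rectES.
(* The pair at time [k + n] is recovered from the state as the hidden component and the head of the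
   lag window. *)
pose f' (z : Z) := (\1_[set z : Z | B n (z.1, thead z.2)] z)%:E * kerZ f z.
have step (m : {measure set E -> \bar R}) :
    \int[m]_(e in rectE k n B `&` (fun e => e (k + n%:Z)%R) @^-1` B n) kerZ f (stZ (k + n%:Z)%R e) =
    \int[m]_(e in rectE k n B) f' (stZ (k + n%:Z)%R e).
  rewrite integral_mkcondr; apply: eq_integral => e _; rewrite patchE /f' indicE.
  rewrite (_ : (stZ _ e \in _) = (e \in (fun e => e (k + n%:Z)%R) @^-1` B n)).
    by case: ifPn => _; rewrite ?mul1e ?mul0e.
  change ((((stZ (k + n%:Z)%R e).1, thead (stZ (k + n%:Z)%R e).2) \in B n) =
    (e (k + n%:Z)%R \in B n)).
  by rewrite stateZ_head.
rewrite !step; apply: ih => //.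
- apply: emeasurable_funM; last exact: measurable_kerZ.
  apply/measurable_EFinP/measurable_indic.
  rewrite -[X in measurable X]setTI.
  apply: (measurable_fun_pair measurable_fst (measurableT_comp (measurable_thead (s := s)) measurable_snd)) => //.
- by move=> z; rewrite mule_ge0 ?lee_fin//; exact: kerZ_ge0.
Qed.

Lemma rect_setsE B N : (forall i, (N < `|i|)%N -> B i = setT) ->
  [set e : E | forall i, B i (e i)] =
  rectE (- N%:Z)%R (N + N).+1 (fun i => B (- N%:Z + i%:Z)%R).
Proof.
move=> BT; apply/seteqP; split => e H i => [_|]; first exact: H.
have [iN|iN] := leqP `|i|%N N; last by rewrite BT.
have := H (absz (i + N%:Z)%R).
have -> : (- N%:Z + (absz (i + N%:Z)%R)%:Z = i)%R by lia.
by apply; lia.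
Qed.

Lemma markov_unique (m1 m2 : {measure set E -> \bar R}) : m1 setT < +oo ->
  (forall k A, measurable A -> m1 (stZ k @^-1` A) = m2 (stZ k @^-1` A)) ->
  markov m1 -> markov m2 -> forall A, measurable A -> m1 A = m2 A.
Proof.
move=> m1fin m12 M1 M2; apply: paths_measure_unique => // B N mB BT.
rewrite (rect_setsE BT).
set C := rectE _ _ _; have mC : measurable C by exact: measurable_rectE.
have := @markov_rect m1 m2 m12 M1 M2 (N + N).+1 (- N%:Z)%R (fun i => B (- N%:Z + i%:Z)%R) (cst 1).
rewrite -/C !integral_cst// !mul1e; apply => //.
Qed.

Definition shiftE (c : int) (e : E) : E := fun k => e (k + c)%R.

Lemma measurable_shiftE c : measurable_fun setT (shiftE c).
Proof. by apply: measurable_to_paths => k; exact: measurable_coord. Qed.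

Lemma shiftEK c : cancel (shiftE c) (shiftE (- c)).
Proof. by move=> e; apply/funext => k; rewrite /shiftE subrK. Qed.

Lemma iter_shiftE n e : iter n (shiftE 1) e = shiftE n%:Z e.
Proof.
elim: n => [|n ih]; first by apply/funext => k; rewrite /shiftE addr0.
by rewrite iterS ih; apply/funext => k; rewrite /shiftE; congr (e _); lia.
Qed.

Lemma stateS_shiftE (c k : int) e : stateS k (shiftE c e) = stateS (k + c)%R e.
Proof.
rewrite /stateS /past_obs /shiftE; congr pair.
by apply/funext => j; congr (e _).2; lia.
Qed.

Lemma stateZ_shiftE (c k : int) e : stZ k (shiftE c e) = stZ (k + c)%R e.
Proof. by rewrite /stateZ stateS_shiftE. Qed.

Lemma past_shiftE c k C : <<s past_gen k >> C -> <<s past_gen (k + c)%R >> (shiftE c @^-1` C).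
Proof.
suff H : <<s past_gen k >> `<=` image_set_system setT (shiftE c) <<s @past_gen _ _ X Y (k + c)%R >>.
  by move=> /H; rewrite /image_set_system/= setTI.
apply: smallest_sub; first exact/sigma_algebra_image/smallest_sigma_algebra.
move=> _ [j [A [jk mA ->]]]; rewrite /image_set_system/= setTI.
by apply: past_coord; rewrite ?lerD2r.
Qed.

Variables (P : probability E R) (pi : probability Z R).
Hypothesis Ppi : forall k A, measurable A -> P (stZ k @^-1` A) = pi A.
Hypothesis PM : markov P.

(** The shifted measure is again Markov with the same marginals, so uniqueness applies. *)
Lemma shift_stationary c A : measurable A -> P (shiftE c @^-1` A) = P A.
Proof.
have [m mE] := exists_pushforward P (measurable_shiftE c).
rewrite -mE; apply: markov_unique => //.
- by rewrite mE; exact: (le_lt_trans (probability_le1 P measurableT) (ltry _)).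
- move=> k B mB; rewrite mE -comp_preimage.
  rewrite (_ : stZ k \o shiftE c = stZ (k + c)%R).
    exact: etrans (Ppi _ mB) (esym (Ppi _ mB)).
  by apply/funext => e /=; rewrite stateZ_shiftE.
- move=> k C B Ck mB; rewrite mE.
  have -> : shiftE c @^-1` (C `&` stZ (k + 1)%R @^-1` B) =
      shiftE c @^-1` C `&` stZ (k + c + 1)%R @^-1` B.
    by apply/seteqP; split => e /=; rewrite stateZ_shiftE addrAC.
  rewrite PM//; last exact: past_shiftE.
  have mk : measurable_fun setT (fun e => kernel_mass kerZ (stZ k e) B).
    exact: (measurableT_comp (measurable_kerZ_mass mB) (measurable_stateZ k)).
  have mC := past_measurable Ck.
  rewrite [RHS]integral_mkcond -(ge0_integral_law (measurable_shiftE c) (m := P)); last 3 first.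
  + by move=> D mD; rewrite mE.
  + by apply/(measurable_restrictT _ mC); exact: measurable_funTS.
  + by move=> e; apply: erestrict_ge0 => ? _; exact: kerZ_mass_ge0.
  rewrite [LHS]integral_mkcond; apply: eq_integral => e _.
  by rewrite !patchE stateZ_shiftE.
Qed.

Local Notation past n := (@past_gen _ _ X Y n).

(** Approximable events form a sigma-algebra, and the event of a coordinate [k] already belongs to
    the past of time [|k|]. *)
Lemma past_approximable A : measurable A ->
  approximable P (fun n => <<s past n%:Z >>) A.
Proof.
pose F n := <<s past n%:Z >>.
have Fm n : F n `<=` measurable by exact: past_measurable.
have Fnd n m : (n <= m)%N -> F n `<=` F m by move=> nm; apply: past_sub; rewrite lez_nat.
have FC n B : F n B -> F n (~` B) by exact: (@measurableC _ (g_sigma_algebraType (past n%:Z))).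
have FU n B C : F n B -> F n C -> F n (B `|` C).
  exact: (@measurableU _ (g_sigma_algebraType (past n%:Z))).
have F0 n : F n set0 by exact: (@measurable0 _ (g_sigma_algebraType (past n%:Z))).
move=> mA; move: mA; apply: smallest_sub => /=.
  split.
  - split => // e e0; exists 0%N, set0; split; first exact: F0.
    by rewrite /setY setDv setU0 measure0 lee_fin ltW.
  - by move=> B aB; rewrite setTD; exact: approximable_setC.
  - by move=> B aB; apply: (approximable_bigcup Fm Fnd FU (F0 0%N)).
move=> _ [k [B [mB ->]]]; split.
  by rewrite -[X in measurable X]setTI; exact: measurable_coord.
move=> e e0; exists `|k|%N, ((fun y => y k) @^-1` B); split.
  by apply: past_coord => //; lia.
by rewrite /setY setDv setU0 measure0 lee_fin ltW.
Qed.

Section invariant_event.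
Variable A : set E.
Hypothesis mA : measurable A.
Hypothesis AT : shiftE 1 @^-1` A = A.

Lemma invariant_shiftE c : shiftE c @^-1` A = A.
Proof.
have An (n : nat) e : A (shiftE n%:Z e) <-> A e.
  rewrite -iter_shiftE; elim: n => [//|n ih].
  have <- : A (iter n (shiftE 1) e) = A (iter n.+1 (shiftE 1) e) by rewrite -[in LHS]AT.
  exact: ih.
case: c => n; first by apply/seteqP; split => e H; [exact: (An n e).1|exact: (An n e).2].
rewrite NegzE; apply/seteqP; split => e /= H; have K : shiftE n.+1%:Z (shiftE (- n.+1%:Z) e) = e
  by rewrite -[X in shiftE X _]opprK shiftEK.
  by rewrite -K; exact: (An n.+1 _).2.
by apply: (An n.+1 _).1; rewrite K.
Qed.

(** Shifting an approximation back in time changes neither the invariant event nor the error, so the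
    approximation can be taken from an arbitrarily remote past. *)
Lemma invariant_approx k (e : R) : (0 < e)%R ->
  exists C, <<s past k >> C /\ P (A `+` C) <= e%:E.
Proof.
move=> e0; have [n [C [Cn PC]]] := (past_approximable mA).2 e e0.
(* The shift lowers the level from [n] to [- |k|], which is at most [k]. *)
exists (shiftE (- (n + `|k|)%N%:Z) @^-1` C); split.
  suff : <<s past (n%:Z + - (n + `|k|)%N%:Z)%R >> `<=` <<s past k >>.
    by apply; exact: past_shiftE.
  by apply: past_sub; lia.
rewrite -[X in X `+` _](invariant_shiftE (- (n + `|k|)%N%:Z)).
rewrite (_ : _ `+` _ = shiftE (- (n + `|k|)%N%:Z) @^-1` (A `+` C))//.
rewrite shift_stationary//.
by apply: measurable_setY => //; exact: past_measurable Cn.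
Qed.

(** An invariant event need not lie in the past of [k], but it may be replaced by an approximation
    [D] that does. Both sides of the Markov identity then change by at most the measure of the
    symmetric difference, since the kernel mass is at most 1. *)
Lemma invariant_markov : markov (mrestr P mA).
Proof.
move=> k C B Ck mB; have mC := past_measurable Ck.
have mk : measurable_fun setT (fun e => kernel_mass kerZ (stZ k e) B).
  exact: (measurableT_comp (measurable_kerZ_mass mB) (measurable_stateZ k)).
have k0 e : 0 <= kernel_mass kerZ (stZ k e) B by exact: kerZ_mass_ge0.
have k1 e : kernel_mass kerZ (stZ k e) B <= 1 by exact: kerZ_mass_le1.
have mV : measurable (C `&` stZ (k + 1)%R @^-1` B).
  apply: measurableI => //; rewrite -[X in measurable X]setTI.
  exact: measurable_stateZ.
have -> : \int[mrestr P mA]_(e in C) kernel_mass kerZ (stZ k e) B =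
          \int[P]_(e in A `&` C) kernel_mass kerZ (stZ k e) B.
  rewrite [LHS]integral_mkcond ge0_integral_mrestr.
  - by rewrite integral_mkcondr.
  - by apply/(measurable_restrictT _ mC); exact: measurable_funTS.
  - by move=> e; apply: erestrict_ge0.
rewrite /= /mrestr; set V := C `&` _.
have le1 D D' : measurable D -> measurable D' -> P (V `&` D) <= P (V `&` D') + P (D `+` D').
  move=> mD mD'; apply: (@le_trans _ _ (P ((V `&` D') `|` (D `+` D')))).
    apply: le_measure; [apply/mem_set|apply/mem_set|].
    - exact: measurableI.
    - by apply: measurableU; [exact: measurableI|exact: measurable_setY].
    move=> e [Ve De]; have [?|?] := pselect (D' e); [by left|by right; left].
  by apply: measureU2; [exact: measurableI|exact: measurable_setY].
have le2 D D' : measurable D -> measurable D' ->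
    \int[P]_(e in D `&` C) kernel_mass kerZ (stZ k e) B <=
    \int[P]_(e in D' `&` C) kernel_mass kerZ (stZ k e) B + P (D `+` D').
  move=> mD mD'; apply: (@le_trans _ _ (\int[P]_(e in (D' `&` C) `|` ((D `&` C) `\` (D' `&` C))) kernel_mass kerZ (stZ k e) B)).
    apply: ge0_subset_integral => //.
    - exact: measurableI.
    - by apply: measurableU; [exact: measurableI|apply: measurableD; exact: measurableI].
    - exact: measurable_funTS.
    - by move=> e He; have [?|?] := pselect ((D' `&` C) e); [left|right].
  rewrite ge0_integral_setU//; last 4 first.
  - exact: measurableI.
  - by apply: measurableD; exact: measurableI.
  - exact: measurable_funTS.
  - by apply/disj_setPRL => e [].
  rewrite leeD2l//.
  have mDD : measurable (D `&` C `\` D' `&` C) by apply: measurableD; exact: measurableI.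
  apply: (@le_trans _ _ (\int[P]_(e in D `&` C `\` D' `&` C) 1)).
    by apply: ge0_le_integral => //; exact: measurable_funTS.
  rewrite integral_cst// mul1e; apply: le_measure; [exact/mem_set|apply/mem_set; exact: measurable_setY|].
  by move=> e [[De Ce] H]; left; split => // D'e; apply: H.
(* Each inequality passes from [A] to [D], uses the Markov property on the intersection of [C] and
   [D], and returns to [A]; each passage costs [e / 2]. *)
apply/eqP; rewrite eq_le; apply/andP; split; apply/lee_addgt0Pr => e e0;
  have e20 : (0 < e / 2)%R by rewrite divr_gt0.
all: have [D [Dk PD]] := invariant_approx k e20; have mD := past_measurable Dk.
all: have VD : P (V `&` D) = \int[P]_(e in D `&` C) kernel_mass kerZ (stZ k e) B
  by rewrite /V setIAC -PM ?setIA// (setIC D); [congr (P _); rewrite setIAC|exact: pastI].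
- apply: le_trans (le1 _ _ mA mD) _; rewrite VD.
  apply: le_trans (leeD2r _ (le2 _ _ mD mA)) _; rewrite -addeA leeD2l//.
  by rewrite (splitr e) EFinD leeD// setYC.
- apply: le_trans (le2 _ _ mA mD) _; rewrite -VD.
  apply: le_trans (leeD2r _ (le1 _ _ mD mA)) _; rewrite -addeA leeD2l//.
  by rewrite (splitr e) EFinD leeD// setYC.
Qed.

Hypothesis pi_unique : unique_invariant kerZ pi.

(** The marginals conditioned on [A] are invariant, hence equal to [pi]. The restriction of [P] to
    [A] and the multiple [P A] of [P] are then Markov with equal marginals, so they coincide; at [A]
    itself this reads [P A = P A * P A]. *)
Lemma invariant_event01 : P A = 0 \/ P A = 1.
Proof.
have [->|PA0] := eqVneq (P A) 0; [by left|right].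
have Afin : P A \is a fin_num by exact: fin_num_measure.
have a0 : (0 < fine (P A))%R by rewrite fine_gt0// lt0e PA0 measure_ge0/= ltey_eq Afin.
have mZ k B : measurable B -> measurable (stZ k @^-1` B).
  by move=> mB; rewrite -[X in measurable X]setTI; exact: measurable_stateZ.
have marg k B : measurable B -> P (stZ k @^-1` B `&` A) = P (stZ 0%R @^-1` B `&` A).
  move=> mB; rewrite -(shift_stationary k (A := stZ 0%R @^-1` B `&` A)).
    rewrite preimage_setI invariant_shiftE; congr (P (_ `&` _)).
    by apply/seteqP; split => e /=; rewrite stateZ_shiftE add0r.
  by apply: measurableI => //; exact: mZ.
have [mm mmE] := exists_pushforward (mrestr P mA) (@measurable_stateZ _ _ X Y s 0%R).
have mmE' B : mm B = P (stZ 0%R @^-1` B `&` A) by rewrite mmE.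
have c0 : (0 <= (fine (P A))^-1)%R by rewrite invr_ge0 ltW.
pose c := NngNum c0.
have mm1 : mscale c mm setT = 1.
  by rewrite /mscale/= mmE' preimage_setT setTI -[X in _ * X](fineK Afin) -EFinM mulVf// gt_eqF.
have [pi' pi'E] : exists pi' : probability Z R, forall B, pi' B = mscale c mm B.
  pose p : probability Z R := HB.pack (mscale c mm)
    (Measure_isProbability.Build _ _ _ (mscale c mm) mm1).
  by exists p.
(* This is the Markov property of the restricted measure at time 0, the marginal at time 1 being
   brought back to time 0 by the shift. *)
have inv_pi' : Defs.invariant kerZ pi'.
  move=> B mB; rewrite pi'E (eq_measure_integral (mscale c mm)); last by move=> D mD _; exact: pi'E.
  rewrite ge0_integral_mscale//; last 2 first.
  - exact: measurable_kerZ_mass.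
  - by move=> z _; exact: kerZ_mass_ge0.
  rewrite /mscale/=; congr (_ * _).
  rewrite -(ge0_integral_law (measurable_stateZ 0%R) (m := mrestr P mA) (m' := mm)); last 3 first.
  - by move=> D mD; rewrite mmE.
  - exact: measurable_kerZ_mass.
  - by move=> z; exact: kerZ_mass_ge0.
  rewrite -(@invariant_markov 0%R setT B) ?setTI//; last exact: (@measurableT _ (g_sigma_algebraType (past 0%R))).
  by rewrite /= /mrestr marg// mmE'.
have piE B : measurable B -> P (stZ 0%R @^-1` B `&` A) = P A * pi B.
  move=> mB; rewrite -(pi_unique.2 pi' inv_pi' B mB) pi'E /mscale/= mmE'.
  by rewrite muleA -[X in X * _ * _](fineK Afin) -EFinM mulfV ?mul1e// gt_eqF.
have := @markov_unique (mrestr P mA) (mscale (NngNum (ltW a0)) P).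
have /[swap]/[apply] : mrestr P mA setT < +oo by rewrite /mrestr setTI ltey_eq Afin.
move=> /(_ _ invariant_markov) H.
have {H} : P (A `&` A) = P A * P A.
  rewrite -[X in X * _](fineK Afin); apply: H => //.
  - by move=> k B mB; rewrite /= /mrestr marg// piE// /mscale/= Ppi// fineK.
  - move=> k C B Ck mB; have mC := past_measurable Ck.
    rewrite ge0_integral_mscale//.
    + by rewrite /= /mscale/= PM.
    + apply: measurable_funTS.
      exact: (measurableT_comp (measurable_kerZ_mass mB) (measurable_stateZ k)).
    + by move=> e _; exact: kerZ_mass_ge0.
rewrite setIid -(fineK Afin) -EFinM => -[H].
by have -> : fine (P A) = 1%R by apply: (mulfI (lt0r_neq0 a0)); rewrite mulr1 -H.
Qed.

End invariant_event.

End ar_stationary.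

(** * Conditional densities of the observations *)

Section conditional_density.
Context {R : realType} {dX dY : measure_display}.
Context {X : measurableType dX} {Y : measurableType dY} {s : nat}.
Variables (mu : probability X R) (nu : {sigma_finite_measure set Y -> \bar R}).
Variables (q : X -> X -> R) (g : s.+1.-tuple Y -> X -> Y -> R).

Local Notation S := (X * paths nat Y)%type.

(* Joint density of the [n] most recent observations [h (n-1), ..., h 0] given
   that the hidden chain was at [x] just before them and that the earlier
   observations were [h n, h (n+1), ...]. *)
Fixpoint beta (n : nat) (x : X) (h : nat -> Y) : \bar R :=
  if n is n'.+1 then
    \int[mu]_x' ((q x x' * g (lag s.+1 (dropp n h)) x' (h n'))%:E * beta n' x' h)
  else 1.

Hypothesis qgP : ar_density mu nu q g.

Lemma measurable_beta_factor n : measurable_fun [set: S * X]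
  (fun v : S * X => (q v.1.1 v.2 * g (lag s.+1 (dropp n.+1 v.1.2)) v.2 (v.1.2 n))%R).
Proof.
have [mq _ _ mg _] := qgP; apply: measurable_funM.
  apply: (measurableT_comp mq (g := fun u : S * X => (u.1.1, u.2))).
  apply: measurable_fun_pair; last exact: measurable_snd.
  exact: (measurableT_comp measurable_fst measurable_fst).
have m12 : measurable_fun setT (fun v : S * X => v.1.2 : paths nat Y).
  exact: (measurableT_comp measurable_snd measurable_fst).
apply: (measurableT_comp mg (g := fun u : S * X => (lag s.+1 (dropp n.+1 u.1.2), u.2, u.1.2 n))).
apply: measurable_fun_pair; last exact: (measurableT_comp (measurable_coord n) m12).
apply: measurable_fun_pair; last exact: measurable_snd.
apply: (measurableT_comp (f := lag s.+1 : paths nat Y -> s.+1.-tuple Y)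
  (g := fun v : S * X => dropp n.+1 v.1.2)); first exact: measurable_lag.
exact: (measurableT_comp (measurable_dropp n.+1) m12).
Qed.

Lemma beta_factor_ge0 n x h x' :
  0 <= (q x x' * g (lag s.+1 (dropp n.+1 h)) x' (h n))%:E.
Proof. by have [_ q0 _ _ [g0 _]] := qgP; rewrite lee_fin mulr_ge0. Qed.

Lemma beta_ge0 n x h : 0 <= beta n x h.
Proof.
elim: n x => [|n ih] x /=; first exact: lee01.
by apply: integral_ge0 => x' _; rewrite mule_ge0// beta_factor_ge0.
Qed.

Lemma measurable_beta n : measurable_fun [set: S] (fun u : S => beta n u.1 u.2).
Proof.
elim: n => [|n ih] /=; first exact: measurable_cst.
apply: (measurable_fun_fubini_tonelli_F (m2 := mu)
  (fun v : S * X => (q v.1.1 v.2 * g (lag s.+1 (dropp n.+1 v.1.2)) v.2 (v.1.2 n))%:E *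
     beta n v.2 v.1.2)).
  apply: emeasurable_funM; first by apply/measurable_EFinP; exact: measurable_beta_factor.
  apply: (measurableT_comp ih (g := fun v : S * X => (v.2, v.1.2))).
  apply: measurable_fun_pair; first exact: measurable_snd.
  exact: (measurableT_comp measurable_snd measurable_fst).
by move=> v; rewrite mule_ge0 ?beta_ge0 ?beta_factor_ge0.
Qed.

Lemma measurable_beta_path n x : measurable_fun [set: paths nat Y] (beta n x).
Proof. exact: (measurableT_comp (measurable_beta n) (measurable_pair1 x)). Qed.

Lemma measurable_beta_state n (h : paths nat Y) : measurable_fun [set: X] (beta n ^~ h).
Proof. exact: (measurableT_comp (measurable_beta n) (measurable_pair2 h)). Qed.

Lemma measurable_beta_integrand n x (h : paths nat Y) : measurable_fun [set: X]
  (fun x' => (q x x' * g (lag s.+1 (dropp n.+1 h)) x' (h n))%:E * beta n x' h).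
Proof.
apply: emeasurable_funM; last exact: measurable_beta_state.
apply/measurable_EFinP.
exact: (measurableT_comp (measurable_beta_factor n) (measurable_pair1 (x, h))).
Qed.

Lemma measurable_g_state yb y : measurable_fun [set: X] (fun x => g yb x y).
Proof.
have [_ _ _ mg _] := qgP.
apply: (measurableT_comp mg (g := fun x : X => (yb, x, y))).
by apply: measurable_fun_pair => //; exact: measurable_pair1.
Qed.

Lemma measurable_q_state x : measurable_fun [set: X] (q x).
Proof. by have [mq _ _ _ _] := qgP; exact: (measurableT_comp mq (measurable_pair1 x)). Qed.

Section bounds.
Variables (sm sp bp : R).
Hypothesis sm0 : (0 < sm)%R.
Hypothesis smq : forall x, {ae mu, forall x', (sm <= q x x')%R}.
Hypothesis qsp : forall x, {ae mu, forall x', (q x x' <= sp)%R}.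
Hypothesis gbp : forall yb y, {ae mu, forall x, (g yb x y <= bp)%R}.
Hypothesis bp0 : (0 <= bp)%R.

Lemma beta_ub n x h : beta n x h <= (bp ^+ n)%:E.
Proof.
have [mq q0 q1 mg [g0 g1]] := qgP.
elim: n x => [|n ih] x /=; first by rewrite expr0.
have -> : (bp ^+ n.+1)%:E = \int[mu]_x' ((bp ^+ n.+1)%:E * (q x x')%:E).
  rewrite ge0_integralZl ?q1 ?mule1 ?lee_fin ?exprn_ge0//.
    by apply/measurable_EFinP; exact: measurable_q_state.
  by move=> x' _; rewrite lee_fin.
apply: ae_ge0_le_integral => //.
- by move=> x' _; rewrite mule_ge0 ?beta_ge0 ?beta_factor_ge0.
- exact: measurable_beta_integrand.
- by move=> x' _; rewrite mule_ge0 ?lee_fin ?exprn_ge0.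
- by apply: measurable_funeM; apply/measurable_EFinP; exact: measurable_q_state.
- apply: filterS (gbp (lag s.+1 (dropp n.+1 h)) (h n)) => x' gb _.
  apply: (@le_trans _ _ ((q x x' * g (lag s.+1 (dropp n.+1 h)) x' (h n))%:E * (bp ^+ n)%:E)).
    by rewrite lee_wpmul2l// beta_factor_ge0.
  rewrite -!EFinM lee_fin mulrAC [leRHS]mulrC exprSr -!mulrA ler_wpM2l//.
  by rewrite ler_wpM2l// exprn_ge0.
Qed.

Lemma beta_fin_num n x h : beta n x h \is a fin_num.
Proof. by rewrite ge0_fin_numE ?beta_ge0// (le_lt_trans (beta_ub n x h))// ltry. Qed.

(** Replacing every [q] by [sm] uncouples the hidden states, and the iterated integral becomes a
    product. *)
Lemma beta_lb (w : (nat -> Y) -> R) n x h : (forall h, (0 <= w h)%R) ->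
  (forall h, (w h)%:E <= \int[mu]_x (g (lag s.+1 (dropp 1 h)) x (h 0%N))%:E) ->
  (\prod_(k < n) (sm * w (dropp k h)))%:E <= beta n x h.
Proof.
move=> w0 wg; have [mq q0 q1 mg [g0 g1]] := qgP.
elim: n x => [|n ih] x; first by rewrite big_ord0.
rewrite big_ord_recr/= mulrC.
set c := (\prod_(k < n) _)%R in ih *.
have c0 : (0 <= c)%R by apply: prodr_ge0 => k _; rewrite mulr_ge0// ltW.
pose gh x' := (g (lag s.+1 (dropp n.+1 h)) x' (h n)).
have gE : (w (dropp n h))%:E <= \int[mu]_x' (gh x')%:E.
  by have := wg (dropp n h); rewrite droppD addn1 /dropp addn0.
have mgh : measurable_fun [set: X] (fun x' => (gh x')%:E).
  by apply/measurable_EFinP; exact: measurable_g_state.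
have gh0 x' : [set: X] x' -> 0 <= (gh x')%:E by move=> _; rewrite lee_fin; exact: g0.
apply: (@le_trans _ _ (\int[mu]_x' ((sm * c)%:E * (gh x')%:E))).
  rewrite ge0_integralZl//; last by rewrite lee_fin mulr_ge0// ltW.
  by rewrite mulrAC EFinM lee_wpmul2l// lee_fin mulr_ge0// ltW.
apply: ae_ge0_le_integral => //.
- by move=> x' _; rewrite lee_fin mulr_ge0//; [exact: mulr_ge0 (ltW sm0) c0|exact: g0].
- exact: measurable_funeM.
- by move=> x' _; rewrite mule_ge0 ?beta_ge0 ?beta_factor_ge0.
- exact: measurable_beta_integrand.
- apply: filterS (smq x) => x' sq _.
  apply: (@le_trans _ _ ((q x x' * gh x')%:E * c%:E)).
    by rewrite -!EFinM lee_fin mulrAC; apply: ler_wpM2r => //; apply: ler_wpM2r => //; exact: g0.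
  by rewrite lee_wpmul2l// beta_factor_ge0.
Qed.

(** Only the first transition sees the starting state: its density is at most [sp] from [x] and at
    least [sm] from [x'], while the rest of the integrand is the same. *)
Lemma beta_kappa n x x' h : (sm <= sp)%R -> beta n x h <= (sp / sm)%:E * beta n x' h.
Proof.
move=> smsp; have [mq q0 q1 mg [g0 g1]] := qgP.
have sp0 : (0 < sp)%R by exact: lt_le_trans smsp.
case: n => [|n] /=; first by rewrite mule1 lee_fin ler_pdivlMr// mul1r.
pose gh x' := (g (lag s.+1 (dropp n.+1 h)) x' (h n)).
have mgh : measurable_fun [set: X] (fun x' => (gh x')%:E * beta n x' h).
  apply: emeasurable_funM; last exact: measurable_beta_state.
  by apply/measurable_EFinP; exact: measurable_g_state.
have gh0 z : 0 <= (gh z)%:E * beta n z h by apply: mule_ge0; [rewrite lee_fin; exact: g0|exact: beta_ge0].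
apply: (@le_trans _ _ (\int[mu]_z (sp%:E * ((gh z)%:E * beta n z h)))).
  apply: ae_ge0_le_integral => //.
  - by move=> z _; rewrite mule_ge0 ?beta_ge0 ?beta_factor_ge0.
  - exact: measurable_beta_integrand.
  - by move=> z _; rewrite mule_ge0// lee_fin ltW.
  - exact: measurable_funeM.
  - apply: filterS (qsp x) => z qz _.
    by rewrite EFinM -muleA; apply: lee_wpmul2r; [exact: gh0|rewrite lee_fin].
rewrite ge0_integralZl//; last by rewrite lee_fin ltW.
rewrite EFinM -muleA; apply: lee_wpmul2l; first by rewrite lee_fin ltW.
rewrite lee_pdivlMl//.
rewrite -ge0_integralZl//; last by rewrite lee_fin ltW.
apply: ae_ge0_le_integral => //.
- by move=> z _; rewrite mule_ge0// lee_fin ltW.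
- exact: measurable_funeM.
- by move=> z _; rewrite mule_ge0 ?beta_ge0 ?beta_factor_ge0.
- exact: measurable_beta_integrand.
- apply: filterS (smq x') => z qz _.
  by rewrite EFinM -muleA; apply: lee_wpmul2r; [exact: gh0|rewrite lee_fin].
Qed.

End bounds.

(** The density of the last [m] observations depends on the hidden state at the junction of the two
    blocks; a bound uniform in that state factors out. *)
Lemma beta_submul n m x h (c : R) : (0 <= c)%R -> (forall x', beta m x' h <= c%:E) ->
  beta (n + m) x h <= beta n x (dropp m h) * c%:E.
Proof.
move=> c0 Hc; elim: n x => [|n ih] x; first by rewrite add0n mul1e.
rewrite addSn /= muleC -ge0_integralZl//; last 2 first.
- exact: (measurable_beta_integrand n x (dropp m h)).
- by move=> x' _; rewrite mule_ge0 ?beta_ge0 ?beta_factor_ge0.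
apply: ge0_le_integral => //.
- by move=> x' _; rewrite mule_ge0 ?beta_ge0 ?beta_factor_ge0.
- exact: measurable_beta_integrand.
- by apply: measurable_funeM; exact: (measurable_beta_integrand n x (dropp m h)).
move=> x' _; rewrite muleCA.
have -> : dropp n.+1 (dropp m h) = dropp (n + m).+1 h by rewrite droppD addnS addnC.
have -> : dropp m h n = h (n + m)%N by rewrite /dropp addnC.
by apply: lee_wpmul2l; [exact: beta_factor_ge0|rewrite muleC; exact: ih].
Qed.

Lemma beta_supermul n m x h (c : R) : (0 <= c)%R -> (forall x', c%:E <= beta m x' h) ->
  beta n x (dropp m h) * c%:E <= beta (n + m) x h.
Proof.
move=> c0 Hc; elim: n x => [|n ih] x; first by rewrite add0n mul1e.
rewrite addSn /= muleC -ge0_integralZl//; last 2 first.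
- exact: (measurable_beta_integrand n x (dropp m h)).
- by move=> x' _; rewrite mule_ge0 ?beta_ge0 ?beta_factor_ge0.
apply: ge0_le_integral => //.
- by move=> x' _; rewrite !mule_ge0 ?beta_ge0 ?beta_factor_ge0 ?lee_fin.
- by apply: measurable_funeM; exact: (measurable_beta_integrand n x (dropp m h)).
- exact: measurable_beta_integrand.
move=> x' _; rewrite muleCA.
have -> : dropp n.+1 (dropp m h) = dropp (n + m).+1 h by rewrite droppD addnS addnC.
have -> : dropp m h n = h (n + m)%N by rewrite /dropp addnC.
by apply: lee_wpmul2l; [exact: beta_factor_ge0|rewrite muleC; exact: ih].
Qed.

(** Its [m]-th iterate integrates over [m] successive observations added on top of [h]. *)
Definition int_obs (F : paths nat Y -> \bar R) (h : paths nat Y) : \bar R :=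
  \int[nu]_y F (consp y h).

Lemma int_obs_ge0 m F h : (forall v, 0 <= F v) -> 0 <= iter m int_obs F h.
Proof. by move=> F0; elim: m h => [//|m ih] h; apply: integral_ge0 => y _; exact: ih. Qed.

Lemma measurable_iter_int_obs {d} {T : measurableType d} m (F : T -> paths nat Y -> \bar R) :
  measurable_fun [set: T * paths nat Y] (fun u => F u.1 u.2) ->
  (forall t v, 0 <= F t v) ->
  measurable_fun [set: T * paths nat Y] (fun u => iter m int_obs (F u.1) u.2).
Proof.
move=> mF F0; elim: m => [//|m ih].
apply: (measurable_fun_fubini_tonelli_F (m2 := nu)
  (fun v : (T * paths nat Y) * Y => iter m int_obs (F v.1.1) (consp v.2 v.1.2))).
  apply: (measurableT_comp ih (g := fun v : (T * paths nat Y) * Y => (v.1.1, consp v.2 v.1.2 : paths nat Y))).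
  apply: measurable_fun_pair; first exact: (measurableT_comp measurable_fst measurable_fst).
  apply: (measurableT_comp (f := fun u : Y * paths nat Y => consp u.1 u.2 : paths nat Y)
    (g := fun v : (T * paths nat Y) * Y => (v.2, v.1.2))); first exact: measurable_consp.
  apply: measurable_fun_pair; first exact: measurable_snd.
  exact: (measurableT_comp measurable_snd measurable_fst).
by move=> v; exact: int_obs_ge0.
Qed.

Lemma measurable_iter_int_obs1 m (F : paths nat Y -> \bar R) :
  measurable_fun setT F -> (forall v, 0 <= F v) -> measurable_fun setT (iter m int_obs F).
Proof.
move=> mF F0.
have := @measurable_iter_int_obs _ Y m (fun=> F) (measurableT_comp mF measurable_snd) (fun _ => F0).
move=> H; exact: (measurableT_comp H (measurable_pair1 point)).
Qed.

Lemma measurable_consp1 (w : paths nat Y) : measurable_fun setT (fun y => consp y w : paths nat Y).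
Proof. exact: (measurableT_comp measurable_consp (measurable_pair2 w)). Qed.

Lemma le_iter_int_obs m (F G : paths nat Y -> \bar R) w : measurable_fun setT F ->
  measurable_fun setT G -> (forall v, 0 <= F v) -> (forall v, F v <= G v) ->
  iter m int_obs F w <= iter m int_obs G w.
Proof.
move=> mF mG F0 FG; have G0 v : 0 <= G v by exact: le_trans (FG v).
elim: m w => [//|m ih] w; apply: ge0_le_integral => //.
- by move=> y _; exact: int_obs_ge0.
- exact: (measurableT_comp (measurable_iter_int_obs1 m mF F0) (measurable_consp1 w)).
- exact: (measurableT_comp (measurable_iter_int_obs1 m mG G0) (measurable_consp1 w)).
- by move=> y _; exact: ih.
Qed.

(** The iterated integral evaluates its integrand only at histories that extend [w] by [m]
    entries. *)
Lemma eq_iter_int_obs m (F G : paths nat Y -> \bar R) w :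
  (forall v, dropp m v = w -> F v = G v) -> iter m int_obs F w = iter m int_obs G w.
Proof.
elim: m w => [|m ih] w FG; first exact: FG.
apply: eq_integral => y _; apply: ih => v vw; apply: FG.
by rewrite -addn1 -droppD vw.
Qed.

Lemma iter_int_obsZ m (c : R) (F : paths nat Y -> \bar R) w : (0 <= c)%R ->
  measurable_fun setT F -> (forall v, 0 <= F v) ->
  iter m int_obs (fun v => c%:E * F v) w = c%:E * iter m int_obs F w.
Proof.
move=> c0 mF F0; elim: m w => [//|m ih] w.
rewrite !iterS /int_obs -/int_obs -ge0_integralZl//.
- by apply: eq_integral => y _; exact: ih.
- exact: (measurableT_comp (measurable_iter_int_obs1 m mF F0) (measurable_consp1 w)).
- by move=> y _; exact: int_obs_ge0.
Qed.

Lemma iter_int_obs_fubini m (F : X -> paths nat Y -> \bar R) w :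
  measurable_fun [set: X * paths nat Y] (fun u => F u.1 u.2) ->
  (forall t v, 0 <= F t v) ->
  iter m int_obs (fun v => \int[mu]_x F x v) w = \int[mu]_x iter m int_obs (F x) w.
Proof.
move=> mF F0; elim: m w => [//|m ih] w.
transitivity (\int[nu]_y \int[mu]_x iter m int_obs (F x) (consp y w)).
  by apply: eq_integral => y _; exact: ih.
rewrite -(fubini_tonelli (m1 := mu) (m2 := nu)
  (fun u : X * Y => iter m int_obs (F u.1) (consp u.2 w)))//.
  apply: (measurableT_comp (measurable_iter_int_obs m mF F0)
    (g := fun u : X * Y => (u.1, consp u.2 w : paths nat Y))).
  apply: measurable_fun_pair; first exact: measurable_fst.
  exact: (measurableT_comp (measurable_consp1 w) measurable_snd).
by move=> u; exact: int_obs_ge0.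
Qed.

(** When the integrand reads the history alone, the hidden states can be integrated out first, which
    leaves the density [beta] of the [m] new observations. The induction peels off the oldest of
    them, and Tonelli's theorem moves its hidden state inside the later integrals. *)
Lemma iter_kerS_beta m (F : paths nat Y -> \bar R) x h :
  measurable_fun setT F -> (forall v, 0 <= F v) ->
  iter m (kerS mu nu q g) (fun u => F u.2) (x, h) =
  iter m int_obs (fun v => beta m x v * F v) h.
Proof.
move=> mF F0; elim: m x h => [|m ih] x h /=; first by rewrite mul1e.
have mB z : measurable_fun setT (fun v : paths nat Y => beta m z v * F v).
  by apply: emeasurable_funM => //; exact: measurable_beta_path.
have mBB : measurable_fun [set: X * paths nat Y] (fun u => beta m u.1 u.2 * F u.2).
  apply: emeasurable_funM; first exact: measurable_beta.
  exact: (measurableT_comp mF measurable_snd).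
have B0 z v : 0 <= beta m z v * F v by rewrite mule_ge0 ?beta_ge0.
transitivity (\int[mu \x nu]_w (iter m int_obs (fun v => beta m w.1 v * F v) (consp w.2 h) *
    (q x w.1 * g (lag s.+1 h) w.1 w.2)%:E)).
  by apply: eq_integral => w _; rewrite -ih.
rewrite fubini_tonelli2//; last 2 first.
- apply: emeasurable_funM; last first.
    apply/measurable_EFinP; exact: (measurableT_comp (measurable_rhoS qgP) (measurable_pair1 (x, h))).
  apply: (measurableT_comp (measurable_iter_int_obs m mBB B0)
    (g := fun u : X * Y => (u.1, consp u.2 h : paths nat Y))).
  apply: measurable_fun_pair; first exact: measurable_fst.
  exact: (measurableT_comp (measurable_consp1 h) measurable_snd).
- by move=> w; rewrite mule_ge0 ?int_obs_ge0// lee_fin; exact: (rhoS_ge0 qgP (x, h) w).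
apply: eq_integral => y _; rewrite /fubini_G/=.
have [mq q0 q1 mg [g0 g1]] := qgP.
have c0 z : (0 <= q x z * g (lag s.+1 h) z y)%R by rewrite mulr_ge0.
transitivity (\int[mu]_z iter m int_obs
    (fun v => (q x z * g (lag s.+1 h) z y)%:E * (beta m z v * F v)) (consp y h)).
  by apply: eq_integral => z _; rewrite iter_int_obsZ// muleC.
rewrite -iter_int_obs_fubini//; last 2 first.
- apply: emeasurable_funM => //; apply/measurable_EFinP.
  have m1 := measurableT_comp (measurable_q_state x) measurable_fst.
  have m2 := measurableT_comp (measurable_g_state (lag s.+1 h) y) measurable_fst.
  by apply: measurable_funM; [exact: m1|exact: m2].
- by move=> z v; rewrite mule_ge0 ?lee_fin.
(* A history reached from [consp y h] in [m] steps has [y] at index [m] and [h] after it, which is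
   what the first factor of [beta] reads. *)
apply: eq_iter_int_obs => v vE.
have -> : dropp m.+1 v = h by rewrite -addn1 -droppD vE.
have -> : v m = y by have := congr1 (fun f => f 0%N) vE; rewrite /dropp addn0.
rewrite muleC -ge0_integralZl//.
- by apply: eq_integral => z _; rewrite [RHS]muleCA [F v * _]muleC.
- apply: emeasurable_funM; last exact: measurable_beta_state.
  by apply/measurable_EFinP/measurable_funM; [exact: measurable_q_state|exact: measurable_g_state].
- by move=> z _; rewrite mule_ge0 ?beta_ge0 ?lee_fin.
Qed.

End conditional_density.

Section beta_continuity.
Context {R : realType} {dX dY : measure_display}.
Context {X : measurableType dX} {Y : measurableType dY} {s : nat}.
Variables (mu : probability X R) (nu : {sigma_finite_measure set Y -> \bar R}).
Variables (q : X -> X -> R) (g : s.+1.-tuple Y -> X -> Y -> R).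
Variables (q_ : nat -> X -> X -> R) (g_ : nat -> s.+1.-tuple Y -> X -> Y -> R).
Hypothesis qgP : ar_density mu nu q g.
Hypothesis qgP_ : forall k, ar_density mu nu (q_ k) (g_ k).
Variables (sp bp : R).
Hypothesis qsp : forall k x, {ae mu, forall x', (q_ k x x' <= sp)%R}.
Hypothesis gbp : forall k yb y, {ae mu, forall x, (g_ k yb x y <= bp)%R}.
Hypothesis gbp' : forall yb y, {ae mu, forall x, (g yb x y <= bp)%R}.
Hypothesis bp0 : (0 <= bp)%R.
Hypothesis cvq : forall x x', q_ k x x' @[k --> \oo] --> q x x'.
Hypothesis cvg : forall yb x y, g_ k yb x y @[k --> \oo] --> g yb x y.

Lemma beta_cvg n x (h : paths nat Y) :
  beta mu (q_ k) (g_ k) n x h @[k --> \oo] --> beta mu q g n x h.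
Proof.
elim: n x => [|n ih] x /=; first exact: cvg_cst.
(* The dominating constant is [sp * bp] for the first factor times [bp ^+ n] for the remaining
   block, uniformly in [k]. *)
have [] := @dominated_convergence _ _ _ mu setT measurableT
  (fun k x' => (q_ k x x' * g_ k (lag s.+1 (dropp n.+1 h)) x' (h n))%:E * beta mu (q_ k) (g_ k) n x' h)
  (fun x' => (q x x' * g (lag s.+1 (dropp n.+1 h)) x' (h n))%:E * beta mu q g n x' h)
  (cst (sp * bp * bp ^+ n)%:E).
- by move=> k; exact: (measurable_beta_integrand (qgP_ k)).
- exact: (measurable_beta_integrand qgP).
- apply: aeW => x' _; apply: cvgeM; last exact: ih.
    by rewrite mule_def_fin// (beta_fin_num qgP gbp' bp0).
  apply: cvg_EFin; first exact: nearW.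
  by apply: cvgM; [exact: cvq|exact: cvg].
- exact: finite_measure_integrable_cst.
- have Hq : {ae mu, forall x', forall k, (q_ k x x' <= sp)%R}.
    by apply: ae_foralln => k; exact: qsp.
  have Hg : {ae mu, forall x', forall k, (g_ k (lag s.+1 (dropp n.+1 h)) x' (h n) <= bp)%R}.
    by apply: ae_foralln => k; exact: gbp.
  move: Hq Hg; apply: filterS2 => x' Hq Hg k _.
  have [_ q0 _ _ [g0 _]] := qgP_ k.
  rewrite gee0_abs; last by rewrite mule_ge0 ?(beta_ge0 (qgP_ k)) ?(beta_factor_ge0 (qgP_ k)).
  rewrite [leRHS]EFinM; apply: lee_pmul.
  + exact: (beta_factor_ge0 (qgP_ k)).
  + exact: (beta_ge0 (qgP_ k)).
  + by rewrite lee_fin ler_pM.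
  + exact: (beta_ub (qgP_ k) (gbp k) bp0).
by move=> _ _.
Qed.

End beta_continuity.

Section likelihood_beta.
Context {R : realType} {dX dY : measure_display}.
Context {X : measurableType dX} {Y : measurableType dY} {s p : nat}.
Variables (mu : probability X R) (nu : {sigma_finite_measure set Y -> \bar R}).
Variables (q : 'rV[R]_p -> X -> X -> R) (g : 'rV[R]_p -> s.+1.-tuple Y -> X -> Y -> R).
Variable (theta : 'rV[R]_p).
Hypothesis qgP : ar_density mu nu (q theta) (g theta).

Definition past_from {T : Type} (y : int -> T) (k : int) : nat -> T := fun j => y (k - j%:Z)%R.

(** Generalized for the induction: [c] collects the factors of the hidden states already fixed, and
    [i] counts the observations they used. *)
Lemma iter_integral_beta (y : int -> Y) n (i : nat) (x0 x : X) (c : R) : (0 <= c)%R ->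
  iter_integral mu n (fun xs => (c * \prod_(k < n)
      (q theta (nth x0 (x :: xs) k) (nth x0 xs k) *
       g theta (lagged s.+1 y (i + k)%N%:Z) (nth x0 xs k) (y (i + k).+1%:Z)))%:E) =
  c%:E * beta mu (q theta) (g theta) n x (past_from y (i + n)%N%:Z).
Proof.
elim: n i x c => [|n ih] i x c c0; first by rewrite /= big_ord0 mulr1 mule1.
rewrite /= -ge0_integralZl ?lee_fin//; last 2 first.
- exact: (measurable_beta_integrand qgP).
- by move=> z _; rewrite mule_ge0 ?(beta_ge0 qgP) ?(beta_factor_ge0 qgP).
apply: eq_integral => x1 _.
have [_ q0 _ _ [g0 _]] := qgP.
have -> : dropp n.+1 (past_from y (i + n.+1)%N%:Z) = past_from y i%:Z.
  by apply/funext => j; rewrite /dropp /past_from; congr y; lia.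
have -> : past_from y (i + n.+1)%N%:Z n = y i.+1%:Z by rewrite /past_from; congr y; lia.
have := ih i.+1 x1 (c * (q theta x x1 * g theta (lag s.+1 (past_from y i)) x1 (y i.+1)))%R.
rewrite addSnnS EFinM -muleA => <-; last by rewrite !mulr_ge0.
congr iter_integral; apply/funext => xs; congr (_%:E).
rewrite big_ord_recl /= addn0 mulrA; congr (_ * _)%R.
apply: eq_bigr => k _.
by rewrite /= /bump/= !add1n !addnS addSn.
Qed.

Lemma likelihood_beta (y : int -> Y) n x0 :
  likelihood mu q g y n theta x0 = beta mu (q theta) (g theta) n x0 (past_from y n%:Z).
Proof.
have := iter_integral_beta y n 0 x0 x0 ler01; rewrite add0n mul1e => <-.
congr iter_integral; apply/funext => xs; congr (_%:E); rewrite mul1r.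
by apply: eq_bigr => k _.
Qed.

End likelihood_beta.

(** * Harris recurrence *)

Lemma le_limn_einf_near {R : realType} (u v : (\bar R)^nat) :
  (\forall n \near \oo, u n <= v n) -> limn_einf u <= limn_einf v.
Proof.
move=> [N _ uv]; rewrite !limn_einf_lim; apply: lee_lim.
- exact: is_cvg_einfs.
- exact: is_cvg_einfs.
- exists N => // n /= Nn; apply: le_ereal_inf_tmp => _ [k /= nk <-].
  apply: ge_ereal_inf; exists (u k); first by exists k.
  by apply: uv => /=; exact: leq_trans nk.
Qed.

Lemma measurable_limn_einf {R : realType} {d} {T : measurableType d} (f : (T -> \bar R)^nat) :
  (forall n, measurable_fun setT (f n)) -> measurable_fun setT (fun x => limn_einf (f^~ x)).
Proof.
move=> mf; rewrite (_ : (fun x => _) = fun x => - limn_esup (fun n => - f n x)).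
  apply: measurableT_comp => //; apply: measurable_fun_limn_esup => n.
  exact: measurableT_comp.
by apply/funext => x; rewrite -limn_einfN; congr limn_einf; apply/funext => n /=; rewrite oppeK.
Qed.

(** Along a subsequence with integrals at most [2^-j] the sum of the functions is integrable, hence
    finite almost everywhere, so its terms tend to 0. *)
Lemma L1_subseq_ae {R : realType} {d} {T : measurableType d} (P : {measure set T -> \bar R})
    (f : nat -> T -> \bar R) :
  (forall n, measurable_fun setT (f n)) -> (forall n x, 0 <= f n x) ->
  \int[P]_x f n x @[n --> \oo] --> 0 ->
  exists2 r : nat -> nat, forall j, (j < r j)%N &
    {ae P, forall x, f (r j) x @[j --> \oo] --> 0}.
Proof.
move=> mf f0 If.
have step j : exists n, (j < n)%N /\ \int[P]_x f n x <= (geometric 1 (1/2) j)%:E.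
  have g0 : (0 < geometric 1 (1/2) j :> R)%R by rewrite /geometric/= mul1r exprn_gt0.
  move: If => /fine_cvgP[[N1 _ H1] /cvgrPdist_le /(_ _ g0)[N2 _ H2]].
  pose n := maxn j.+1 (maxn N1 N2); exists n; split; first by rewrite leq_max leqnn.
  have n1 : (N1 <= n)%N by rewrite !leq_max leqnn !orbT.
  have n2 : (N2 <= n)%N by rewrite !leq_max leqnn !orbT.
  have := H2 _ n2; rewrite /= sub0r normrN => H.
  by rewrite -[leLHS](fineK (H1 _ n1)) lee_fin (le_trans (ler_norm _)).
have [r Hr] := choice step; exists r; first by move=> j; have [] := Hr j.
pose F x := \sum_(0 <= j <oo) f (r j) x.
have F0 x : 0 <= F x by apply: nneseries_ge0 => *; exact: f0.
have IF : P.-integrable setT F.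
  apply/integrableP; split; first by apply: ge0_emeasurable_sum => // *; exact: f0.
  under eq_integral do rewrite gee0_abs//.
  rewrite integral_nneseries//.
  apply: (@le_lt_trans _ _ (\sum_(0 <= j <oo) (geometric 1 (1/2) j)%:E)).
    by apply: lee_nneseries => [j _ _|j _]; [exact: integral_ge0|have [] := Hr j].
  rewrite (_ : \sum_(0 <= j <oo) _ = (1 / (1 - 1/2))%:E) ?ltry//.
  apply/cvg_lim => //; apply: cvg_EFin; first by apply: nearW => n; rewrite sumEFin.
  have := @cvg_geometric_series R 1 (1/2).
  rewrite ger0_norm//; have -> : (1 / 2 < 1 :> R)%R by lra.
  move=> /(_ isT); apply: cvg_trans; apply: near_eq_cvg; apply: nearW => n /=.
  by rewrite /series/= sumEFin.
apply: filterS (integrable_ae measurableT IF) => x /(_ I) Fx.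
have Ftail := nneseries_tail_cvg (f := fun j => f (r j) x) (P := xpredT) _ (fun k _ => f0 (r k) x).
have {}Ftail := Ftail (_ : F x < +oo).
apply: (squeeze_cvge _ (cvg_cst 0) (Ftail _)); last by rewrite -ge0_fin_numE// F0.
apply: nearW => j; rewrite f0/=.
apply: le_trans (nneseries_lim_ge j.+1 _) => [|k _ _]; last exact: f0.
by rewrite big_nat1.
Qed.

Section harris.
Context {R : realType} {dX dY : measure_display}.
Context {X : measurableType dX} {Y : measurableType dY} {s : nat}.
Variables (mu : probability X R) (nu : {sigma_finite_measure set Y -> \bar R}).
Variables (q : X -> X -> R) (g : s.+1.-tuple Y -> X -> Y -> R).
Hypothesis qgP : ar_density mu nu q g.

Local Notation Z := (X * s.+1.-tuple Y)%type.
Local Notation K := (kerZ mu nu q g).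
Variable pi : probability Z R.
Hypothesis pi_inv : Defs.invariant K pi.

Lemma integral_kerZ f : measurable_fun setT f -> (forall z, 0 <= f z) ->
  \int[pi]_z K f z = \int[pi]_z f z.
Proof.
move=> mf f0; apply/esym.
apply: (dker_transfer (U := id) (V := id) measurable_phiZ (measurable_rhoZ qgP) (rhoZ_ge0 qgP)) => //.
by move=> A mA; rewrite setTI pi_inv.
Qed.

Lemma kerZ_le f h z : measurable_fun setT f -> measurable_fun setT h ->
  (forall x, 0 <= f x) -> (forall x, f x <= h x) -> K f z <= K h z.
Proof.
by apply: dker_le; [exact: measurable_phiZ|exact: (measurable_rhoZ qgP)|exact: (rhoZ_ge0 qgP)].
Qed.

Lemma kerZ_cst c z : 0 <= c -> K (cst c) z = c.
Proof. by move=> c0; apply: dker_cst => //; [exact: measurable_rhoZ qgP|exact: rhoZ_ge0 qgP|exact: rhoZ_int1 qgP]. Qed.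

Lemma kerZZ (c : R) f z : (0 <= c)%R -> measurable_fun setT f ->
  (forall x, 0 <= f x) -> K (fun y => c%:E * f y) z = c%:E * K f z.
Proof.
by apply: dkerZ; [exact: measurable_phiZ|exact: (measurable_rhoZ qgP)|exact: (rhoZ_ge0 qgP)].
Qed.

Lemma kerZD f h z : measurable_fun setT f -> measurable_fun setT h ->
  (forall x, 0 <= f x) -> (forall x, 0 <= h x) ->
  K (fun y => f y + h y) z = K f z + K h z.
Proof.
by apply: dkerD; [exact: measurable_phiZ|exact: (measurable_rhoZ qgP)|exact: (rhoZ_ge0 qgP)].
Qed.

Section visits.
Variable A : set Z.
Hypothesis mA : measurable A.

Local Notation v := (visits_ge K A).

Lemma visits_ge_ge0 N m z : 0 <= v N m z.
Proof.
elim: N m z => [|N ih] m z /=; first by case: m.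
by apply: (kerZ_ge0 qgP) => w; exact: ih.
Qed.

(** The Boolean subtracted in the argument of [visits_ge] hides its measurability; indicators expose
    it. *)
Lemma visits_split N m w : v N (m - (w \in A))%N w =
  (\1_A w)%:E * v N m.-1 w + (\1_(~` A) w)%:E * v N m w.
Proof.
rewrite !indicE in_setC; case: (w \in A) => /=.
  by rewrite mul0e adde0 mul1e subn1.
by rewrite mul0e add0e mul1e subn0.
Qed.

Lemma measurable_visits N m : measurable_fun setT (v N m).
Proof.
elim: N m => [|N ih] m /=; first by case: m => [|m]; exact: measurable_cst.
apply: (measurable_kerZ qgP); last by move=> w; exact: visits_ge_ge0.
under eq_fun do rewrite visits_split.
apply: emeasurable_funD; apply: emeasurable_funM => //;
  apply/measurable_EFinP; apply: measurable_indic => //; exact: measurableC.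
Qed.

Lemma measurable_visits_split N m : measurable_fun setT (fun w => v N (m - (w \in A))%N w).
Proof.
under eq_fun do rewrite visits_split.
apply: emeasurable_funD; apply: emeasurable_funM; try exact: measurable_visits;
  apply/measurable_EFinP; apply: measurable_indic => //; exact: measurableC.
Qed.

Lemma visits_ge_le1 N m z : v N m z <= 1.
Proof.
elim: N m z => [|N ih] m z /=; first by case: m.
rewrite -(kerZ_cst z lee01); apply: kerZ_le => //.
- exact: measurable_visits_split.
- by move=> w; exact: visits_ge_ge0.
Qed.

(** A visit within [N + 1] steps happens at the first step or during the next [N]; by invariance the
    former has probability [pi A] under [pi]. *)
Lemma integral_visits0 N : pi A = 0 -> \int[pi]_z v N 1 z = 0.
Proof.
move=> A0; elim: N => [|N ih]; first exact: integral0.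
rewrite [LHS]integral_kerZ; last 2 first.
- exact: measurable_visits_split.
- by move=> w; exact: visits_ge_ge0.
apply/eqP; rewrite eq_le integral_ge0 ?andbT => [|w _]; last exact: visits_ge_ge0.
rewrite -[leRHS](adde0 0) -[X in X + _]ih -[X in _ + X]A0 -[A in pi A]setIT -integral_indic//.
rewrite -ge0_integralD//; last 3 first.
- by move=> w _; exact: visits_ge_ge0.
- exact: measurable_visits.
- by apply/measurable_EFinP; exact: measurable_indic.
apply: ge0_le_integral => //.
- by move=> w _; exact: visits_ge_ge0.
- exact: measurable_visits_split.
- by apply: emeasurable_funD; [exact: measurable_visits|apply/measurable_EFinP; exact: measurable_indic].
move=> w _; rewrite -[leLHS]/(v N (1 - (w \in A))%N w) visits_split addeC leeD//.
  rewrite indicE; case: (_ \in _); first by rewrite mul1e.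
  by rewrite mul0e visits_ge_ge0.
by rewrite -[leRHS]mule1 lee_wpmul2l ?lee_fin// visits_ge_le1.
Qed.

End visits.

Hypothesis Hharris : harris_recurrent K.

(** Harris recurrence speaks of sets charged by an unknown [phi]. If [phi] did not charge [A] it
    would charge the complement, which would then be hit from everywhere, although a chain started
    from [pi] almost surely never visits this null set. *)
Lemma harris_full_hit A : measurable A -> pi (~` A) = 0 ->
  forall z, visits_ge K A N 1 z @[N --> \oo] --> (1 : \bar R).
Proof.
move=> mA A0; have [phi [phi0 hit]] := Hharris.
have [phiA|phiA] := ltP 0 (phi A); first by move=> z; exact: hit.
exfalso; have mAC : measurable (~` A) by exact: measurableC.
have phiAC : 0 < phi (~` A).
  rewrite lt0e measure_ge0 andbT; apply/negP => /eqP phiAC.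
  move: phi0; rewrite ltNge => /negP; apply.
  rewrite -(setUv A) (le_trans (measureU2 _ _ _))//.
  rewrite -[leRHS](adde0 0); apply: leeD => //.
  by rewrite le_eqVlt; apply/orP; left; apply/eqP.
have : \int[pi]_z limn_einf (fun N => visits_ge K (~` A) N 1 z) <= 0.
  apply: le_trans (fatou pi measurableT _ _) _ => //.
  - by move=> N; exact: measurable_visits.
  - by move=> N z _; exact: visits_ge_ge0.
  under [X in limn_einf X]eq_fun do rewrite integral_visits0//.
  by rewrite (cvg_limn_einf_sup (cvg_cst (0 : \bar R))).1.
rewrite (eq_integral (cst 1)) => [|z _].
  have pi1 : 0 < pi setT by rewrite probability_setT lte01.
  by rewrite leNgt integral_cst// mul1e => /negP; apply.
by rewrite (cvg_limn_einf_sup (hit _ mAC phiAC z 1%N)).1.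
Qed.

Variable H : Z -> \bar R.
Hypothesis mH : measurable_fun setT H.
Hypothesis H01 : forall z, 0 <= H z <= 1.

Definition cesaro (n : nat) (z : Z) : \bar R :=
  (n%:R^-1)%:E * \sum_(k < n) iter k K H z.

Lemma iter_kerZ01 k z : 0 <= iter k K H z <= 1.
Proof.
suff : measurable_fun setT (iter k K H) /\ forall z, 0 <= iter k K H z <= 1 by case.
elim: k => [//|k [mk ih]] /=.
have k0 w : 0 <= iter k K H w by have /andP[] := ih w.
have k1 w : iter k K H w <= 1 by have /andP[] := ih w.
split; first exact: (measurable_kerZ qgP).
move=> w; rewrite (kerZ_ge0 qgP)//= -(kerZ_cst w lee01).
exact: kerZ_le.
Qed.

Lemma measurable_iter_kerZ k : measurable_fun setT (iter k K H).
Proof.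
elim: k => [//|k ih] /=; apply: (measurable_kerZ qgP) => // z.
by have /andP[] := iter_kerZ01 k z.
Qed.

Lemma cesaro_ge0 n z : 0 <= cesaro n z.
Proof.
rewrite mule_ge0 ?lee_fin//; apply: sume_ge0 => k _.
by have /andP[] := iter_kerZ01 k z.
Qed.

Lemma measurable_cesaro n : measurable_fun setT (cesaro n).
Proof.
apply: measurable_funeM; apply: emeasurable_sum => k; exact: measurable_iter_kerZ.
Qed.

(** A kernel step moves the window of summation by one: the term lost is nonnegative and the term
    gained is at most 1. *)
Lemma kerZ_cesaro n z : K (cesaro n) z <= cesaro n z + (n%:R^-1)%:E.
Proof.
have k0 k w : 0 <= iter k K H w by have /andP[] := iter_kerZ01 k w.
rewrite /cesaro kerZZ//; last 2 first.
- by apply: emeasurable_sum => k; exact: measurable_iter_kerZ.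
- by move=> w; apply: sume_ge0 => k _.
have -> : K (fun w => \sum_(k < n) iter k K H w) z =
    \sum_(k < n) iter k.+1 K H z.
  elim: n => [|n ih].
    rewrite big_ord0; under [X in K X]eq_fun do rewrite big_ord0.
    exact: kerZ_cst.
  under [X in K X]eq_fun do rewrite big_ord_recr.
  rewrite kerZD//; last 3 first.
  - by apply: emeasurable_sum => k; exact: measurable_iter_kerZ.
  - exact: measurable_iter_kerZ.
  - by move=> w; apply: sume_ge0.
  by rewrite ih big_ord_recr.
apply: (@le_trans _ _ ((n%:R^-1)%:E * (\sum_(k < n) iter k K H z + 1))).
  rewrite lee_wpmul2l ?lee_fin//.
  apply: (@le_trans _ _ (\sum_(k < n.+1) iter k K H z)).
    rewrite [leRHS]big_ord_recl/= leeDr//; by have /andP[] := H01 z.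
  by rewrite big_ord_recr/= leeD2l//; have /andP[] := iter_kerZ01 n z.
by rewrite ge0_muleDr ?mule1// sume_ge0.
Qed.

(** Convergence in mean only gives [h >= a] almost everywhere for [pi], where [h] is the lower limit
    along a subsequence. But [h] is superharmonic, so [h z] is at least [a] times the probability of
    reaching the set where [h >= a], and this probability is 1 from every [z]. *)
Lemma harris_cesaro (a : R) : (0 <= a)%R ->
  \int[pi]_z `|cesaro n z - a%:E| @[n --> \oo] --> 0 ->
  exists2 r : nat -> nat, forall j, (j < r j)%N &
    forall z, a%:E <= limn_einf (fun j => cesaro (r j) z).
Proof.
move=> a0 L1; have mc := measurable_cesaro.
have [|n z|r rj ae_r] := L1_subseq_ae _ _ L1.
- by move=> n; apply: measurableT_comp => //; apply: emeasurable_funB.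
- exact: abse_ge0.
exists r => //; pose h z := limn_einf (fun j => cesaro (r j) z).
have h0 z : 0 <= h z.
  rewrite -(cvg_limn_einf_sup (cvg_cst (0 : \bar R))).1.
  by apply: le_limn_einf_near; apply: nearW => j; exact: cesaro_ge0.
have mh : measurable_fun setT h by exact: measurable_limn_einf.
have Kh z : K h z <= h z.
  apply: le_trans (dker_fatou _ _ measurable_phiZ (measurable_rhoZ qgP) (rhoZ_ge0 qgP) _ _ _) _ => //.
    by move=> j w; exact: cesaro_ge0.
  apply/lee_addgt0Pr => e e0; rewrite addeC -limn_einf_shift//.
  (* As [r j > j], the threshold makes [r j] exceed [1 / e], so the error [1 / r j] of a kernel step
     is at most [e]. *)
  apply: le_limn_einf_near; exists (Num.truncn e^-1) => // j /= jn.
  apply: le_trans (kerZ_cesaro _ _) _; rewrite addeC leeD2r// lee_fin.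
  rewrite -[leRHS]invrK lef_pV2 ?posrE ?invr_gt0//; last first.
    by rewrite ltr0n (leq_ltn_trans _ (rj j)).
  rewrite ltW// (lt_le_trans (Num.Theory.truncnS_gt _))// ler_nat.
  exact: leq_ltn_trans jn (rj j).
pose C := [set z | a%:E <= h z].
have mC : measurable C.
  rewrite (_ : C = h @^-1` `[a%:E, +oo[); last by apply/seteqP; split => z /=; rewrite in_itv/= andbT.
  by rewrite -[X in measurable X]setTI; apply: mh => //; exact: emeasurable_itv.
have piC : pi (~` C) = 0.
  apply/(negligibleP _ (measurableC mC)); apply: negligibleS ae_r => z nC Hz; apply: nC.
  rewrite /C/=/h.
  have -> : (fun j => cesaro (r j) z) = fun j => a%:E + (cesaro (r j) z - a%:E).
    by apply/funext => j; rewrite addeC subeK.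
  have cv : cesaro (r j) z - a%:E @[j --> \oo] --> 0 by exact/cvg_abse0P.
  by rewrite limn_einf_shift// (cvg_limn_einf_sup cv).1 adde0.
(* Optional stopping at the first visit to [C], as an induction on the horizon: a visit at the next
   step gives [a] at once, otherwise [N] steps remain. *)
have key N z : a%:E * visits_ge K C N 1 z <= h z.
  elim: N z => [|N ih] z; first by rewrite /= mule0.
  apply: le_trans (Kh z); rewrite /= -kerZZ//.
  - apply: kerZ_le => //.
    + by apply: measurable_funeM; exact: measurable_visits_split.
    + by move=> w; rewrite mule_ge0 ?lee_fin// visits_ge_ge0.
    + move=> w; have [Cw|nC] := pselect (C w).
        rewrite (le_trans _ Cw)// -[leRHS]mule1 lee_wpmul2l ?lee_fin//.
        exact: visits_ge_le1.
      by rewrite memNset//= subn0; exact: ih.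
  - exact: measurable_visits_split.
  - by move=> w; exact: visits_ge_ge0.
move=> z; have cv := harris_full_hit mC piC z.
have {}cv : a%:E * visits_ge K C N 1 z @[N --> \oo] --> a%:E.
  by rewrite -[X in _ --> X]mule1; exact: cvgeZl.
by apply: (cvge_le _ cv); apply: nearW => N; exact: key.
Qed.

End harris.

(** Jensen's inequality for a conditional expectation [u] of [v]. Since [u - a] keeps its sign on
    [C] and on its complement, equality of the integrals over these two sets is all that it
    takes. *)
Lemma L1_dist_le {R : realType} {d} {T : measurableType d} (P : probability T R)
    (u v : T -> R) (a : R) :
  measurable_fun setT u -> measurable_fun setT v ->
  (forall x, 0 <= u x <= 1)%R -> (forall x, 0 <= v x <= 1)%R ->
  let C := [set x | (a <= u x)%R] in
  \int[P]_(x in C) (u x)%:E = \int[P]_(x in C) (v x)%:E ->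
  \int[P]_(x in ~` C) (u x)%:E = \int[P]_(x in ~` C) (v x)%:E ->
  \int[P]_x `|u x - a|%:E <= \int[P]_x `|v x - a|%:E.
Proof.
move=> mu mv u01 v01 C uvC uvCC.
have mC : measurable C.
  rewrite (_ : C = u @^-1` `[a, +oo[); last by apply/seteqP; split => x /=; rewrite in_itv/= andbT.
  by rewrite -[X in measurable X]setTI; exact: mu.
have mCC := measurableC mC.
have Ib (f : T -> R) D : measurable D -> measurable_fun setT f -> (forall x, 0 <= f x <= 1)%R ->
    P.-integrable D (EFin \o f).
  move=> mD mf f01; apply: (integrableS measurableT) => //.
  apply: (@bounded_integrable _ _ _ _ _ 1%R) => // x.
  by have /andP[? ?] := f01 x; rewrite ger0_norm.
have Ic D : measurable D -> P.-integrable D (EFin \o cst a).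
  by move=> mD; exact: finite_measure_integrable_cst.
have split (f : T -> R) : measurable_fun setT f ->
    \int[P]_x `|f x - a|%:E =
    \int[P]_(x in C) `|f x - a|%:E + \int[P]_(x in ~` C) `|f x - a|%:E.
  move=> mf; rewrite -[in LHS](setUv C) ge0_integral_setU//.
    rewrite setUv; apply/measurable_EFinP; apply: measurableT_comp => //.
    exact: measurable_funB.
  exact/disj_setPCl.
rewrite !split//; apply: leeD.
  apply: (@le_trans _ _ (\int[P]_(x in C) ((v x)%:E - a%:E))).
    rewrite (integralB_EFin mC (Ib v C mC mv v01) (Ic C mC)) -uvC.
    rewrite -(integralB_EFin mC (Ib u C mC mu u01) (Ic C mC)).
    rewrite le_eqVlt; apply/orP; left; apply/eqP; apply: eq_integral => x /set_mem Cx.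
    by rewrite -EFinB ger0_norm// subr_ge0.
  apply: le_integral => //.
  - exact: (integrableB mC (Ib v C mC mv v01) (Ic C mC)).
  - exact: (integrable_abse (integrableB mC (Ib v C mC mv v01) (Ic C mC))).
  - by move=> x _; rewrite -EFinB lee_fin ler_norm.
apply: (@le_trans _ _ (\int[P]_(x in ~` C) (a%:E - (v x)%:E))).
  rewrite (integralB_EFin mCC (Ic _ mCC) (Ib v _ mCC mv v01)) -uvCC.
  rewrite -(integralB_EFin mCC (Ic _ mCC) (Ib u _ mCC mu u01)).
  rewrite le_eqVlt; apply/orP; left; apply/eqP; apply: eq_integral => x /set_mem Cx.
  rewrite -EFinB distrC ger0_norm// subr_ge0 ltW// ltNge; exact/negP.
apply: le_integral => //.
- exact: (integrableB mCC (Ic _ mCC) (Ib v _ mCC mv v01)).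
- exact: (integrable_abse (integrableB mCC (Ib v _ mCC mv v01) (Ic _ mCC))).
- by move=> x _; rewrite -EFinB lee_fin distrC ler_norm.
Qed.

(** * Ergodic theorems in mean for the stationary chain *)

Section stationary_ergodic.
Context {R : realType} {dX dY : measure_display}.
Context {X : measurableType dX} {Y : measurableType dY} {s : nat}.
Variables (mu : probability X R) (nu : {sigma_finite_measure set Y -> \bar R}).
Variables (q : X -> X -> R) (g : s.+1.-tuple Y -> X -> Y -> R).
Hypothesis qgP : ar_density mu nu q g.

Local Notation Z := (X * s.+1.-tuple Y)%type.
Local Notation S := (X * paths nat Y)%type.
Local Notation E := (paths int (X * Y)%type).
Local Notation stZ := (@stateZ _ _ X Y s).
Local Notation K := (kerZ mu nu q g).
Local Notation KS := (kerS mu nu q g).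

Variables (P : probability E R) (pi : probability Z R).
Hypothesis Ppi : forall k A, measurable A -> P (stZ k @^-1` A) = pi A.
Hypothesis PM : markov mu nu q g P.
Hypothesis pi_unique : unique_invariant K pi.

Let T : E -> E := shiftE 1.
Let PT : forall A, measurable A -> P (T @^-1` A) = P A.
Proof. by move=> A mA; exact: (shift_stationary qgP Ppi PM). Qed.
Let ergT : forall A, measurable A -> T @^-1` A = A -> P A = 0 \/ P A = 1.
Proof. by move=> A mA AT; exact: (invariant_event01 qgP Ppi PM mA AT pi_unique). Qed.

Lemma measurable_past_obsE k : measurable_fun setT (fun e : E => past_obs e k).
Proof. exact: (measurableT_comp measurable_snd (measurable_stateS k)). Qed.

Lemma past_obs_shiftE (c k : int) (e : E) : past_obs (shiftE c e) k = past_obs e (k + c)%R.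
Proof. by have [] := stateS_shiftE c k e. Qed.

Lemma birkhoff_sum_past (f : paths nat Y -> R) n e :
  birkhoff_sum T (fun e => f (past_obs e 0%R)) n e = (\sum_(i < n) f (past_obs e i%:Z))%R.
Proof.
by apply: eq_bigr => i _; rewrite iter_shiftE past_obs_shiftE add0r.
Qed.

Lemma stationary_ge0 k (f : S -> \bar R) : measurable_fun setT f -> (forall u, 0 <= f u) ->
  \int[P]_e f (stateS k e) = \int[P]_e f (stateS 0%R e).
Proof.
move=> mf f0.
have mfs : measurable_fun setT (fun e : E => f (stateS 0%R e)).
  exact: (measurableT_comp mf (measurable_stateS 0%R)).
have := ge0_integral_law (measurable_shiftE k)
  (fun A mA => shift_stationary qgP Ppi PM k mA) mfs (fun e => f0 _).
by move=> <-; apply: eq_integral => e _; rewrite stateS_shiftE add0r.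
Qed.

Lemma stationary_iter m (f : S -> \bar R) : measurable_fun setT f -> (forall u, 0 <= f u) ->
  \int[P]_e iter m KS f (stateS 0%R e) = \int[P]_e f (stateS 0%R e).
Proof.
move=> mf f0.
have P1 : P setT < +oo by rewrite probability_setT ltry.
have pT : <<s @past_gen _ _ X Y 0%R >> setT.
  exact: (@measurableT _ (g_sigma_algebraType (past_gen 0%R))).
elim: m => [//|m ih]; rewrite -ih.
have mk : measurable_fun setT (iter m KS f) /\ forall u, 0 <= iter m KS f u.
  elim: m {ih} => [//|m [mk k0]]; split; first exact: measurable_kerS.
  by move=> u; exact: kerS_ge0.
have [mk1 k0] := mk.
rewrite -(stationary_ge0 (0 + 1)%R mk1 k0).
by rewrite (markovS qgP PM P1 pT).
Qed.

Lemma birkhoff_past (f : paths nat Y -> R) : measurable_fun setT f ->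
  P.-integrable setT (fun e => (f (past_obs e 0%R))%:E) ->
  {ae P, forall e, ((\sum_(i < n) f (past_obs e i%:Z)) / n%:R)%R @[n --> \oo] -->
    fine (\int[P]_e (f (past_obs e 0%R))%:E)}.
Proof.
move=> mf If; have := birkhoff (measurable_shiftE 1) PT ergT If.
by apply: filterS => e; under eq_fun do rewrite birkhoff_sum_past.
Qed.

Definition obs_mean (f : paths nat Y -> R) : R := fine (\int[P]_e (f (past_obs e 0%R))%:E).

Lemma measurable_obs (f : paths nat Y -> R) : measurable_fun setT f ->
  measurable_fun setT (fun e : E => f (past_obs e 0%R)).
Proof. by move=> mf; exact: (measurableT_comp mf (measurable_past_obsE 0%R)). Qed.

Definition obs_avg (f : paths nat Y -> R) (n : nat) (h : paths nat Y) : R :=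
  ((\sum_(k < n) f (dropp k h)) / n%:R)%R.

Lemma measurable_obs_avg f n : measurable_fun setT f -> measurable_fun setT (obs_avg f n).
Proof.
move=> mf; apply: measurable_funM => //; apply: measurable_sum => k.
exact: (measurableT_comp mf (measurable_dropp k)).
Qed.

(** [obs_avg] looks backwards from time 0 whereas Birkhoff sums look forwards; after a shift by
    [n - 1] the two sums differ only in the order of their terms. *)
Lemma obs_avg_L1 (f : paths nat Y -> R) : measurable_fun setT f ->
  (forall h, (0 <= f h <= 1)%R) ->
  \int[P]_e `|obs_avg f n (past_obs e 0%R) - obs_mean f|%:E @[n --> \oo] --> 0.
Proof.
move=> mf f01.
have := birkhoff_L1 (measurable_shiftE 1) PT ergT (measurable_obs mf) (fun e => f01 _).
apply: cvg_trans; apply: near_eq_cvg; exists 1%N => // n /= n1.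
have mF : measurable_fun setT (fun u : S => `|obs_avg f n u.2 - obs_mean f|%:E).
  apply/measurable_EFinP; apply: measurableT_comp => //; apply: measurable_funB => //.
  exact: (measurableT_comp (measurable_obs_avg n mf) measurable_snd).
transitivity (\int[P]_e `|obs_avg f n (past_obs e n.-1%:Z) - obs_mean f|%:E).
  apply: eq_integral => e _; congr (`|_ - _|%:E)%R.
  rewrite birkhoff_sum_past /obs_avg; congr (_ / _)%R.
  rewrite (reindex_inj rev_ord_inj)/=; apply: eq_bigr => k _; congr f.
  by apply/funext => j; rewrite /past_obs /dropp; congr (e _).2; have := ltn_ord k; lia.
exact: (stationary_ge0 n.-1%:Z mF).
Qed.

Lemma markovZ_iter (C : set E) k (f : Z -> \bar R) : <<s past_gen 0%R >> C ->
  measurable_fun setT f -> (forall z, 0 <= f z) ->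
  \int[P]_(e in C) f (stZ k%:Z e) = \int[P]_(e in C) iter k K f (stZ 0%R e).
Proof.
move=> C0; elim: k f => [//|k ih] f mf f0.
rewrite -addn1 PoszD (markovZ qgP PM)//; last by apply: (past_sub _ C0).
by rewrite ih -?iterSr ?addn1//; [exact: measurable_kerZ|move=> z; exact: kerZ_ge0].
Qed.

(** At the state of time 0, [cesaro n] is the conditional expectation of the Birkhoff average of [H]
    given that state, and conditioning does not increase the L1 distance to a constant. *)
Lemma cesaro_L1 (H : Z -> R) : measurable_fun setT H -> (forall z, (0 <= H z <= 1)%R) ->
  \int[pi]_z `|cesaro mu nu q g (EFin \o H) n z - (fine (\int[pi]_z (H z)%:E))%:E|
    @[n --> \oo] --> 0.
Proof.
move=> mH H01; set a := fine _.
have lawZ : forall A, measurable A -> P (stZ 0%R @^-1` A) = pi A by exact: Ppi.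
have mEH : measurable_fun setT (EFin \o H) by exact/measurable_EFinP.
have EH01 z : 0 <= (EFin \o H) z <= 1 by rewrite !lee_fin.
have aE : a = fine (\int[P]_e (H (stZ 0%R e))%:E).
  by rewrite (ge0_integral_law (measurable_stateZ 0%R) lawZ (f := EFin \o H))// => z; rewrite lee_fin; have /andP[] := H01 z.
have mHs : measurable_fun setT (fun e => H (stZ 0%R e)).
  exact: (measurableT_comp mH (measurable_stateZ 0%R)).
have := birkhoff_L1 (measurable_shiftE 1) PT ergT mHs (fun e => H01 _).
rewrite -aE => L1.
have mc n := measurable_cesaro qgP mEH EH01 n.
have c01 n z : 0 <= cesaro mu nu q g (EFin \o H) n z <= 1.
  rewrite cesaro_ge0//=; case: n => [|n]; first by rewrite /cesaro big_ord0 mule0.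
  rewrite /cesaro lee_pdivrMl// mule1.
  apply: (@le_trans _ _ (\sum_(k < n.+1) 1)).
    by apply: lee_sum => k _; have /andP[] := iter_kerZ01 qgP mEH EH01 k z.
  by rewrite sumEFin sumr_const card_ord.
have cfin n z : cesaro mu nu q g (EFin \o H) n z \is a fin_num.
  have /andP[c0 c1] := c01 n z; rewrite ge0_fin_numE//.
  by rewrite (le_lt_trans c1)// ltry.
apply: (squeeze_cvge _ (cvg_cst 0) L1); apply: nearW => n.
rewrite integral_ge0//=.
pose u e := fine (cesaro mu nu q g (EFin \o H) n (stZ 0%R e)).
pose v e := (birkhoff_sum T (fun e => H (stZ 0%R e)) n e / n%:R)%R.
have vE e : (v e)%:E = (n%:R^-1)%:E * \sum_(k < n) (H (stZ k%:Z e))%:E.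
  rewrite /v mulrC EFinM sumEFin; congr (_ * _%:E).
  by apply: eq_bigr => i _; rewrite iter_shiftE stateZ_shiftE add0r.
have mu' : measurable_fun setT u.
  apply: measurableT_comp => //.
  exact: (measurableT_comp (mc n) (measurable_stateZ 0%R)).
have mv : measurable_fun setT v.
  apply: measurable_funM => //; apply: measurable_birkhoff_sum => //.
  exact: measurable_shiftE.
have H0 z : (0 <= H z)%R by have /andP[] := H01 z.
(* The defining identity of this conditional expectation. *)
have uv D : measurable D -> \int[P]_(e in stZ 0%R @^-1` D) (u e)%:E =
    \int[P]_(e in stZ 0%R @^-1` D) (v e)%:E.
  move=> mD.
  have pD : <<s @past_gen _ _ X Y 0%R >> (stZ 0%R @^-1` D).
    have mlD : measurable (@lagS _ _ X Y s @^-1` D).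
      by rewrite -[X in measurable X]setTI; exact: measurable_lagS.
    exact: (past_stateS mlD).
  have mD' := past_measurable pD.
  under eq_integral do rewrite /u fineK//.
  under [RHS]eq_integral do rewrite vE.
  have mk k : measurable_fun setT (fun e => iter k K (EFin \o H) (stZ 0%R e)).
    exact: (measurableT_comp (measurable_iter_kerZ qgP mEH EH01 k) (measurable_stateZ 0%R)).
  have mHk k : measurable_fun setT (fun e => (H (stZ k e))%:E).
    exact: (measurableT_comp mEH (measurable_stateZ k)).
  have k0 k e : 0 <= iter k K (EFin \o H) (stZ 0%R e).
    by have /andP[] := iter_kerZ01 qgP mEH EH01 k (stZ 0%R e).
  rewrite ge0_integralZl//; last 2 first.
  - by apply: measurable_funTS; apply: emeasurable_sum => k; exact: mHk.
  - by move=> e _; apply: sume_ge0 => k _; rewrite lee_fin.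
  rewrite ge0_integralZl//; last 2 first.
  - by apply: measurable_funTS; apply: emeasurable_sum => k; exact: mk.
  - by move=> e _; apply: sume_ge0 => k _.
  congr (_ * _); rewrite !ge0_integral_sum//;
    try (by move=> k; exact: measurable_funTS); try (by move=> k e _; rewrite lee_fin).
  by apply: eq_bigr => k _; rewrite -(markovZ_iter _ pD mEH).
pose D := [set z | a%:E <= cesaro mu nu q g (EFin \o H) n z].
have mD : measurable D.
  rewrite (_ : D = cesaro mu nu q g (EFin \o H) n @^-1` `[a%:E, +oo[).
    by rewrite -[X in measurable X]setTI; apply: mc => //; exact: emeasurable_itv.
  by apply/seteqP; split => z /=; rewrite in_itv/= andbT.
have DE : stZ 0%R @^-1` D = [set e | (a <= u e)%R].
  have ue e : (a <= u e)%R = (a%:E <= cesaro mu nu q g (EFin \o H) n (stZ 0%R e)).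
    by rewrite /u -lee_fin (fineK (cfin _ _)).
  by apply/seteqP; split => e; rewrite /D/= ue.
apply: le_trans (L1_dist_le mu' mv _ _ (a := a) _ _).
- rewrite -(ge0_integral_law (measurable_stateZ 0%R) lawZ
    (f := fun z => `|cesaro mu nu q g (EFin \o H) n z - a%:E|))//; last first.
    by apply: measurableT_comp => //; apply: emeasurable_funB.
  rewrite le_eqVlt; apply/orP; left; apply/eqP; apply: eq_integral => e _.
  by rewrite -abse_EFin EFinB (fineK (cfin _ _)).
- by move=> e; rewrite -!lee_fin (fineK (cfin _ _)); exact: c01.
- move=> e; rewrite -!lee_fin vE.
  have := c01 n (stZ 0%R e); move=> _; rewrite mule_ge0 ?lee_fin//=; last first.
    by apply: sume_ge0 => k _; rewrite lee_fin.
  case: n {L1 cfin uv mu' mv vE D mD DE u v} => [|n]; first by rewrite big_ord0 mule0.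
  rewrite lee_pdivrMl// mule1.
  apply: (@le_trans _ _ (\sum_(k < n.+1) 1)).
    by apply: lee_sum => k _; rewrite lee_fin; have /andP[] := H01 (stZ k e).
  by rewrite sumEFin sumr_const card_ord.
- by rewrite -DE uv.
- by rewrite -DE; exact: (uv _ (measurableC mD)).
Qed.

End stationary_ergodic.

Definition depends_on {T U : Type} (n : nat) (f : (nat -> T) -> U) : Prop :=
  forall h h', (forall j, (j < n)%N -> h j = h' j) -> f h = f h'.

Lemma depends_on_le {T U : Type} m n (f : (nat -> T) -> U) :
  (m <= n)%N -> depends_on m f -> depends_on n f.
Proof. by move=> mn fm h h' hh; apply: fm => j jm; apply: hh; exact: leq_trans mn. Qed.

Lemma sum_shift_le {R : realType} (a : nat -> R) m n : (forall i, 0 <= a i <= 1)%R ->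
  (\sum_(i < m) a (i + n.+1)%N <= \sum_(i < m) a i.+1 + n%:R)%R.
Proof.
move=> a01; elim: n => [|n ih].
  by rewrite addr0; apply: ler_sum => i _; rewrite addn1.
apply: (@le_trans _ _ (\sum_(i < m) a (i + n.+1)%N + 1)%R); last by rewrite -natr1 addrA lerD2r.
have -> : (\sum_(i < m) a (i + n.+2)%N = \sum_(i < m.+1) a (i + n.+1)%N - a n.+1)%R.
  rewrite big_ord_recl/= add0n [in RHS]addrC addKr.
  by apply: eq_bigr => i _; rewrite /= /bump/= -addnA add1n addnS.
rewrite big_ord_recr/= -addrA lerD2l.
by have /andP[? ?] := a01 (m + n.+1)%N; have /andP[? ?] := a01 n.+1; lra.
Qed.

Section observation_means.
Context {R : realType} {dX dY : measure_display}.
Context {X : measurableType dX} {Y : measurableType dY}.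

Local Notation E := (paths int (X * Y)%type).

Lemma obs_meanE (Q : probability E R) (f : paths nat Y -> R) : measurable_fun setT f ->
  (forall h, 0 <= f h <= 1)%R ->
  (obs_mean Q f)%:E = \int[Q]_e (f (past_obs e 0%R))%:E.
Proof.
move=> mf f01; rewrite fineK//; apply: integrable_fin_num => //.
apply: (@bounded_integrable _ _ _ _ _ 1%R); first exact: measurable_obs.
by move=> e; have /andP[? ?] := f01 (past_obs e 0%R); rewrite ger0_norm.
Qed.

Lemma obs_avg01 (f : paths nat Y -> R) m h : (0 < m)%N -> (forall h, 0 <= f h <= 1)%R ->
  (0 <= obs_avg f m h <= 1)%R.
Proof.
move=> m0 f01; have mR : (0 < m%:R :> R)%R by rewrite ltr0n.
have f0 k : (0 <= f k)%R by have /andP[] := f01 k.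
rewrite /obs_avg divr_ge0//=; last by apply: sumr_ge0.
rewrite ler_pdivrMr// mul1r; apply: (@le_trans _ _ (\sum_(k < m) 1)%R).
  by apply: ler_sum => k _; have /andP[] := f01 (dropp k h).
by rewrite sumr_const card_ord.
Qed.

End observation_means.

(** * Averages of local functions of the observations *)

Section observation_chain.
Context {R : realType} {dX dY : measure_display}.
Context {X : measurableType dX} {Y : measurableType dY} {s : nat}.
Variables (mu : probability X R) (nu : {sigma_finite_measure set Y -> \bar R}).
Variables (q : X -> X -> R) (g : s.+1.-tuple Y -> X -> Y -> R).
Hypothesis qgP : ar_density mu nu q g.

Local Notation Z := (X * s.+1.-tuple Y)%type.
Local Notation S := (X * paths nat Y)%type.
Local Notation E := (paths int (X * Y)%type).
Local Notation K := (kerZ mu nu q g).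
Local Notation KS := (kerS mu nu q g).

(** A step supplies one observation, so one fewer old one is read; the density of the step reads
    [s.+1] of them, whence the lower bound on [n]. *)
Lemma kerS_depends n (F : S -> \bar R) : (s.+1 <= n)%N ->
  (forall x, depends_on n.+1 (fun h => F (x, h))) ->
  forall x, depends_on n (fun h => KS F (x, h)).
Proof.
move=> sn Fn x h h' hh; apply: eq_integral => w _; congr (_ * _).
  apply: Fn => -[|j]//=; rewrite ltnS => jn; exact: hh.
congr (_%:E); rewrite /rhoS /lagS/=; congr (rhoZ _ _ (_, _) _).
by apply: eq_from_tnth => i; rewrite !tnth_mktuple; apply: hh; exact: leq_trans sn.
Qed.

Lemma iter_kerS_depends n (F : S -> \bar R) :
  (forall x, depends_on (s.+1 + n) (fun h => F (x, h))) ->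
  forall x, depends_on s.+1 (fun h => iter n KS F (x, h)).
Proof.
elim: n F => [|n ih] F Fn x; first by have := Fn x; rewrite addn0.
rewrite iterSr; apply: ih => x'; apply: kerS_depends; first exact: leq_addr.
by move=> x''; rewrite -addnS.
Qed.

Lemma iter_kerS_lagS k (f : Z -> \bar R) u :
  iter k KS (f \o @lagS _ _ X Y s) u = iter k K f (lagS u).
Proof.
elim: k u => [//|k ih] u; rewrite !iterS -kerS_lagS; congr (KS _ u).
by apply/funext => v; rewrite ih.
Qed.

(** The mean after [n] steps of a function of [n] observations sees nothing of the start beyond its
    lag window. The padding chosen by [ext] is thus harmless, and the first [k] steps can be run on
    the small chain. *)
Lemma iter_kerS_factor n (F : paths nat Y -> \bar R) k u : depends_on n F ->
  iter (k + n) KS (fun u => F u.2) u =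
  iter k K (fun z => iter n KS (fun u => F u.2) (z.1, ext z.2)) (lagS u).
Proof.
move=> Fn; rewrite iterD -iter_kerS_lagS; congr (iter k KS _ u).
apply/funext => -[x h]/=; apply: iter_kerS_depends => [x'|j js].
  exact: (depends_on_le (leq_addl _ _)).
by rewrite ext_lag.
Qed.

Section bounded.
Variable F : S -> \bar R.
Hypothesis mF : measurable_fun setT F.

Lemma iter_kerS_ge0 k : (forall u, 0 <= F u) ->
  measurable_fun setT (iter k KS F) /\ forall u, 0 <= iter k KS F u.
Proof.
move=> F0; elim: k => [//|k [mk k0]]; split; first exact: measurable_kerS.
by move=> u; exact: kerS_ge0.
Qed.

End bounded.

Lemma kerS_le F G u : measurable_fun setT F -> measurable_fun setT G ->
  (forall v, 0 <= F v) -> (forall v, F v <= G v) -> KS F u <= KS G u.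
Proof.
by apply: dker_le; [exact: measurable_phiS|exact: (measurable_rhoS qgP)|exact: (rhoS_ge0 qgP)].
Qed.

Lemma kerSZ (c : R) F u : (0 <= c)%R -> measurable_fun setT F ->
  (forall v, 0 <= F v) -> KS (fun v => c%:E * F v) u = c%:E * KS F u.
Proof.
by apply: dkerZ; [exact: measurable_phiS|exact: (measurable_rhoS qgP)|exact: (rhoS_ge0 qgP)].
Qed.

Lemma kerSD F G u : measurable_fun setT F -> measurable_fun setT G ->
  (forall v, 0 <= F v) -> (forall v, 0 <= G v) ->
  KS (fun v => F v + G v) u = KS F u + KS G u.
Proof.
by apply: dkerD; [exact: measurable_phiS|exact: (measurable_rhoS qgP)|exact: (rhoS_ge0 qgP)].
Qed.

Lemma kerS_cst (c : \bar R) u : 0 <= c -> KS (cst c) u = c.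
Proof. by move=> c0; exact: (dker_cst (@phiS _ _ X Y) (measurable_rhoS qgP) (rhoS_ge0 qgP) (rhoS_int1 qgP)). Qed.

Lemma iter_kerS_cst k (c : \bar R) u : 0 <= c -> iter k KS (cst c) u = c.
Proof.
move=> c0; elim: k u => [//|k ih] u; rewrite iterS -[RHS](kerS_cst u c0).
by congr (KS _ u); apply/funext => v; exact: ih.
Qed.

Lemma iter_kerSD k (F G : S -> \bar R) u : measurable_fun setT F -> measurable_fun setT G ->
  (forall u, 0 <= F u) -> (forall u, 0 <= G u) ->
  iter k KS (fun u => F u + G u) u = iter k KS F u + iter k KS G u.
Proof.
move=> mF mG F0 G0; elim: k u => [//|k ih] u; rewrite !iterS.
have [mFk Fk0] := iter_kerS_ge0 mF k F0; have [mGk Gk0] := iter_kerS_ge0 mG k G0.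
rewrite -kerSD//.
by congr (KS _ u); apply/funext => v; exact: ih.
Qed.

Lemma iter_kerSZ k (c : R) (F : S -> \bar R) u : (0 <= c)%R -> measurable_fun setT F ->
  (forall u, 0 <= F u) ->
  iter k KS (fun u => c%:E * F u) u = c%:E * iter k KS F u.
Proof.
move=> c0 mF F0; elim: k u => [//|k ih] u; rewrite !iterS.
have [mFk Fk0] := iter_kerS_ge0 mF k F0.
rewrite -kerSZ//.
by congr (KS _ u); apply/funext => v; exact: ih.
Qed.

Lemma iter_kerS_sum k n (F : nat -> S -> \bar R) u : (forall i, measurable_fun setT (F i)) ->
  (forall i u, 0 <= F i u) ->
  iter k KS (fun u => \sum_(i < n) F i u) u = \sum_(i < n) iter k KS (F i) u.
Proof.
move=> mF F0; elim: n u => [|n ih] u.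
  rewrite big_ord0 -[RHS](iter_kerS_cst k u (lexx 0)); congr (iter k KS _ u).
  by apply/funext => v; rewrite big_ord0.
rewrite big_ord_recr/= -ih -iter_kerSD//.
- by congr (iter k KS _ u); apply/funext => v; rewrite big_ord_recr.
- exact: emeasurable_sum.
- by move=> v; apply: sume_ge0.
Qed.

(** The last [k] steps leave the history from index [k] on untouched. *)
Lemma iter_kerS_dropp m k (F : paths nat Y -> \bar R) u : (k <= m)%N -> (forall h, 0 <= F h) ->
  iter m KS (fun v => F (dropp k v.2)) u = iter (m - k) KS (fun v => F v.2) u.
Proof.
move=> km F0; rewrite -{1}(subnK km) iterD; congr (iter _ KS _ u).
apply/funext => v; elim: k F F0 {km} v => [|k ih] F F0 v; first by rewrite /= dropp0.
rewrite iterSr; transitivity (iter k KS (fun v => F (dropp k v.2)) v); last exact: ih.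
congr (iter k KS _ v); apply/funext => w.
rewrite -(kerS_dropp qgP (F := fun h => F (dropp k h)) w)//.
Qed.

Lemma iter_kerS01 k (F : S -> \bar R) u : measurable_fun setT F ->
  (forall u, 0 <= F u <= 1) -> 0 <= iter k KS F u <= 1.
Proof.
move=> mF F01; have F0 v : 0 <= F v by have /andP[] := F01 v.
have [mk k0] := iter_kerS_ge0 mF k F0; rewrite k0/=.
elim: k u {mk k0} => [|k ih] u; first by have /andP[] := F01 u.
rewrite iterS -[leRHS](kerS_cst u lee01).
have [mk k0] := iter_kerS_ge0 mF k F0.
by apply: kerS_le.
Qed.

(** The sum runs over times 1 to [m], without the starting state: for [m > 0] this is the mean of
    [obs_avg F m] after [m] steps, when each of the averaged histories ends at a new observation. *)
Definition obs_cesaro (F : paths nat Y -> R) (m : nat) (u : S) : \bar R :=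
  (m%:R^-1)%:E * \sum_(i < m) iter i.+1 KS (fun u => (F u.2)%:E) u.

Section obs_cesaro.
Variable F : paths nat Y -> R.
Hypothesis mF : measurable_fun setT F.
Hypothesis F01 : forall h, (0 <= F h <= 1)%R.

Let mF2 : measurable_fun setT (fun u : S => (F u.2)%:E).
Proof. by apply/measurable_EFinP; exact: (measurableT_comp mF measurable_snd). Qed.

Let F2 (u : S) : 0 <= (F u.2)%:E <= 1.
Proof. by rewrite !lee_fin. Qed.

Let F20 (u : S) : 0 <= (F u.2)%:E.
Proof. by have /andP[] := F2 u. Qed.

Lemma obs_cesaro_ge0 m u : 0 <= obs_cesaro F m u.
Proof.
rewrite mule_ge0 ?lee_fin//; apply: sume_ge0 => i _.
exact: (iter_kerS_ge0 mF2 i.+1 F20).2.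
Qed.

Lemma measurable_obs_cesaro m : measurable_fun setT (obs_cesaro F m).
Proof.
apply: measurable_funeM; apply: emeasurable_sum => i.
exact: (iter_kerS_ge0 mF2 i.+1 F20).1.
Qed.

Lemma iter_kerS_obs_avg m u : (0 < m)%N ->
  iter m KS (fun u => (obs_avg F m u.2)%:E) u = obs_cesaro F m u.
Proof.
move=> m0; pose G k (u : S) := (F (dropp k u.2))%:E.
have mG k : measurable_fun setT (G k).
  apply/measurable_EFinP; apply: (measurableT_comp mF).
  exact: (measurableT_comp (measurable_dropp k) measurable_snd).
have G0 k v : 0 <= G k v by rewrite lee_fin; have /andP[] := F01 (dropp k v.2).
transitivity (iter m KS (fun u => (m%:R^-1)%:E * \sum_(k < m) G k u) u).
  by congr (iter m KS _ u); apply/funext => v; rewrite /obs_avg mulrC EFinM sumEFin.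
rewrite iter_kerSZ//; last 2 first.
- exact: emeasurable_sum.
- by move=> v; apply: sume_ge0.
congr (_ * _); rewrite iter_kerS_sum// (reindex_inj rev_ord_inj)/=.
apply: eq_bigr => i _; have im := ltn_ord i.
rewrite (iter_kerS_dropp (F := EFin \o F))//; first by rewrite subKn.
- exact: leq_subr.
- by move=> h; rewrite lee_fin; have /andP[] := F01 h.
Qed.

Lemma obs_avgC m h : (0 < m)%N -> obs_avg (fun h => 1 - F h)%R m h = (1 - obs_avg F m h)%R.
Proof.
move=> m0; rewrite /obs_avg sumrB sumr_const card_ord mulrBl divff//.
by rewrite pnatr_eq0 -lt0n.
Qed.

End obs_cesaro.

(** Turns lower bounds on the averages of [1 - F] into upper bounds on those of [F]. *)
Lemma iter_kerS_obs_avgC (F : paths nat Y -> R) m u : (0 < m)%N -> measurable_fun setT F ->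
  (forall h, (0 <= F h <= 1)%R) ->
  iter m KS (fun u => (obs_avg F m u.2)%:E) u + obs_cesaro (fun h => 1 - F h)%R m u = 1.
Proof.
move=> m0 mF F01.
have F01' h : (0 <= 1 - F h <= 1)%R by have /andP[? ?] := F01 h; lra.
have mF' : measurable_fun setT (fun h => 1 - F h)%R by exact: measurable_funB.
have avg0 G h : (forall h, (0 <= G h <= 1)%R) -> (0 <= obs_avg G m h)%R.
  by move=> G01; rewrite divr_ge0//; apply: sumr_ge0 => k _; have /andP[] := G01 (dropp k h).
rewrite -iter_kerS_obs_avg// -iter_kerSD//.
- rewrite -[RHS](iter_kerS_cst m u lee01); congr (iter m KS _ u).
  by apply/funext => v; rewrite obs_avgC// -EFinD addrC subrK.
- by apply/measurable_EFinP; exact: (measurableT_comp (measurable_obs_avg _ mF) measurable_snd).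
- by apply/measurable_EFinP; exact: (measurableT_comp (measurable_obs_avg _ mF') measurable_snd).
- by move=> v; rewrite lee_fin avg0.
- by move=> v; rewrite lee_fin avg0.
Qed.

Variables (P : probability (paths int (X * Y)%type) R) (pi : probability Z R).
Hypothesis Ppi : forall k A, measurable A -> P (@stateZ _ _ X Y s k @^-1` A) = pi A.
Hypothesis PM : markov mu nu q g P.
Hypothesis pi_unique : unique_invariant K pi.
Hypothesis Hharris : harris_recurrent K.

(** After [n + 1] steps [F] becomes a function [HE] of the small chain, to which the Harris bound
    applies. The sums of [HE] are those of [F] with the window moved by [n], which changes them by
    at most [n]. *)
Lemma harris_obs_cesaro n (F : paths nat Y -> R) : measurable_fun setT F ->
  (forall h, (0 <= F h <= 1)%R) -> depends_on n F ->
  exists2 r : nat -> nat, forall j, (j < r j)%N &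
    forall u, (obs_mean P F)%:E <= limn_einf (fun j => obs_cesaro F (r j) u).
Proof.
move=> mF F01 Fn.
have mF2 : measurable_fun setT (fun u : S => (F u.2)%:E).
  by apply/measurable_EFinP; exact: (measurableT_comp mF measurable_snd).
have F2 (u : S) : 0 <= (F u.2)%:E <= 1 by rewrite !lee_fin.
have F20 (u : S) : 0 <= (F u.2)%:E by have /andP[] := F2 u.
have Fn1 : depends_on n.+1 (EFin \o F) by move=> h h' hh; congr (_%:E); apply: Fn => j jn; apply: hh; exact: ltnW.
pose HE (z : Z) := iter n.+1 KS (fun u => (F u.2)%:E) (z.1, ext z.2).
have HE01 z : 0 <= HE z <= 1 by exact: iter_kerS01.
have Hfin z : HE z \is a fin_num.
  by have /andP[h0 h1] := HE01 z; rewrite ge0_fin_numE// (le_lt_trans h1)// ltry.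
pose H z := fine (HE z).
have HEE : EFin \o H = HE by apply/funext => z; rewrite /= fineK.
have mHE : measurable_fun setT HE.
  apply: (measurableT_comp (iter_kerS_ge0 mF2 n.+1 F20).1
    (g := fun z : Z => (z.1, ext z.2 : paths nat Y))).
  apply: measurable_fun_pair; first exact: measurable_fst.
  exact: (measurableT_comp (measurable_ext (s := s)) (measurable_snd (T1 := X))).
have mH : measurable_fun setT H by exact: measurableT_comp.
have H01 z : (0 <= H z <= 1)%R by rewrite -!lee_fin fineK.
have factor k u : iter (k + n.+1) KS (fun u => (F u.2)%:E) u = iter k K HE (lagS u).
  exact: (iter_kerS_factor (F := EFin \o F)).
have meanE : fine (\int[pi]_z (H z)%:E) = obs_mean P F.
  congr fine; transitivity (\int[pi]_z HE z).
    by apply: eq_integral => z _; rewrite fineK.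
  rewrite -(ge0_integral_law (measurable_stateZ 0%R) (Ppi 0%R) mHE); last first.
    by move=> z; have /andP[] := HE01 z.
  rewrite -(stationary_iter qgP Ppi PM n.+1 mF2 F20).
  by apply: eq_integral => e _; have := factor 0%N (stateS 0%R e); rewrite add0n => ->.
have := cesaro_L1 qgP Ppi PM pi_unique mH H01; rewrite meanE HEE => L1.
have mean0 : (0 <= obs_mean P F)%R.
  by apply: fine_ge0; apply: integral_ge0 => e _; rewrite lee_fin; have /andP[] := F01 (past_obs e 0%R).
have [r rj rH] := harris_cesaro qgP pi_unique.1 Hharris mHE HE01 mean0 L1.
exists r => // u; apply/lee_addgt0Pr => e e0; rewrite addeC -limn_einf_shift//.
apply: (le_trans (rH (lagS u))); apply: le_limn_einf_near.
(* Once [r j] exceeds [n / e], moving the window costs at most [e] after division by [r j]. *)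
have [N Nn] : exists N : nat, (n%:R / e < N%:R)%R.
  by exists (Num.truncn (n%:R / e)).+1; exact: Num.Theory.truncnS_gt.
exists N => // j /= Nj.
have rj0 : (0 < (r j)%:R :> R)%R by rewrite ltr0n (leq_ltn_trans _ (rj j)).
pose a i := fine (iter i KS (fun u => (F u.2)%:E) u).
have aE i : iter i KS (fun u => (F u.2)%:E) u = (a i)%:E.
  rewrite fineK//; have /andP[i0 i1] := iter_kerS01 i u mF2 F2.
  by rewrite ge0_fin_numE// (le_lt_trans i1)// ltry.
have a01 i : (0 <= a i <= 1)%R by rewrite -!lee_fin -aE; exact: iter_kerS01.
rewrite /cesaro /obs_cesaro.
under eq_bigr do rewrite -factor aE.
under [X in _ <= _ + _ * X]eq_bigr do rewrite aE.
rewrite !sumEFin -!EFinM -EFinD lee_fin.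
rewrite -(ler_pM2l rj0) mulrDr !mulVKf ?gt_eqF//.
apply: (le_trans (sum_shift_le _ _ a01)); rewrite addrC lerD2r.
move: Nn; rewrite ltr_pdivrMr// => /ltW /le_trans; apply.
by rewrite ler_pM2r// ler_nat (leq_trans Nj)// ltnW.
Qed.

Lemma obs_mean_dropp (f : paths nat Y -> R) k : measurable_fun setT f ->
  (forall h, 0 <= f h)%R ->
  \int[P]_e (f (dropp k (past_obs e 0%R)))%:E = \int[P]_e (f (past_obs e 0%R))%:E.
Proof.
move=> mf f0.
have mf2 : measurable_fun setT (fun u : S => (f u.2)%:E).
  by apply/measurable_EFinP; exact: (measurableT_comp mf measurable_snd).
rewrite -(stationary_ge0 qgP Ppi PM (- k%:Z) mf2); last by move=> u; rewrite lee_fin.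
apply: eq_integral => e _; congr (f _)%:E; apply/funext => j.
by rewrite /stateS/= /past_obs /dropp; congr (e _).2; lia.
Qed.

Lemma integral_obs_avg (f : paths nat Y -> R) m : (0 < m)%N -> measurable_fun setT f ->
  (forall h, 0 <= f h <= 1)%R ->
  \int[P]_e (obs_avg f m (past_obs e 0%R))%:E = \int[P]_e (f (past_obs e 0%R))%:E.
Proof.
move=> m0 mf f01; have f0 h : (0 <= f h)%R by have /andP[] := f01 h.
have mfk k : measurable_fun setT (fun e : E => (f (dropp k (past_obs e 0%R)))%:E).
  apply/measurable_EFinP; apply: (measurableT_comp mf).
  exact: (measurableT_comp (measurable_dropp k) (measurable_past_obsE 0%R)).
transitivity (\int[P]_e ((m%:R^-1)%:E * \sum_(k < m) (f (dropp k (past_obs e 0%R)))%:E)).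
  by apply: eq_integral => e _; rewrite /obs_avg mulrC EFinM sumEFin.
rewrite ge0_integralZl//; last 2 first.
- exact: emeasurable_sum.
- by move=> e _; apply: sume_ge0 => k _; rewrite lee_fin.
rewrite ge0_integral_sum//; last by move=> k e _; rewrite lee_fin.
under eq_bigr do rewrite obs_mean_dropp//.
have yfin : \int[P]_e (f (past_obs e 0%R))%:E \is a fin_num.
  apply: integrable_fin_num => //; apply: (@bounded_integrable _ _ _ _ _ 1%R).
    exact: measurable_obs.
  by move=> e; have /andP[? ?] := f01 (past_obs e 0%R); rewrite ger0_norm.
rewrite -(fineK yfin) sumEFin sumr_const card_ord -EFinM mulrnAr -mulrnAl -[(m%:R^-1 *+ m)%R]mulr_natr mulVf ?mul1r//.
by rewrite pnatr_eq0 -lt0n.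
Qed.

End observation_chain.

(** * Identifiability *)

Section identifiability.
Context {R : realType} {dX dY : measure_display}.
Context {X : measurableType dX} {Y : measurableType dY} {s : nat}.
Variables (mu : probability X R) (nu : {sigma_finite_measure set Y -> \bar R}).
Variables (q q' : X -> X -> R) (g g' : s.+1.-tuple Y -> X -> Y -> R).
Hypothesis qgP : ar_density mu nu q g.
Hypothesis qgP' : ar_density mu nu q' g'.

Local Notation Z := (X * s.+1.-tuple Y)%type.
Local Notation S := (X * paths nat Y)%type.
Local Notation E := (paths int (X * Y)%type).
Local Notation stZ := (@stateZ _ _ X Y s).

Variables (P P' : probability E R) (pi pi' : probability Z R).
Hypothesis Ppi : forall k A, measurable A -> P (stZ k @^-1` A) = pi A.
Hypothesis Ppi' : forall k A, measurable A -> P' (stZ k @^-1` A) = pi' A.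
Hypothesis PM : markov mu nu q g P.
Hypothesis PM' : markov mu nu q' g' P'.
Hypothesis pi_unique' : unique_invariant (kerZ mu nu q' g') pi'.
Hypothesis Hharris' : harris_recurrent (kerZ mu nu q' g').

Variables (x0 : X) (kp c : R).
Hypothesis kp0 : (0 < kp)%R.
Hypothesis kappaP : forall n x h, beta mu q g n x h <= kp%:E * beta mu q g n x0 h.
Hypothesis beta_gt0 : forall n h, 0 < beta mu q g n x0 h.
Hypothesis beta_gt0' : forall n h, 0 < beta mu q' g' n x0 h.
Hypothesis beta_fin : forall n x h, beta mu q g n x h \is a fin_num.
Hypothesis beta_fin' : forall n x h, beta mu q' g' n x h \is a fin_num.

(** Its mean under [P] is a relative entropy, up to the error of starting both hidden chains at the
    fixed [x0]. *)
Definition log_ratio (n : nat) (h : paths nat Y) : R :=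
  (ln (fine (beta mu q g n x0 h)) - ln (fine (beta mu q' g' n x0 h)))%R.

Hypothesis int_log_ratio : forall n,
  P.-integrable setT (fun e => (log_ratio n (past_obs e 0%R))%:E) /\
  \int[P]_e (log_ratio n (past_obs e 0%R))%:E <= c%:E.

Lemma measurable_log_ratio n : measurable_fun setT (log_ratio n).
Proof.
have ml q1 g1 : ar_density mu nu q1 g1 ->
    measurable_fun [set: paths nat Y] (fun h => ln (fine (beta mu q1 g1 n x0 h))).
  move=> d1; apply: (measurableT_comp (@measurable_ln R)).
  by apply: measurableT_comp => //; exact: (measurable_beta_path d1).
by apply: measurable_funB; exact: ml.
Qed.

Lemma beta_log_ratio n h :
  beta mu q g n x0 h * (expR (- log_ratio n h))%:E = beta mu q' g' n x0 h.
Proof.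
have b0 : (0 < fine (beta mu q g n x0 h))%R by rewrite fine_gt0// beta_gt0/= ltey_eq beta_fin.
have b0' : (0 < fine (beta mu q' g' n x0 h))%R by rewrite fine_gt0// beta_gt0'/= ltey_eq beta_fin'.
rewrite /log_ratio opprB expRB !lnK ?posrE//.
rewrite -[X in X * _]fineK// -EFinM mulrC divfK ?gt_eqF// fineK//.
Qed.

(** Run the stationary chain [n] steps from time 0. The density of the new observations is at most
    [kp] times the one from [x0], and [exp (- log_ratio)] exchanges the latter for the density of
    the other model. On the right, that model therefore starts from [x0] and a past distributed
    under [P], not under [P']. *)
Lemma change_of_measure n (G : paths nat Y -> R) : measurable_fun setT G ->
  (forall h, 0 <= G h)%R ->
  \int[P]_e (G (past_obs e 0%R) * expR (- log_ratio n (past_obs e 0%R)))%:E <=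
  kp%:E * \int[P]_e iter n (kerS mu nu q' g') (fun u => (G u.2)%:E) (x0, past_obs e 0%R).
Proof.
move=> mG G0.
pose F (h : paths nat Y) := (G h * expR (- log_ratio n h))%:E.
have F0 h : 0 <= F h by rewrite lee_fin mulr_ge0// expR_ge0.
have mF : measurable_fun setT F.
  apply/measurable_EFinP; apply: measurable_funM => //; apply: measurableT_comp => //.
  by apply: measurableT_comp => //; exact: measurable_log_ratio.
have mF2 : measurable_fun setT (fun u : S => F u.2) by exact: (measurableT_comp mF measurable_snd).
have mEG : measurable_fun setT (EFin \o G) by exact/measurable_EFinP.
have mG2 : measurable_fun setT (fun u : S => (G u.2)%:E) by exact: (measurableT_comp mEG measurable_snd).
have G20 (u : S) : 0 <= (G u.2)%:E by rewrite lee_fin.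
have [mK K0] := iter_kerS_ge0 qgP' mG2 n G20.
rewrite -(stationary_iter qgP Ppi PM n mF2 (fun u => F0 _)).
have mK0 : measurable_fun setT (fun e : E => iter n (kerS mu nu q' g') (fun u => (G u.2)%:E) (x0, past_obs e 0%R)).
  apply: (measurableT_comp mK (g := fun e : E => (x0, past_obs e 0%R))).
  by apply: measurable_fun_pair => //; exact: measurable_past_obsE.
rewrite -ge0_integralZl//; last exact: ltW.
apply: ge0_le_integral => //.
- by move=> e _; exact: (iter_kerS_ge0 qgP mF2 n (fun u => F0 _)).2.
- apply: (measurableT_comp (iter_kerS_ge0 qgP mF2 n (fun u => F0 _)).1).
  exact: measurable_stateS.
- exact: measurable_funeM.
move=> e _; rewrite /stateS.
rewrite (iter_kerS_beta qgP)//.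
have /= -> := iter_kerS_beta qgP' n x0 (past_obs e 0%R) mEG (fun v => G20 (x0, v)).
have mB q1 g1 x (F1 : paths nat Y -> \bar R) : ar_density mu nu q1 g1 -> measurable_fun setT F1 ->
    measurable_fun setT (fun v : paths nat Y => beta mu q1 g1 n x v * F1 v).
  by move=> d1 mF1; apply: emeasurable_funM => //; exact: (measurable_beta_path d1).
have B0 q1 g1 x (F1 : paths nat Y -> \bar R) v : ar_density mu nu q1 g1 -> (forall v, 0 <= F1 v) ->
    0 <= beta mu q1 g1 n x v * F1 v.
  by move=> d1 F10; rewrite mule_ge0// (beta_ge0 d1).
rewrite -iter_int_obsZ//; last 3 first.
- exact: ltW.
- exact: mB.
- by move=> v; exact: (B0 _ q' g' x0 (EFin \o G) v qgP' (fun w => G20 (x0, w))).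
apply: le_iter_int_obs; first exact: mB.
- by apply: measurable_funeM; exact: mB.
- by move=> v; exact: B0.
move=> v; apply: (@le_trans _ _ ((kp%:E * beta mu q g n x0 v) * F v)).
  exact: lee_wpmul2r.
by rewrite -muleA -beta_log_ratio -[in leRHS]muleA -EFinM mulrC.
Qed.

(* [- log_ratio <= exp (- log_ratio) - M 1{log_ratio > M}], so that
   [M P(log_ratio > M)] is at most [c + kp]; on the complement the density ratio
   is at least [exp (- M)]. *)
Lemma obs_mean_transfer n (f : paths nat Y -> R) (M : R) : measurable_fun setT f ->
  (forall h, 0 <= f h <= 1)%R -> depends_on n f -> (0 < M)%R ->
  (M * obs_mean P f <= c + kp + M * expR M * kp * obs_mean P' f)%R.
Proof.
move=> mf f01 fn M0.
have f0 h : (0 <= f h)%R by have /andP[] := f01 h.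
(* The Harris bound is a lower bound; for [1 - f] it controls the averages of [f] from above. *)
pose F h := (1 - f h)%R.
have mF : measurable_fun setT F by exact: measurable_funB.
have F01 h : (0 <= F h <= 1)%R by rewrite /F; have /andP[? ?] := f01 h; lra.
have Fn : depends_on n F by move=> h h' hh; rewrite /F (fn _ _ hh).
have [r rj rF] := harris_obs_cesaro qgP' Ppi' PM' pi_unique' Hharris' mF F01 Fn.
have If (Q : probability E R) (f1 : paths nat Y -> R) : measurable_fun setT f1 -> (forall h, 0 <= f1 h <= 1)%R ->
    Q.-integrable setT (fun e : E => (f1 (past_obs e 0%R))%:E).
  move=> mf1 f11; apply: (@bounded_integrable _ _ _ _ _ 1%R); first exact: measurable_obs.
  by move=> e; have /andP[? ?] := f11 (past_obs e 0%R); rewrite ger0_norm.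
have meanC : obs_mean P' F = (1 - obs_mean P' f)%R.
  apply: EFin_inj; rewrite EFinB !obs_meanE// /F.
  under eq_integral do rewrite EFinB.
  rewrite integralB_EFin//; last 2 first.
  - exact: finite_measure_integrable_cst.
  - exact: If.
  by congr (_ - _); rewrite integral_cst// mul1e; exact: probability_setT.
(* The bound on the mean of [I j] that [key] below amounts to, since the means of [J] and [I j] add
   up to 1. *)
pose t := (1 - (M * obs_mean P f - c - kp) / (M * expR M * kp))%R.
have D0 : (0 < M * expR M * kp)%R by rewrite !mulr_gt0// expR_gt0.
pose I j (e : E) := obs_cesaro mu nu q' g' F (r j) (x0, past_obs e 0%R).
have mI j : measurable_fun setT (I j).
  apply: (measurableT_comp (measurable_obs_cesaro qgP' mF F01 (r j))
    (g := fun e : E => (x0, past_obs e 0%R))).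
  by apply: measurable_fun_pair => //; exact: measurable_past_obsE.
have I0 j e : 0 <= I j e by exact: obs_cesaro_ge0.
have It j : \int[P]_e I j e <= t%:E.
  pose m := r j; have m0 : (0 < m)%N by exact: leq_ltn_trans (rj j).
  pose A := obs_avg f m.
  have A01 h : (0 <= A h <= 1)%R by exact: obs_avg01.
  have A0 h : (0 <= A h)%R by have /andP[] := A01 h.
  have mA : measurable_fun setT A by exact: measurable_obs_avg.
  have mA2 : measurable_fun setT (fun u : S => (A u.2)%:E).
    by apply/measurable_EFinP; exact: (measurableT_comp mA measurable_snd).
  pose J (e : E) := iter m (kerS mu nu q' g') (fun u => (A u.2)%:E) (x0, past_obs e 0%R).
  have J0 e : 0 <= J e by apply: (iter_kerS_ge0 qgP' mA2 m _).2 => u; rewrite lee_fin.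
  have mJ : measurable_fun setT J.
    have A20 (u : S) : 0 <= (A u.2)%:E by rewrite lee_fin.
    apply: (measurableT_comp (iter_kerS_ge0 qgP' mA2 m A20).1
      (g := fun e : E => (x0, past_obs e 0%R))).
    by apply: measurable_fun_pair => //; exact: measurable_past_obsE.
  have JI : \int[P]_e J e + \int[P]_e I j e = 1.
    rewrite -ge0_integralD//.
    under eq_integral do rewrite (iter_kerS_obs_avgC qgP' _ m0 mf f01).
    by rewrite integral_cst// mul1e; exact: probability_setT.
  have Jfin : \int[P]_e J e \is a fin_num.
    rewrite ge0_fin_numE; last exact: integral_ge0.
    apply: (@le_lt_trans _ _ 1); last exact: ltry.
    by rewrite -JI leeDl// integral_ge0.
  have Ifin : \int[P]_e I j e \is a fin_num.
    rewrite ge0_fin_numE; last exact: integral_ge0.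
    apply: (@le_lt_trans _ _ 1); last exact: ltry.
    by rewrite -JI leeDr// integral_ge0.
  pose V (e : E) := log_ratio m (past_obs e 0%R).
  have mV : measurable_fun setT V.
    exact: (measurableT_comp (measurable_log_ratio m) (measurable_past_obsE 0%R)).
  have mL : measurable_fun setT (fun e => expR (- V e))%R.
    by apply: measurableT_comp => //; exact: measurableT_comp.
  have L1 : \int[P]_e (expR (- V e))%:E <= kp%:E.
    have := change_of_measure m (measurable_cst (1%R : R)) (fun _ => ler01).
    under eq_integral do rewrite mul1r.
    move=> /le_trans; apply; rewrite [X in _ * X](_ : _ = 1) ?mule1//.
    rewrite -[RHS](probability_setT P) -[RHS]mul1e -integral_cst//.
    by apply: eq_integral => e _; exact: (iter_kerS_cst qgP' m _ lee01).
  have AL : \int[P]_e (A (past_obs e 0%R) * expR (- V e))%:E <= kp%:E * \int[P]_e J e.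
    exact: (change_of_measure m mA A0).
  have mAL : measurable_fun setT (fun e => A (past_obs e 0%R) * expR (- V e))%R.
    by apply: measurable_funM => //; exact: measurable_obs.
  have IL : P.-integrable setT (fun e => (expR (- V e))%:E).
    apply/integrableP; split; first exact/measurable_EFinP.
    under eq_integral do rewrite gee0_abs ?lee_fin ?expR_ge0//.
    by rewrite (le_lt_trans L1)// ltry.
  have IAL : P.-integrable setT (fun e => (A (past_obs e 0%R) * expR (- V e))%:E).
    apply: (le_integrable measurableT _ _ IL); first exact/measurable_EFinP.
    move=> e _; rewrite gee0_abs; last by rewrite lee_fin mulr_ge0// expR_ge0.
    rewrite gee0_abs; last by rewrite lee_fin expR_ge0.
    by rewrite lee_fin ler_piMl ?expR_ge0//; have /andP[] := A01 (past_obs e 0%R).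
  have [IV Vc] := int_log_ratio m.
  have key : (M * obs_mean P f)%:E <=
      c%:E + kp%:E + (M * expR M)%:E * (kp%:E * \int[P]_e J e).
    rewrite EFinM (obs_meanE P)//.
    rewrite -(integral_obs_avg qgP Ppi PM m0 mf f01) -/A.
    have -> : M%:E * \int[P]_e (A (past_obs e 0))%:E = \int[P]_e (M%:E * (A (past_obs e 0))%:E).
      by rewrite integralZl//; exact: If.
    (* Pointwise: if [V <= M] the last term is at least [M * a] and the others have a nonnegative
       sum; if [V > M] the first term is at least [M * a] and the others are nonnegative. *)
    apply: (@le_trans _ _ (\int[P]_e ((V e)%:E + (expR (- V e))%:E +
        (M * expR M)%:E * (A (past_obs e 0%R) * expR (- V e))%:E))).
      apply: le_integral => //.
      - by apply: integrableZl => //; exact: If.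
      - exact: (integrableD measurableT (integrableD measurableT IV IL) (integrableZl measurableT _ IAL)).
      move=> e _; rewrite -!EFinM -!EFinD lee_fin.
      have /andP[a0 a1] := A01 (past_obs e 0%R); set a := A _ in a0 a1 *.
      have e0 := expR_ge0 (- V e).
      have [VM|MV] := leP (V e) M.
        have h1 : (0 <= V e + expR (- V e))%R by have := expR_ge1Dx (- V e); lra.
        have h2 : (1 <= expR M * expR (- V e))%R by rewrite -expRD -expR0 ler_expR; lra.
        have : (M * a <= M * a * (expR M * expR (- V e)))%R by rewrite ler_peMr// mulr_ge0// ltW.
        have -> : (M * expR M * (a * expR (- V e)) = M * a * (expR M * expR (- V e)))%R by ring.
        lra.
      have h1 : (M * a <= M)%R by rewrite ler_piMr// ltW.
      have h2 : (0 <= M * expR M * (a * expR (- V e)))%R.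
        by rewrite mulr_ge0// mulr_ge0// ?expR_ge0// ltW.
      lra.
    rewrite integralD//; last 2 first.
    - exact: integrableD.
    - exact: integrableZl.
    rewrite integralD//; apply: leeD; first exact: leeD.
    rewrite integralZl//; apply: lee_wpmul2l => //.
    by rewrite lee_fin mulr_ge0 ?expR_ge0// ltW.
  move: key JI; rewrite -(fineK Jfin) -(fineK Ifin) -!EFinM -!EFinD lee_fin lee_fin.
  move=> key [JI]; rewrite /t lerBrDr -lerBrDl ler_pdivrMr//.
  have -> : (1 - fine (\int[P]_e I j e) = fine (\int[P]_e J e))%R by rewrite -JI addrK.
  lra.
(* The lower bound valid from every start is used at [x0] and the past under [P], then integrated
   with Fatou's lemma. *)
have mean_t : (obs_mean P' F <= t)%R.
  rewrite -lee_fin; apply: (@le_trans _ _ (\int[P]_e limn_einf (fun j => I j e))).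
    rewrite -[leLHS]mule1 -(probability_setT P) -integral_cst//.
    apply: ge0_le_integral => //.
    - move=> e _; rewrite lee_fin; apply: fine_ge0; apply: integral_ge0 => e' _.
      by rewrite lee_fin; have /andP[] := F01 (past_obs e' 0%R).
    - exact: measurable_limn_einf.
    - by move=> e _; exact: rF.
  apply: (le_trans (fatou _ measurableT mI _)) => //.
  rewrite -(cvg_limn_einf_sup (cvg_cst t%:E)).1.
  by apply: le_limn_einf_near; apply: nearW.
move: mean_t; rewrite meanC /t lerD2l lerN2 ler_pdivrMr//.
lra.
Qed.

End identifiability.

Section law_identification.
Context {R : realType} {dX dY : measure_display}.
Context {X : measurableType dX} {Y : measurableType dY} {s : nat}.
Variables (mu : probability X R) (nu : {sigma_finite_measure set Y -> \bar R}).
Variables (q q' : X -> X -> R) (g g' : s.+1.-tuple Y -> X -> Y -> R).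
Hypothesis qgP : ar_density mu nu q g.
Hypothesis qgP' : ar_density mu nu q' g'.

Local Notation Z := (X * s.+1.-tuple Y)%type.
Local Notation E := (paths int (X * Y)%type).
Local Notation stZ := (@stateZ _ _ X Y s).

Variables (P P' : probability E R) (pi pi' : probability Z R).
Hypothesis Ppi : forall k A, measurable A -> P (stZ k @^-1` A) = pi A.
Hypothesis Ppi' : forall k A, measurable A -> P' (stZ k @^-1` A) = pi' A.
Hypothesis PM : markov mu nu q g P.
Hypothesis PM' : markov mu nu q' g' P'.
Hypothesis pi_unique' : unique_invariant (kerZ mu nu q' g') pi'.

Variables (C : R) (D : R -> R).
Hypothesis C0 : (0 <= C)%R.
Hypothesis transfer : forall n (f : paths nat Y -> R) (M : R), measurable_fun setT f ->
  (forall h, 0 <= f h <= 1)%R -> depends_on n f -> (0 < M)%R ->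
  (M * obs_mean P f <= C + D M * obs_mean P' f)%R.

Lemma obs_avg_depends n (f : paths nat Y -> R) m : depends_on n f ->
  depends_on (m + n) (obs_avg f m).
Proof.
move=> fn h h' hh; congr (_ / _)%R; apply: eq_bigr => k _; apply: fn => j jn.
by apply: hh; have := ltn_ord k; lia.
Qed.

(** The deviation [phi N] of an [N]-term average from [b'] is local, its [P']-mean tends to 0 by
    ergodicity, and its [P]-mean is at least [|b - b'|]. As [C] and [D] do not depend on [N], the
    limit gives [M * |b - b'| <= C] for every [M > 0]. *)
Lemma obs_mean_eq n (f : paths nat Y -> R) : measurable_fun setT f ->
  (forall h, 0 <= f h <= 1)%R -> depends_on n f -> obs_mean P f = obs_mean P' f.
Proof.
move=> mf f01 fn; set b := obs_mean P f; set b' := obs_mean P' f.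
have b01 : (0 <= b' <= 1)%R.
  rewrite -!lee_fin obs_meanE//; apply/andP; split.
    by apply: integral_ge0 => e _; rewrite lee_fin; have /andP[] := f01 (past_obs e 0%R).
  rewrite -[leRHS](probability_setT P') -[leRHS]mul1e -integral_cst//.
  apply: ge0_le_integral => //.
  - by move=> e _; rewrite lee_fin; have /andP[] := f01 (past_obs e 0%R).
  - by apply/measurable_EFinP; exact: measurable_obs.
  - by move=> e _; rewrite lee_fin; have /andP[] := f01 (past_obs e 0%R).
pose phi N (h : paths nat Y) := `|obs_avg f N h - b'|%R.
have mphi N : measurable_fun setT (phi N).
  by apply: measurableT_comp => //; apply: measurable_funB => //; exact: measurable_obs_avg.
have phi01 N h : (0 < N)%N -> (0 <= phi N h <= 1)%R.
  move=> N0; rewrite normr_ge0/= ler_norml.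
  by have /andP[? ?] := obs_avg01 h N0 f01; have /andP[? ?] := b01; lra.
have phin N : depends_on (N + n) (phi N).
  by move=> h h' hh; rewrite /phi (obs_avg_depends fn hh).
have low N : (0 < N)%N -> (`|b - b'| <= obs_mean P (phi N))%R.
  move=> N0; have IA : P.-integrable setT (fun e : E => (obs_avg f N (past_obs e 0%R))%:E).
    apply: (@bounded_integrable _ _ _ _ _ 1%R).
      by apply: measurable_obs; exact: measurable_obs_avg.
    by move=> e; have /andP[? ?] := obs_avg01 (past_obs e 0%R) N0 f01; rewrite ger0_norm.
  rewrite -lee_fin obs_meanE//; last by move=> h; exact: phi01.
  have -> : `|b - b'|%:E = `|\int[P]_e (obs_avg f N (past_obs e 0%R) - b')%:E|.
    under eq_integral do rewrite EFinB.
    rewrite integralB_EFin//; last exact: finite_measure_integrable_cst.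
    rewrite (integral_obs_avg qgP Ppi PM N0 mf f01) -obs_meanE// integral_cst//.
    have -> : b'%:E * P setT = b'%:E.
      by rewrite -[RHS]mule1; congr (_ * _); exact: probability_setT.
    by [].
  apply: le_abse_integral => //; apply/measurable_EFinP; apply: measurable_funB => //.
  by apply: measurable_obs; exact: measurable_obs_avg.
have lim0 : obs_mean P' (phi N) @[N --> \oo] --> (0 : R)%R.
  apply: (fine_cvg (f := fun N => \int[P']_e (phi N (past_obs e 0%R))%:E)).
  exact: (obs_avg_L1 qgP' Ppi' PM' pi_unique' mf f01).
have bnd M : (0 < M)%R -> (M * `|b - b'| <= C)%R.
  move=> M0; apply/ler_addgt0Pr => e e0.
  have d0 : (0 < e / (`|D M| + 1))%R by rewrite divr_gt0// ltr_wpDl.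
  have [N0 _ HN] := cvgr_lt 0%R lim0 _ d0.
  have /= := HN N0.+1 (leqnSn _) => small.
  apply: (@le_trans _ _ (M * obs_mean P (phi N0.+1))%R).
    by rewrite ler_pM2l// low.
  apply: (le_trans (transfer (mphi _) _ (phin N0.+1) M0)); first by move=> h; exact: phi01.
  rewrite lerD2l; apply: (@le_trans _ _ (`|D M| * obs_mean P' (phi N0.+1))%R).
    apply: ler_wpM2r; last exact: ler_norm.
    by apply: fine_ge0; apply: integral_ge0 => e' _; rewrite lee_fin normr_ge0.
  apply: (@le_trans _ _ (`|D M| * (e / (`|D M| + 1)))%R).
    by apply: ler_wpM2l => //; exact: ltW.
  rewrite mulrA ler_pdivrMr ?ltr_wpDl//.
  by rewrite mulrC ler_pM2l// lerDl.
apply/eqP; rewrite -subr_eq0 -normr_eq0; apply/eqP/le_anti; rewrite normr_ge0 andbT.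
rewrite leNgt; apply/negP => d0.
(* For this [M] the bound would read [C + 1 <= C]. *)
have M0 : (0 < (C + 1) / `|b - b'|)%R by rewrite divr_gt0// ltr_wpDl.
by have := bnd _ M0; rewrite divfK ?gt_eqF// gerDl ler10.
Qed.

(** A cylinder over the times from [-N] to [N] is an event of the [2 N + 1] most recent observations
    at time [N], so local functions determine the law. *)
Lemma obs_law_eq A : measurable (A : set (paths int Y)) ->
  P ((fun e : E => (fun k => (e k).2) : paths int Y) @^-1` A) =
  P' ((fun e : E => (fun k => (e k).2) : paths int Y) @^-1` A).
Proof.
move=> mA; pose V (e : E) : paths int Y := fun k => (e k).2.
have mV : measurable_fun setT V.
  by apply: measurable_to_paths => k; exact: (measurableT_comp measurable_snd (measurable_coord k)).
have [m mE] := exists_pushforward P mV; have [m' mE'] := exists_pushforward P' mV.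
rewrite -[LHS]mE -[RHS]mE'; apply: paths_measure_unique mA.
  by rewrite mE preimage_setT; apply: (le_lt_trans (probability_le1 P measurableT)); rewrite ltry.
move=> B N mB BT; rewrite mE mE'.
pose W : set (paths nat Y) := [set h | forall j, (j < (N + N).+1)%N -> B (N%:Z - j%:Z)%R (h j)].
have mW : measurable W.
  rewrite (_ : W = \bigcap_(j in `I_(N + N).+1) (fun h : paths nat Y => h j) @^-1` B (N%:Z - j%:Z)%R).
    apply: bigcap_measurableType => j _.
    by rewrite -[X in measurable X]setTI; exact: measurable_coord.
  by apply/seteqP; split => h H j; [exact: H|exact: (H j)].
have VW : V @^-1` [set e | forall i, B i (e i)] = (fun e : E => past_obs e N%:Z) @^-1` W.
  apply/seteqP; split => e H /=; first by move=> j _; exact: H.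
  move=> i; have [iN|iN] := leqP `|i|%N N; last by rewrite BT.
  have jN : (absz (N%:Z - i)%R < (N + N).+1)%N by lia.
  have := H _ jN; rewrite /past_obs /V.
  by have -> : (N%:Z - (absz (N%:Z - i)%R)%:Z = i)%R by lia.
have mI : measurable_fun setT (\1_W : paths nat Y -> R) by exact: measurable_indic.
have lawW (Q : probability E R) q1 (g1 : s.+1.-tuple Y -> X -> Y -> R) (pi1 : probability Z R) : ar_density mu nu q1 g1 ->
    (forall k A, measurable A -> Q (stZ k @^-1` A) = pi1 A) -> markov mu nu q1 g1 Q ->
    Q ((fun e : E => past_obs e N%:Z) @^-1` W) = (obs_mean Q \1_W)%:E.
  move=> d1 Qpi QM; rewrite obs_meanE//; last first.
    by move=> h; rewrite indicE; case: (_ \in _); rewrite ?ler01 ?lexx.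
  have mI2 : measurable_fun setT (fun u : X * paths nat Y => (\1_W u.2)%:E : \bar R).
    by apply/measurable_EFinP; exact: (measurableT_comp mI measurable_snd).
  have I0 (u : X * paths nat Y) : 0 <= (\1_W u.2)%:E :> \bar R by rewrite lee_fin.
  have /= <- := stationary_ge0 d1 Qpi QM N%:Z mI2 I0.
  have mQ : measurable ((fun e : E => past_obs e N%:Z) @^-1` W).
    by rewrite -[X in measurable X]setTI; exact: measurable_past_obsE.
  rewrite -[in LHS](setIT (_ @^-1` _)) -integral_indic//.
rewrite VW; transitivity (obs_mean P \1_W)%:E; first exact: lawW qgP Ppi PM.
transitivity (obs_mean P' \1_W)%:E; last by symmetry; exact: lawW qgP' Ppi' PM'.
congr (_%:E); apply: (@obs_mean_eq (N + N).+1) => //.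
  by move=> h; rewrite indicE; case: (_ \in _); rewrite ?ler01 ?lexx.
move=> h h' hh; rewrite !indicE; congr (_%:R); congr nat_of_bool.
apply/idP/idP => /set_mem H; apply/mem_set => j jN; have := H j jN; first by rewrite hh.
by rewrite -hh.
Qed.

End law_identification.

(** * Wald's method *)

(** Iterating the [m]-step inequality along one residue class would call for averages of [F] over
    multiples of [m]. Summed over a window of [m] consecutive times it involves every term of [F],
    and the one-step inequality compares the window with the value that follows it. [N] is chosen
    before [x], which makes the result uniform over a ball of parameters. *)
Lemma subadditive_eventually_neg {R : realType} (F G : nat -> R) (m : nat) (a b K : R) :
  (0 < m)%N -> (forall k, 0 <= G k)%R -> (a < 0)%R ->
  ((\sum_(k < n) F k) / n%:R)%R @[n --> \oo] --> a ->
  ((\sum_(k < n) G k) / n%:R)%R @[n --> \oo] --> b ->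
  exists N, forall x : nat -> R,
    (forall n, x (n + m)%N <= x n + F (n + m)%N)%R ->
    (forall n, x n.+1 <= x n + G n.+1)%R ->
    (\sum_(i < m) x i <= K)%R ->
    forall n, (N <= n)%N -> (x n < 0)%R.
Proof.
move=> m0 G0 a0 cF cG.
pose SF n := (\sum_(k < n) F k)%R; pose SG n := (\sum_(k < n) G k)%R.
have mR : (0 < m%:R :> R)%R by rewrite ltr0n.
(* Errors [e * N] occur once from [F] and [2 m] times from [G]; with this [e] they total [- a / 2]
   times [N]. *)
pose e := (- a / (2 * (1 + 2 * m%:R)))%R.
have e0 : (0 < e)%R by rewrite divr_gt0 ?oppr_gt0// mulr_gt0// addr_gt0// mulr_gt0.
have near_mean (S : nat -> R) (l : R) : (S n / n%:R)%R @[n --> \oo] --> l ->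
    exists N, forall n, (N <= n)%N -> (`|S n - l * n%:R| <= e * n%:R)%R.
  move=> /cvgrPdist_le /(_ _ e0) [N _ HN]; exists N.+1 => n Nn.
  have n0 : (0 < n%:R :> R)%R by rewrite ltr0n (leq_trans _ Nn).
  have := HN n (ltnW Nn); rewrite /= distrC -(ler_pM2r n0).
  by rewrite -[X in (_ * X <= _)%R](ger0_norm (ltW n0)) -normrM mulrBl divfK ?gt_eqF.
have [N1 HF] := near_mean SF a cF; have [N2 HG] := near_mean SG b cG.
(* The part of the final bound that does not grow with [N]. *)
pose C := (K - SF m + m%:R * (m%:R * b + 2 * e))%R.
pose N3 := (Num.truncn (2 * C / - a)).+1.
exists (N1 + N2 + N3 + m)%N => x xF xG xK N NN.
have SFS n : SF n.+1 = (SF n + F n)%R by rewrite /SF big_ord_recr.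
have SGS n : SG n.+1 = (SG n + G n)%R by rewrite /SG big_ord_recr.
have SGle n k : (SG n <= SG (n + k)%N)%R.
  by elim: k => [|k ih]; rewrite ?addn0// addnS SGS (le_trans ih)// lerDl.
(* Sliding the window by one adds [x (n + m)] and removes [x n], a change of at most [F (n + m)]. *)
have block n : (\sum_(i < m) x (n + i)%N <= \sum_(i < m) x i + (SF (n + m)%N - SF m))%R.
  elim: n => [|n ih]; first by rewrite add0n subrr addr0.
  have : (x n + \sum_(i < m) x (n.+1 + i)%N = \sum_(i < m) x (n + i)%N + x (n + m)%N)%R.
    transitivity (\sum_(i < m.+1) x (n + i)%N)%R; last by rewrite big_ord_recr.
    rewrite big_ord_recl/= addn0; congr (_ + _)%R.
    by apply: eq_bigr => i _; rewrite /bump/= add1n addSnnS.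
  by have := xF n; rewrite addSn SFS; lra.
have step n j : (x (n + j)%N <= x n + (SG (n + j).+1 - SG n.+1))%R.
  elim: j => [|j ih]; first by rewrite addn0 subrr addr0.
  by have := xG (n + j)%N; rewrite addnS (SGS (n + j).+1); lra.
pose n := (N - m)%N; have nN : (n + m = N)%N by rewrite subnK//; lia.
have last_le i : (i < m)%N -> (x N <= x (n + i)%N + (SG N.+1 - SG n.+1))%R.
  move=> im; have := step (n + i)%N (m - i)%N.
  have -> : (n + i + (m - i) = N)%N by lia.
  by have := SGle n.+1 i; rewrite addSn; lra.
have : (m%:R * x N <= \sum_(i < m) x (n + i)%N + m%:R * (SG N.+1 - SG n.+1))%R.
  have cst y : (m%:R * y = \sum_(i < m) y)%R by rewrite sumr_const card_ord mulr_natl.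
  rewrite !cst -big_split/=.
  by apply: ler_sum => i _; exact: last_le.
have := block n; rewrite nN.
have := HF N ltac:(lia); have := HG N.+1 ltac:(lia); have := HG n.+1 ltac:(lia).
rewrite !ler_norml => /andP[g1 _] /andP[_ g2] /andP[_ f2] b1 b2.
have N3N : (2 * C / - a < N%:R)%R.
  apply: (lt_le_trans (Num.Theory.truncnS_gt _)); rewrite ler_nat.
  by apply: leq_trans NN; rewrite -/N3; lia.
have NE : (N%:R = n%:R + m%:R :> R)%R by rewrite -nN natrD.
have CN : (2 * C < - a * N%:R)%R by move: N3N; rewrite ltr_pdivrMr ?oppr_gt0// [X in (_ < X)%R]mulrC.
have eE : (2 * (1 + 2 * m%:R) * e = - a)%R.
  by rewrite /e mulrC divfK// gt_eqF// mulr_gt0// addr_gt0// mulr_gt0.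
have G2 : (SG N.+1 - SG n.+1 <= b * m%:R + e * (2 * N%:R + 2))%R.
  have h1 : (n.+1%:R = N%:R - m%:R + 1 :> R)%R by rewrite -natr1 NE addrK.
  have h2 : (N.+1%:R = N%:R + 1 :> R)%R by rewrite -natr1.
  rewrite h1 in g1; rewrite h2 in g2.
  have em : (0 <= e * m%:R)%R by rewrite mulr_ge0// ltW.
  by move: g1 g2; rewrite !mulrDr !mulrN; lra.
have G3 : (m%:R * (SG N.+1 - SG n.+1) <= m%:R * (b * m%:R + e * (2 * N%:R + 2)))%R.
  by rewrite ler_pM2l.
have main : (m%:R * x N < 0)%R.
  have bd : (m%:R * x N <= C + (a + (1 + 2 * m%:R) * e) * N%:R)%R.
    have -> : (C + (a + (1 + 2 * m%:R) * e) * N%:R = K - SF m + (a * N%:R + e * N%:R) +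
        m%:R * (b * m%:R + e * (2 * N%:R + 2)))%R by rewrite /C; ring.
    by move: b1 b2 f2 G3 xK; lra.
  apply: (le_lt_trans bd).
  have -> : (a + (1 + 2 * m%:R) * e = a / 2)%R by move: eE; lra.
  by move: CN; lra.
by move: main; rewrite pmulr_rlt0.
Qed.

(** Finite nets of radius [1/(k+1)] are enumerated together over all [k]; [a] pads the finite
    lists. *)
Lemma compact_dense_seq {R : realType} {T : pseudoMetricType R} (A : set T) (a : T) :
  cover_compact A -> A a ->
  exists2 u : nat -> T, forall i, A (u i) &
    forall x e, A x -> (0 < e)%R -> exists i, ball x e (u i).
Proof.
move=> cA Aa.
have net k : {s : seq T | (forall y, y \in s -> A y) /\
    forall x, A x -> exists2 y, y \in s & ball y (k.+1%:R^-1) x}.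
  apply: cid; move: cA => /(_ T A (fun y => (ball y (k.+1%:R^-1 : R))°)).
  case=> [y _|x Ax|D DA AD]; first exact: open_interior.
    by exists x => //; rewrite /interior; apply: nbhsx_ballx; rewrite invr_gt0 ltr0n.
  exists (enum_fset D); split => [y /DA|x /AD [y yD xy]]; first by move/set_mem.
  by exists y => //; exact: interior_subset.
pose u i := let p := odflt (0, 0)%N (choice.unpickle i) in
  nth a (sval (net p.1)) p.2.
exists u => [i|x e Ax e0].
  rewrite /u; set p := odflt _ _.
  have [ps|ps] := ltnP p.2 (size (sval (net p.1))); last by rewrite nth_default.
  by apply: (svalP (net p.1)).1; exact: mem_nth.
pose k := Num.truncn (e^-1).
have [y ys yx] := (svalP (net k)).2 x Ax.
exists (choice.pickle (k, index y (sval (net k)))); rewrite /u choice.pickleK/= nth_index//.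
apply: ball_sym; apply: le_ball yx.
rewrite invf_ple ?posrE ?ltr0n//; apply: ltW; exact: Num.Theory.truncnS_gt.
Qed.

Section upper_envelope.
Context {R : realType} {M : pseudoMetricType R} {d : measure_display} {T : measurableType d}.
Variables (A : set M) (a : M) (D : M -> T -> R) (W : T -> R).
Hypothesis cA : cover_compact A.
Hypothesis Aa : A a.
Hypothesis mD : forall x, A x -> measurable_fun setT (D x).
Hypothesis DW : forall x t, A x -> (`|D x t| <= W t)%R.
Hypothesis Dcont : forall x (u : nat -> M) t, A x -> (forall i, A (u i)) ->
  u i @[i --> \oo] --> x -> D (u i) t @[i --> \oo] --> D x t.

(* The supremum over a ball around [a] is taken over a countable dense subset of
   [A], which keeps it measurable. *)
Lemma upper_envelope : exists V : nat -> T -> R,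
  [/\ forall j, measurable_fun setT (V j),
      forall j t, (`|V j t| <= W t)%R,
      forall t, V j t @[j --> \oo] --> D a t &
      forall j x t, A x -> ball a (j.+1%:R^-1 / 2) x -> (D x t <= V j t)%R].
Proof.
have [u Au ud] := compact_dense_seq cA Aa.
pose r j : R := (j.+1%:R^-1)%R.
have r0 j : (0 < r j)%R by rewrite invr_gt0 ltr0n.
(* Using [D a t] in the maximum and outside the ball makes the supremum dominate [D a] while every
   term keeps the bound [W]. *)
pose E j i t := if `[< ball a (r j) (u i) >] then Num.max (D a t) (D (u i) t) else D a t.
have EW j i t : (`|E j i t| <= W t)%R.
  rewrite /E; case: ifP => _; last exact: DW.
  by rewrite maxEle; case: ifP => _; exact: DW.
pose U j t := esups (fun i => (E j i t)%:E) 0%N.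
have EU j i t : (E j i t)%:E <= U j t by apply: ereal_sup_ubound; exists i.
have UB j t (B : R) : (forall i, (E j i t <= B)%R) -> U j t <= B%:E.
  by move=> H; apply: ge_ereal_sup => _ [i _ <-]; rewrite lee_fin.
have UW j t : U j t <= (W t)%:E by apply: UB => i; have := EW j i t; rewrite ler_norml => /andP[].
have WU j t : (- W t)%:E <= U j t.
  apply: le_trans (EU j 0%N t); rewrite lee_fin.
  by have := EW j 0%N t; rewrite ler_norml => /andP[].
have Ufin j t : U j t \is a fin_num.
  rewrite fin_numE; apply/andP; split.
    by apply/eqP => UE; have := WU j t; rewrite UE leeNy_eq.
  by apply/eqP => UE; have := UW j t; rewrite UE leye_eq.
pose V j t := fine (U j t).
have VE j t : (V j t)%:E = U j t by exact: fineK.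
have EV j i t : (E j i t <= V j t)%R by rewrite -lee_fin VE.
exists V; split.
- move=> j; apply: measurableT_comp => //; apply: measurable_fun_esups => i.
  apply/measurable_EFinP.
  have [b|b] := boolP `[< ball a (r j) (u i) >]; rewrite /E ?b ?(negbTE b); last exact: mD.
  by apply: measurable_maxr; exact: mD.
- by move=> j t; rewrite ler_norml -!lee_fin VE WU UW.
- move=> t; apply/cvgrPdist_le => e e0.
  have aV j : (D a t <= V j t)%R.
    apply: le_trans (EV j 0%N t); rewrite /E; case: ifP => // _.
    by rewrite le_max lexx.
  (* Otherwise points [u i] arbitrarily close to [a] would contradict continuity at [a]. *)
  have : exists J, forall j, (J <= j)%N -> forall i, ball a (r j) (u i) -> (D (u i) t <= D a t + e)%R.
    apply: contrapT => /forallNP H.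
    have {}H J : exists i, ball a (r J) (u i) /\ (D a t + e < D (u i) t)%R.
      apply: contrapT => /forallNP N; apply: (H J) => j Jj i bi.
      rewrite leNgt; apply/negP => lt; apply: (N i); split => //.
      apply: le_ball bi; rewrite /r lef_pV2 ?posrE ?ltr0n// ler_nat ltnS//.
    have [k Hk] := choice H.
    have kc : u (k J) @[J --> \oo] --> a.
      apply/cvg_ballP => eps eps0.
      exists (Num.truncn (eps^-1)) => // n /= nN.
      apply: le_ball (Hk n).1; rewrite invf_ple ?posrE ?ltr0n//.
      apply: ltW; apply: (lt_le_trans (Num.Theory.truncnS_gt _)).
      by rewrite ler_nat ltnS.
    have := @Dcont a (u \o k) t Aa (fun i => Au _) kc.
    move=> /cvgrPdist_lt /(_ e e0) [n _ Hn].
    have := Hn n (leqnn n); rewrite /= ltr_norml => /andP[h1 _].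
    by have := (Hk n).2; lra.
  case=> J HJ; exists J => // j /= Jj.
  rewrite distrC ger0_norm ?subr_ge0// lerBlDl -lee_fin VE; apply: UB => i.
  rewrite /E; case: ifP => [/asboolP bi|_]; last by rewrite lerDl ltW.
  by rewrite ge_max lerDl (ltW e0)/=; exact: HJ bi.
- move=> j x t Ax bx.
  (* With [x] within [r j / 2] of [a], these points stay in the ball of radius [r j], where they
     enter the supremum. *)
  have H k : exists i, ball x (Num.min (r k) (r j / 2))%R (u i).
    by apply: ud => //; rewrite lt_min r0 divr_gt0.
  have [k Hk] := choice H.
  have kc : u (k J) @[J --> \oo] --> x.
    apply/cvg_ballP => eps eps0.
    exists (Num.truncn (eps^-1)) => // n /= nN.
    apply: le_ball (Hk n); rewrite ge_min; apply/orP; left.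
    rewrite invf_ple ?posrE ?ltr0n//.
    apply: ltW; apply: (lt_le_trans (Num.Theory.truncnS_gt _)).
    by rewrite ler_nat ltnS.
  have c := @Dcont x (u \o k) t Ax (fun i => Au _) kc.
  rewrite leNgt; apply/negP => lt.
  have [n _ Hn] := cvgr_gt _ c _ lt.
  have := Hn n (leqnn n); rewrite /= ltNge => /negP; apply.
  apply: le_trans (EV j (k n) t); rewrite /E asboolT ?le_max ?lexx ?orbT//.
  apply: ball_split bx _; apply: le_ball (Hk n).
  by rewrite ge_min lexx orbT.
Qed.

End upper_envelope.

Section wald.
Context {R : realType} {dX dY : measure_display}.
Context {X : measurableType dX} {Y : measurableType dY} {s : nat}.
Variables (mu : probability X R) (nu : {sigma_finite_measure set Y -> \bar R}).
Variables (q : X -> X -> R) (g : s.+1.-tuple Y -> X -> Y -> R).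
Hypothesis qgP : ar_density mu nu q g.

Local Notation Z := (X * s.+1.-tuple Y)%type.
Local Notation E := (paths int (X * Y)%type).
Local Notation stZ := (@stateZ _ _ X Y s).

Variables (P : probability E R) (pi : probability Z R).
Hypothesis Ppi : forall k A, measurable A -> P (stZ k @^-1` A) = pi A.
Hypothesis PM : markov mu nu q g P.
Hypothesis pi_unique : unique_invariant (kerZ mu nu q g) pi.

Context {M : pseudoMetricType R}.
Variables (Theta : set M) (ts : M).
Hypothesis cTheta : cover_compact Theta.
Hypothesis ThetaS : Theta ts.

Variables (L : M -> nat -> paths nat Y -> R) (xi : paths nat Y -> R) (c : R).
Hypothesis mxi : measurable_fun setT xi.
Hypothesis xi0 : forall h, (0 <= xi h)%R.
Hypothesis Ixi : P.-integrable setT (fun e => (xi (past_obs e 0%R))%:E).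
Hypothesis c0 : (0 <= c)%R.
Hypothesis mL : forall x n, Theta x -> measurable_fun setT (L x n).
Hypothesis Lxi : forall x n h, Theta x -> (`|L x n h| <= \sum_(k < n) xi (dropp k h))%R.
Hypothesis Lsub : forall x n m h, Theta x -> (L x (n + m) h <= L x n (dropp m h) + L x m h + c)%R.
Hypothesis Lsuper : forall x n m h, Theta x -> (L x n (dropp m h) + L x m h - c <= L x (n + m) h)%R.
Hypothesis Lcont : forall x (u : nat -> M) n h, Theta x -> (forall i, Theta (u i)) ->
  u i @[i --> \oo] --> x -> L (u i) n h @[i --> \oo] --> L x n h.

Lemma integrable_xi_sum m : P.-integrable setT
  (fun e : E => (\sum_(k < m) xi (dropp k (past_obs e 0%R)))%:E).
Proof.
have -> : (fun e : E => (\sum_(k < m) xi (dropp k (past_obs e 0%R)))%:E) =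
    (fun e => \sum_(k <- index_enum 'I_m | true) (xi (dropp k (past_obs e 0%R)))%:E).
  by apply/funext => e; rewrite sumEFin.
apply: integrable_sum => // k _.
have := integrable_law (measurable_shiftE (- k%:Z))
  (fun A mA => shift_stationary qgP Ppi PM (- k%:Z) mA) Ixi.
congr (P.-integrable _ _); apply/funext => e; rewrite past_obs_shiftE.
by congr (xi _)%:E; apply/funext => j; rewrite /past_obs /dropp; congr (e _).2; lia.
Qed.

Lemma integrable_log_diff x m : Theta x ->
  P.-integrable setT (fun e : E => (L x m (past_obs e 0%R) - L ts m (past_obs e 0%R))%:E).
Proof.
move=> Tx; have I1 y : Theta y -> P.-integrable setT (fun e : E => (L y m (past_obs e 0%R))%:E).
  move=> Ty; apply: (le_integrable measurableT _ _ (integrable_xi_sum m)).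
    by apply/measurable_EFinP; apply: measurable_obs; exact: mL.
  move=> e _; rewrite [leRHS]gee0_abs; last by rewrite lee_fin; apply: sumr_ge0.
  by rewrite abse_EFin lee_fin; exact: Lxi.
have -> : (fun e : E => (L x m (past_obs e 0%R) - L ts m (past_obs e 0%R))%:E) =
  (fun e => (L x m (past_obs e 0%R))%:E - (L ts m (past_obs e 0%R))%:E).
  by apply/funext => e; rewrite EFinB.
by apply: integrableB => //; exact: I1.
Qed.

Lemma dropp_past_obs (e : E) k m : dropp m (past_obs e (k + m)%N%:Z) = past_obs e k%:Z.
Proof. by apply/funext => i; rewrite /dropp /past_obs; congr (e _).2; lia. Qed.

(** On a small ball the block differences lie below an envelope [V j] whose mean is still less than
    [- 2 c]. Adding [2 c], one [c] from [Lsub] at [y] and one from [Lsuper] at [ts], leaves an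
    increment of negative mean for the deterministic lemma. *)
Lemma wald_local x m : Theta x ->
  \int[P]_e (L x m (past_obs e 0%R) - L ts m (past_obs e 0%R))%:E < (- (2 * c))%:E ->
  exists2 delta : R, (0 < delta)%R &
    {ae P, forall e, exists N, forall n y, (N <= n)%N -> Theta y -> ball x delta y ->
      (L y n (past_obs e n%:Z) < L ts n (past_obs e n%:Z))%R}.
Proof.
move=> Tx Ex.
have aux1 (l1 l2 l3 l4 l5 l6 v : R) : (l5 - l6 <= v -> l3 + l6 - c <= l4 -> l1 <= l2 + l5 + c ->
    l1 - l4 <= l2 - l3 + (v + 2 * c))%R by lra.
have aux2 (l1 l2 l3 l4 l5 l6 z : R) : (`|l6| <= z -> `|l5| <= z -> l3 + l6 - c <= l4 ->
    l1 <= l2 + l5 + c -> l1 - l4 <= l2 - l3 + (2 * z + 2 * c))%R.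
  by rewrite !ler_norml => /andP[? ?] /andP[? ?]; lra.
have aux3 (l5 l6 z : R) : (`|l6| <= z -> `|l5| <= z -> l5 - l6 <= 2 * z)%R.
  by rewrite !ler_norml => /andP[? ?] /andP[? ?]; lra.
(* For [m = 0] the bound [Lxi] makes both log-likelihoods vanish, and their difference has mean
   0. *)
have m0 : (0 < m)%N.
  rewrite lt0n; apply/eqP => m0; move: Ex; rewrite m0.
  have L0 y h : Theta y -> L y 0%N h = 0%R.
    by move=> /(Lxi 0%N h); rewrite big_ord0 normr_le0 => /eqP.
  under eq_integral do rewrite !L0// subrr.
  by rewrite integral0 lte_fin ltNge oppr_le0 mulr_ge0.
pose D y h := (L y m h - L ts m h)%R.
pose W h := (2 * \sum_(k < m) xi (dropp k h))%R.
have [V [mV VW cV DV]] : exists V : nat -> paths nat Y -> R,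
  [/\ forall j, measurable_fun setT (V j),
      forall j t, (`|V j t| <= W t)%R,
      forall t, V j t @[j --> \oo] --> D x t &
      forall j y t, Theta y -> ball x (j.+1%:R^-1 / 2) y -> (D y t <= V j t)%R].
  apply: (upper_envelope cTheta Tx).
  - by move=> y Ty; apply: measurable_funB; exact: mL.
  - move=> y h Ty; rewrite /W mulr_natl mulr2n; apply: (le_trans (ler_normB _ _)).
    by apply: lerD; exact: Lxi.
  - move=> y u h Ty Tu uy; apply: cvgB; last exact: cvg_cst.
    exact: Lcont.
have IW : P.-integrable setT (fun e : E => (W (past_obs e 0%R))%:E).
  have := integrableZl measurableT 2%R (integrable_xi_sum m).
  by congr (P.-integrable _ _); apply/funext => e; rewrite EFinM.
have IV j : P.-integrable setT (fun e : E => (V j (past_obs e 0%R))%:E).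
  apply: (le_integrable measurableT _ _ IW).
    by apply/measurable_EFinP; exact: measurable_obs.
  by move=> e _; rewrite !abse_EFin lee_fin (le_trans (VW j _))// ler_norm.
have cI : \int[P]_e (V j (past_obs e 0%R))%:E @[j --> \oo] --> \int[P]_e (D x (past_obs e 0%R))%:E.
  apply: (dominated_cvg measurableT _ _ _ IW) => //.
  - by move=> j; apply/measurable_EFinP; exact: measurable_obs.
  - move=> e _; apply: cvg_EFin; first exact: nearW.
    exact: (cV (past_obs e 0%R)).
  - by move=> j e _; rewrite abse_EFin lee_fin; exact: VW.
have ID := integrable_log_diff m Tx.
have Dfin : \int[P]_e (D x (past_obs e 0%R))%:E \is a fin_num by exact: integrable_fin_num.
have Vfin j : \int[P]_e (V j (past_obs e 0%R))%:E \is a fin_num by exact: (integrable_fin_num measurableT (IV j)).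
have [j Vj] : exists j, (fine (\int[P]_e (V j (past_obs e 0%R))%:E) < - (2 * c))%R.
  move: cI; rewrite -(fineK Dfin) => /fine_cvg cI.
  have lt : (fine (\int[P]_e (D x (past_obs e 0%R))%:E) < - (2 * c))%R by rewrite -lte_fin fineK.
  have [n _ Hn] := cvgr_lt _ cI _ lt.
  by exists n; exact: (Hn n (leqnn n)).
exists (j.+1%:R^-1 / 2)%R; first by rewrite divr_gt0// invr_gt0 ltr0n.
pose f h := (V j h + 2 * c)%R.
(* A bound on how much one further observation can raise the difference. *)
pose G h := (2 * xi h + 2 * c)%R.
have Ic : P.-integrable setT (EFin \o cst (2 * c)%R) by exact: finite_measure_integrable_cst.
have If : P.-integrable setT (fun e : E => (f (past_obs e 0%R))%:E).
  have := integrableD measurableT (IV j) Ic.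
  by congr (P.-integrable _ _); apply/funext => e; rewrite /f EFinD.
have IG : P.-integrable setT (fun e : E => (G (past_obs e 0%R))%:E).
  have := integrableD measurableT (integrableZl measurableT 2%R Ixi)
    Ic.
  by congr (P.-integrable _ _); apply/funext => e; rewrite /G EFinD EFinM.
have mf : measurable_fun setT f by apply: measurable_funD.
have mG : measurable_fun setT G.
  by apply: measurable_funD => //; exact: measurable_funM.
have fneg : (fine (\int[P]_e (f (past_obs e 0%R))%:E) < 0)%R.
  have -> : \int[P]_e (f (past_obs e 0%R))%:E =
      \int[P]_e (V j (past_obs e 0%R))%:E + (2 * c)%:E.
    under eq_integral do rewrite EFinD.
    rewrite (integralD measurableT (IV j) Ic).
    congr (_ + _); transitivity ((2 * c)%:E * P setT); first exact: (integral_cst P measurableT (2 * c)%:E).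
    rewrite -[RHS]mule1; congr (_ * _).
    exact: probability_setT.
  by rewrite fineD// /= -ltrBrDr sub0r.
have := birkhoff_past qgP Ppi PM pi_unique mG IG.
have := birkhoff_past qgP Ppi PM pi_unique mf If.
apply: filterS2 => e cF cG.
(* Bounds the sum of the first [m] differences for all parameters at once. *)
pose K := (\sum_(i < m) 2 * \sum_(k < i) xi (dropp k (past_obs e (i : nat)%:Z)))%R.
have [|N HN] := @subadditive_eventually_neg R (fun k => f (past_obs e k%:Z))
  (fun k => G (past_obs e k%:Z)) m _ _ K m0 _ fneg cF cG.
  by move=> k; rewrite addr_ge0// mulr_ge0.
exists N => n y Nn Ty bxy.
rewrite -subr_lt0.
apply: (HN (fun n => L y n (past_obs e n%:Z) - L ts n (past_obs e n%:Z))%R _ _ _ n Nn).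
- move=> k; have dE : dropp m (past_obs e (k + m)%N%:Z) = past_obs e k%:Z.
    exact: dropp_past_obs.
  have := Lsub k m (past_obs e (k + m)%N%:Z) Ty; have := Lsuper k m (past_obs e (k + m)%N%:Z) ThetaS.
  have := DV j y (past_obs e (k + m)%N%:Z) Ty bxy; rewrite dE /D /f.
  exact: aux1.
- move=> k; have dE : dropp 1 (past_obs e k.+1%:Z) = past_obs e k%:Z.
    by rewrite -(dropp_past_obs e k 1) addn1.
  have := Lsub k 1 (past_obs e k.+1%:Z) Ty; have := Lsuper k 1 (past_obs e k.+1%:Z) ThetaS.
  have := Lxi 1 (past_obs e k.+1%:Z) Ty; have := Lxi 1 (past_obs e k.+1%:Z) ThetaS.
  rewrite !big_ord1 !dropp0 dE !addn1 /G; exact: aux2.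
- apply: ler_sum => i _.
  have := Lxi i (past_obs e (i : nat)%:Z) Ty; have := Lxi i (past_obs e (i : nat)%:Z) ThetaS.
  exact: aux3.
Qed.

Hypothesis identified : forall x, Theta x -> x <> ts -> exists m,
  \int[P]_e (L x m (past_obs e 0%R) - L ts m (past_obs e 0%R))%:E < (- (2 * c))%:E.

(** For each [k], [Theta] is covered by a ball of radius [1/(k+1)] around [ts] and balls given by
    [wald_local] around the other points. By compactness, parameters outside the first ball lie in
    finitely many of the others. *)
Lemma wald_consistency : {ae P, forall e, forall eps : R, (0 < eps)%R ->
  exists N, forall n y, (N <= n)%N -> Theta y -> ~ ball ts eps y ->
    (L y n (past_obs e n%:Z) < L ts n (past_obs e n%:Z))%R}.
Proof.
have dlt x : {delta : R | (0 < delta)%R /\ (Theta x -> x <> ts ->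
    {ae P, forall e, exists N, forall n y, (N <= n)%N -> Theta y -> ball x delta y ->
      (L y n (past_obs e n%:Z) < L ts n (past_obs e n%:Z))%R})}.
  apply: cid; have [[Tx xts]|H] := pselect (Theta x /\ x <> ts).
    by have [m /(wald_local Tx)[delta d0 H]] := identified Tx xts; exists delta.
  by exists 1%R; split => // Tx xts; exfalso; apply: H.
suff H k : {ae P, forall e, exists N, forall n y, (N <= n)%N -> Theta y ->
    ~ ball ts (k.+1%:R^-1) y -> (L y n (past_obs e n%:Z) < L ts n (past_obs e n%:Z))%R}.
  have := ae_foralln H; apply: filterS => e He eps eps0.
  have [N HN] := He (Num.truncn (eps^-1)); exists N => n y Nn Ty nb.
  apply: HN => // b; apply: nb; apply: le_ball b.
  rewrite invf_ple ?posrE ?ltr0n//; apply: ltW; exact: Num.Theory.truncnS_gt.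
pose rad x : R := if `[< x = ts >] then (k.+1%:R^-1)%R else sval (dlt x).
have rad0 x : (0 < rad x)%R.
  by rewrite /rad; case: ifP => _; [rewrite invr_gt0 ltr0n|exact: (svalP (dlt x)).1].
move: cTheta => /(_ M Theta (fun x => (ball x (rad x))°)).
case=> [x _|x Tx|F FT TF]; first exact: open_interior.
  by exists x => //; rewrite /interior; exact: nbhsx_ballx.
pose Q x := [set e : E | x <> ts -> exists N, forall n y, (N <= n)%N -> Theta y -> ball x (rad x) y ->
      (L y n (past_obs e n%:Z) < L ts n (past_obs e n%:Z))%R].
have QF x : x \in F -> almost_everywhere P (Q x).
  move=> /FT/set_mem Tx; have [xts|xts] := pselect (x = ts); first by apply: aeW => e.
  have := (svalP (dlt x)).2 Tx xts; apply: filterS => e He _.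
  by rewrite /rad asboolF.
have QF' : almost_everywhere P (\bigcap_(i in [set` F]) Q i) by exact: filter_bigI.
apply: filterS QF' => e He.
have {}He x : exists N, x \in F -> x <> ts -> forall n y, (N <= n)%N -> Theta y ->
    ball x (rad x) y -> (L y n (past_obs e n%:Z) < L ts n (past_obs e n%:Z))%R.
  have [xF|xF] := boolP (x \in F); last by exists 0%N.
  have [xts|xts] := pselect (x = ts); first by exists 0%N => _ /(_ xts).
  by have [N HN] := He x xF xts; exists N.
have [Nf HNf] := choice He.
exists (\max_(x <- enum_fset F) Nf x)%N => n y Nn Ty nb.
have [x xF bx] := TF y Ty; have {}bx := interior_subset bx.
have xts : x <> ts by move=> xts; apply: nb; move: bx; rewrite /rad asboolT// xts.
apply: (HNf x xF xts) => //; apply: leq_trans Nn.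
exact: (leq_bigmax_seq (F := Nf) x xF isT).
Qed.

End wald.

Lemma within_continuous_seq {R : realType} {M : pseudoMetricType R} (A : set M) (f : M -> R)
    (u : nat -> M) (x : M) :
  {within A, continuous f} -> A x -> (forall i, A (u i)) -> u i @[i --> \oo] --> x ->
  f (u i) @[i --> \oo] --> f x.
Proof.
move=> fA Ax Au ux.
have fx : f y @[y --> within A (nbhs x)] --> f x.
  by rewrite (nbhs_subspace_in Ax); exact: fA.
apply: cvg_comp fx => Q; rewrite /within/= => AQ.
have {}AQ : \forall z \near x, A z -> Q z by [].
have AQu : \forall i \near \oo, A (u i) -> Q (u i) := ux _ AQ.
by apply: filterS AQu => i; apply; exact: Au.
Qed.

(** * The model satisfies the hypotheses of Wald's method *)

Section bounded_model.
Context {R : realType} {dX dY : measure_display}.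
Context {X : measurableType dX} {Y : measurableType dY} {s p : nat}.
Variables (mu : probability X R) (nu : {sigma_finite_measure set Y -> \bar R}).
Variables (Theta : set 'rV[R]_p) (ts : 'rV[R]_p).
Hypothesis cTheta : cover_compact Theta.
Hypothesis ThetaS : Theta ts.
Variables (q : 'rV[R]_p -> X -> X -> R) (g : 'rV[R]_p -> s.+1.-tuple Y -> X -> Y -> R).
Hypothesis qgP : forall t, Theta t -> ar_density mu nu (q t) (g t).
Variables (sm sp bp : R).
Hypothesis sm0 : (0 < sm)%R.
Hypothesis smsp : (sm <= sp)%R.
Hypothesis bp1 : (1 <= bp)%R.
Hypothesis smq : forall t x, Theta t -> {ae mu, forall x', (sm <= q t x x')%R}.
Hypothesis qsp : forall t x, Theta t -> {ae mu, forall x', (q t x x' <= sp)%R}.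
Hypothesis gbp : forall t yb y, Theta t -> {ae mu, forall x, (g t yb x y <= bp)%R}.
Hypothesis qcont : forall x x', {within Theta, continuous (fun t => q t x x')}.
Hypothesis gcont : forall x yb y, {within Theta, continuous (fun t => g t yb x y)}.
Hypothesis b_minus_gt0 : forall yb y, 0 < b_minus mu Theta g yb y.

Local Notation bm := (b_minus mu Theta g).

Let bp0 : (0 <= bp)%R. Proof. exact: le_trans bp1. Qed.
Let sp0 : (0 < sp)%R. Proof. exact: lt_le_trans smsp. Qed.

Lemma measurable_g_bar t : Theta t ->
  measurable_fun [set: s.+1.-tuple Y * Y] (fun v => g_bar mu g t v.1 v.2).
Proof.
move=> Tt; have [_ _ _ mg [g0 _]] := qgP Tt.
apply: (measurable_fun_fubini_tonelli_F (m2 := mu)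
  (fun v : (s.+1.-tuple Y * Y) * X => (g t v.1.1 v.2 v.1.2)%:E)).
  apply/measurable_EFinP.
  apply: (measurableT_comp mg (g := fun v : (s.+1.-tuple Y * Y) * X => (v.1.1, v.2, v.1.2))).
  apply: measurable_fun_pair; last exact: (measurableT_comp measurable_snd measurable_fst).
  apply: measurable_fun_pair; last exact: measurable_snd.
  exact: (measurableT_comp measurable_fst measurable_fst).
by move=> v; rewrite lee_fin.
Qed.

Lemma g_bar_le t yb y : Theta t -> g_bar mu g t yb y <= bp%:E.
Proof.
move=> Tt; have [_ _ _ _ [g0 _]] := qgP Tt.
rewrite -[leRHS]mule1 -(probability_setT mu) -integral_cst//.
apply: ae_ge0_le_integral => //.
- by move=> x _; rewrite lee_fin.
- by apply/measurable_EFinP; exact: (measurable_g_state (qgP Tt)).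
- by apply: filterS (gbp yb y Tt) => x gx _; rewrite lee_fin.
Qed.

Lemma g_bar_cvg t (u : nat -> 'rV[R]_p) yb y : Theta t -> (forall i, Theta (u i)) ->
  u i @[i --> \oo] --> t -> g_bar mu g (u i) yb y @[i --> \oo] --> g_bar mu g t yb y.
Proof.
move=> Tt Tu ut.
have [] // := @dominated_convergence _ _ _ mu setT measurableT
  (fun i x => (g (u i) yb x y)%:E) (fun x => (g t yb x y)%:E) (cst bp%:E).
- by move=> i; apply/measurable_EFinP; exact: (measurable_g_state (qgP (Tu i))).
- by apply/measurable_EFinP; exact: (measurable_g_state (qgP Tt)).
- apply: aeW => x _; apply: cvg_EFin; first exact: nearW.
  exact: (within_continuous_seq (@gcont x yb y) Tt Tu ut).
- exact: finite_measure_integrable_cst.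
apply: ae_foralln => i; apply: filterS (gbp yb y (Tu i)) => x gx _.
have [_ _ _ _ [g0 _]] := qgP (Tu i).
by rewrite abse_EFin lee_fin ger0_norm.
Qed.

(** The infimum over [Theta] is one over a dense sequence, because [g_bar] is continuous in the
    parameter by dominated convergence. *)
Lemma measurable_b_minus : measurable_fun [set: s.+1.-tuple Y * Y] (fun v => bm v.1 v.2).
Proof.
have [u Tu ud] := compact_dense_seq cTheta ThetaS.
rewrite (_ : (fun _ => _) = fun v => einfs (fun i => g_bar mu g (u i) v.1 v.2) 0%N).
  by apply: measurable_fun_einfs => i; exact: measurable_g_bar.
apply/funext => v; apply/eqP; rewrite eq_le; apply/andP; split.
  apply: le_ereal_inf_tmp => _ [i _ <-]; apply: ereal_inf_lbound.
  by exists (u i).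
apply: le_ereal_inf_tmp => _ [t Tt <-].
have H k : exists i, ball t (k.+1%:R^-1) (u i) by apply: ud.
have [k Hk] := choice H.
have kt : u (k J) @[J --> \oo] --> t.
  apply/cvg_ballP => eps eps0; exists (Num.truncn (eps^-1)) => // n /= nN.
  apply: le_ball (Hk n); rewrite invf_ple ?posrE ?ltr0n//.
  by apply: ltW; apply: (lt_le_trans (Num.Theory.truncnS_gt _)); rewrite ler_nat ltnS.
have c := @g_bar_cvg t (u \o k) v.1 v.2 Tt (fun i => Tu _) kt.
apply: (cvge_to_ge c); apply: nearW => J.
by apply: ereal_inf_lbound; exists (k J).
Qed.

Lemma b_minus_le t yb y : Theta t -> bm yb y <= g_bar mu g t yb y.
Proof. by move=> Tt; apply: ereal_inf_lbound; exists t. Qed.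

Lemma b_minus_fin yb y : bm yb y \is a fin_num.
Proof.
rewrite ge0_fin_numE; last exact: ltW.
by rewrite (le_lt_trans (b_minus_le _ _ ThetaS))// (le_lt_trans (g_bar_le _ _ ThetaS))// ltry.
Qed.

Definition obs_lb (h : nat -> Y) : R := fine (bm (lag s.+1 (dropp 1 h)) (h 0%N)).

Lemma obs_lb_gt0 h : (0 < obs_lb h)%R.
Proof. by rewrite fine_gt0// b_minus_gt0/= ltey_eq b_minus_fin. Qed.

Lemma measurable_obs_lb : measurable_fun [set: paths nat Y] obs_lb.
Proof.
apply: measurableT_comp => //.
apply: (measurableT_comp measurable_b_minus
  (g := fun h : paths nat Y => (lag s.+1 (dropp 1 h), h 0%N))).
apply: measurable_fun_pair; last exact: measurable_coord.
exact: (measurableT_comp (f := lag s.+1 : paths nat Y -> s.+1.-tuple Y)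
  (@measurable_lag _ Y s.+1) (measurable_dropp 1)).
Qed.

(** The likelihood lies between the products over the observations of [sm * obs_lb] and of [bp];
    this bounds the absolute logarithm of both factors. *)
Definition obs_bound (h : nat -> Y) : R := (`|ln sm| + `|ln bp| + `|ln (obs_lb h)|)%R.

Lemma obs_bound_ge0 h : (0 <= obs_bound h)%R.
Proof. by rewrite addr_ge0// addr_ge0. Qed.

Lemma measurable_obs_bound : measurable_fun [set: paths nat Y] obs_bound.
Proof.
apply: measurable_funD => //; apply: measurableT_comp => //.
by apply: measurableT_comp => //; exact: measurable_obs_lb.
Qed.

Variable x0 : X.

Definition obs_loglik (t : 'rV[R]_p) (n : nat) (h : paths nat Y) : R :=
  ln (fine (beta mu (q t) (g t) n x0 h)).

Lemma beta_prod_le t n x h : Theta t ->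
  (\prod_(k < n) (sm * obs_lb (dropp k h)))%:E <= beta mu (q t) (g t) n x h.
Proof.
move=> Tt; apply: (beta_lb (qgP Tt) sm0 (fun x => smq x Tt)).
  by move=> h'; rewrite ltW// obs_lb_gt0.
by move=> h'; rewrite fineK ?b_minus_fin//; exact: b_minus_le.
Qed.

Lemma prod_obs_lb_gt0 n (h : nat -> Y) : (0 < \prod_(k < n) (sm * obs_lb (dropp k h)))%R.
Proof. by apply: prodr_gt0 => k _; rewrite mulr_gt0// obs_lb_gt0. Qed.

Lemma obs_beta_gt0 t n x h : Theta t -> 0 < beta mu (q t) (g t) n x h.
Proof.
by move=> Tt; apply: lt_le_trans (beta_prod_le n x h Tt); rewrite lte_fin prod_obs_lb_gt0.
Qed.

Lemma obs_beta_fin t n x h : Theta t -> beta mu (q t) (g t) n x h \is a fin_num.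
Proof. by move=> Tt; exact: (beta_fin_num (qgP Tt) (fun yb y => gbp yb y Tt) bp0). Qed.

Lemma fine_beta_gt0 t n x h : Theta t -> (0 < fine (beta mu (q t) (g t) n x h))%R.
Proof. by move=> Tt; rewrite fine_gt0// obs_beta_gt0//= ltey_eq obs_beta_fin. Qed.

Lemma measurable_obs_loglik t n : Theta t -> measurable_fun setT (obs_loglik t n).
Proof.
move=> Tt; apply: (measurableT_comp (@measurable_ln R)).
by apply: measurableT_comp => //; exact: (measurable_beta_path (qgP Tt)).
Qed.

Lemma obs_loglik_bound t n h : Theta t ->
  (`|obs_loglik t n h| <= \sum_(k < n) obs_bound (dropp k h))%R.
Proof.
move=> Tt; have b0 := fine_beta_gt0 n x0 h Tt.
rewrite ler_norml; apply/andP; split.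
  have lnp : (- \sum_(k < n) obs_bound (dropp k h) <=
      ln (\prod_(k < n) (sm * obs_lb (dropp k h))))%R.
    elim: n {b0} => [|n ih]; first by rewrite !big_ord0 oppr0 ln1.
    rewrite !big_ord_recr/= lnM ?posrE ?prod_obs_lb_gt0 ?mulr_gt0 ?obs_lb_gt0//.
    rewrite lnM ?posrE ?obs_lb_gt0// opprD; apply: lerD => //.
    rewrite /obs_bound; set l := ln (obs_lb _).
    have := ler_norm (- ln sm)%R; have := ler_norm (- l)%R; have := normr_ge0 (ln bp).
    by rewrite !normrN; lra.
  apply: (le_trans lnp); rewrite ler_ln ?posrE ?prod_obs_lb_gt0//.
  by rewrite -lee_fin fineK ?obs_beta_fin// beta_prod_le.
apply: (@le_trans _ _ (ln (bp ^+ n))).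
  rewrite ler_ln ?posrE ?exprn_gt0// ?(lt_le_trans ltr01)//.
  rewrite -lee_fin fineK ?obs_beta_fin//.
  exact: (beta_ub (qgP Tt) (fun yb y => gbp yb y Tt) bp0).
rewrite lnXn ?(lt_le_trans ltr01)// -[X in (_ *+ X)%R](card_ord n) -sumr_const.
apply: ler_sum => k _; rewrite /obs_bound.
have := ler_norm (ln bp); have := normr_ge0 (ln sm).
by have := normr_ge0 (ln (obs_lb (dropp k h))); lra.
Qed.

Definition log_kappa : R := ln (sp / sm).

Lemma kappa_ge1 : (1 <= sp / sm)%R.
Proof. by rewrite ler_pdivlMr// mul1r. Qed.

Lemma log_kappa_ge0 : (0 <= log_kappa)%R.
Proof. exact: ln_ge0 kappa_ge1. Qed.

Let kappa_gt0 : (0 < sp / sm)%R. Proof. exact: divr_gt0. Qed.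

Lemma obs_beta_kappa t n x x' h : Theta t ->
  beta mu (q t) (g t) n x h <= (sp / sm)%:E * beta mu (q t) (g t) n x' h.
Proof.
by move=> Tt; apply: (beta_kappa (qgP Tt) sm0 (fun x => smq x Tt) (fun x => qsp x Tt)).
Qed.

Lemma obs_loglik_sub t n m h : Theta t ->
  (obs_loglik t (n + m) h <= obs_loglik t n (dropp m h) + obs_loglik t m h + log_kappa)%R.
Proof.
move=> Tt; have b k h' := fine_beta_gt0 k x0 h' Tt.
have bb : (0 < fine (beta mu (q t) (g t) n x0 (dropp m h)) * fine (beta mu (q t) (g t) m x0 h))%R.
  exact: mulr_gt0.
rewrite /obs_loglik /log_kappa -lnM ?posrE// -lnM ?posrE// ler_ln ?posrE//; last exact: mulr_gt0.
rewrite -lee_fin fineK ?obs_beta_fin// -mulrA EFinM fineK ?obs_beta_fin//.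
apply: (beta_submul (qgP Tt)); first by apply: ltW; exact: mulr_gt0.
by move=> x'; rewrite mulrC EFinM fineK ?obs_beta_fin//; exact: obs_beta_kappa.
Qed.

Lemma obs_loglik_super t n m h : Theta t ->
  (obs_loglik t n (dropp m h) + obs_loglik t m h - log_kappa <= obs_loglik t (n + m) h)%R.
Proof.
move=> Tt; have b k h' := fine_beta_gt0 k x0 h' Tt.
have bb : (0 < fine (beta mu (q t) (g t) n x0 (dropp m h)) * fine (beta mu (q t) (g t) m x0 h))%R.
  exact: mulr_gt0.
rewrite /obs_loglik /log_kappa -lnM ?posrE// -ln_div ?posrE// ler_ln ?posrE//; last exact: divr_gt0.
rewrite -lee_fin [leRHS]fineK ?obs_beta_fin// -mulrA EFinM fineK ?obs_beta_fin//.
apply: (beta_supermul (qgP Tt)); first by apply: ltW; exact: divr_gt0.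
move=> x'; rewrite mulrC EFinM lee_pdivrMl// fineK ?obs_beta_fin//; exact: obs_beta_kappa.
Qed.

Lemma obs_loglik_cvg t (u : nat -> 'rV[R]_p) n h : Theta t -> (forall i, Theta (u i)) ->
  u i @[i --> \oo] --> t -> obs_loglik (u i) n h @[i --> \oo] --> obs_loglik t n h.
Proof.
move=> Tt Tu ut; have b := fine_beta_gt0 n x0 h Tt.
apply: (cvg_comp (fun i => fine (beta mu (q (u i)) (g (u i)) n x0 h)) (@ln R) _ (continuous_ln b)).
apply: (fine_cvg (f := fun i => beta mu (q (u i)) (g (u i)) n x0 h)); rewrite fineK ?obs_beta_fin//.
apply: (beta_cvg (qgP Tt) (fun k => qgP (Tu k)) (fun k x => qsp x (Tu k))
  (fun k yb y => gbp yb y (Tu k)) (fun yb y => gbp yb y Tt) bp0).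
- by move=> x x'; exact: (within_continuous_seq (@qcont x x') Tt Tu ut).
- by move=> yb x y; exact: (within_continuous_seq (@gcont x yb y) Tt Tu ut).
Qed.

Local Notation Z := (X * s.+1.-tuple Y)%type.
Local Notation E := (paths int (X * Y)%type).
Local Notation stZ := (@stateZ _ _ X Y s).

Variables (P : 'rV[R]_p -> probability E R) (pi : 'rV[R]_p -> probability Z R).
Hypothesis Ppi : forall t k A, Theta t -> measurable A -> P t (stZ k @^-1` A) = pi t A.
Hypothesis PM : forall t, Theta t -> markov mu nu (q t) (g t) (P t).
Hypothesis pi_unique : forall t, Theta t -> unique_invariant (kerZ mu nu (q t) (g t)) (pi t).
Hypothesis harris : forall t, Theta t -> harris_recurrent (kerZ mu nu (q t) (g t)).
Hypothesis int_obs_lb : (P ts).-integrable setT (fun e => (ln (obs_lb (past_obs e 0%R)))%:E).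
Hypothesis identifiable : forall t, Theta t ->
  (forall A, measurable (A : set (paths int Y)) ->
     P t ((fun e : E => (fun k => (e k).2) : paths int Y) @^-1` A) =
     P ts ((fun e : E => (fun k => (e k).2) : paths int Y) @^-1` A)) -> t = ts.

Let PpiT t (Tt : Theta t) k A (mA : measurable A) := @Ppi t k A Tt mA.

Lemma integrable_obs_bound : (P ts).-integrable setT (fun e : E => (obs_bound (past_obs e 0%R))%:E).
Proof.
have Ic : (P ts).-integrable setT (EFin \o cst (`|ln sm| + `|ln bp|)%R).
  exact: finite_measure_integrable_cst.
exact: (integrableD measurableT Ic (integrable_abse int_obs_lb)).
Qed.

Lemma loglik_identified t : Theta t -> t <> ts -> exists m,
  \int[P ts]_e (obs_loglik t m (past_obs e 0%R) - obs_loglik ts m (past_obs e 0%R))%:E <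
  (- (2 * log_kappa))%:E.
Proof.
move=> Tt tts; apply: contrapT => /forallNP H; apply: tts; apply: identifiable => // A mA.
have ID m := integrable_log_diff (qgP ThetaS) (PpiT ThetaS) (PM ThetaS) ThetaS
  obs_bound_ge0 integrable_obs_bound log_kappa_ge0 measurable_obs_loglik obs_loglik_bound m Tt.
have bound m : (P ts).-integrable setT
      (fun e => (log_ratio mu (q ts) (q t) (g ts) (g t) x0 m (past_obs e 0%R))%:E) /\
    \int[P ts]_e (log_ratio mu (q ts) (q t) (g ts) (g t) x0 m (past_obs e 0%R))%:E <=
    (2 * log_kappa)%:E.
  have rE (e : E) : (log_ratio mu (q ts) (q t) (g ts) (g t) x0 m (past_obs e 0%R))%:E =
      - (obs_loglik t m (past_obs e 0%R) - obs_loglik ts m (past_obs e 0%R))%:E.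
    by rewrite -EFinN opprB.
  split.
    have := integrableN (ID m); congr (integrable _ _ _); apply/funext => e.
    by rewrite rE.
  under eq_integral do rewrite rE.
  rewrite integralN; last exact: (integrable_add_def measurableT (ID m)).
  rewrite leeNl -EFinN leNgt; apply/negP; exact: H.
(* The constants are those of [obs_mean_transfer] with [c = 2 * log_kappa] and [kp = sp / sm]. *)
symmetry; apply: (@obs_law_eq _ _ _ _ _ _ _ _ _ _ _ _ (qgP ThetaS) (qgP Tt) _ _ _ _
  (PpiT ThetaS) (PpiT Tt) (PM ThetaS) (PM Tt) (pi_unique Tt)
  (2 * log_kappa + sp / sm)%R (fun M => M * expR M * (sp / sm))%R) => //.
  by apply: addr_ge0; [rewrite mulr_ge0// log_kappa_ge0|exact: ltW].
move=> n f M mf f01 fn M0.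
apply: (obs_mean_transfer (qgP ThetaS) (qgP Tt) (PpiT ThetaS) (PpiT Tt) (PM ThetaS) (PM Tt)
  (pi_unique Tt) (harris Tt) (x0 := x0) kappa_gt0 _ _ _ _ _ bound mf f01 fn M0).
- by move=> k x h; exact: obs_beta_kappa.
- by move=> k h; exact: obs_beta_gt0.
- by move=> k h; exact: obs_beta_gt0.
- by move=> k x h; exact: obs_beta_fin.
- by move=> k x h; exact: obs_beta_fin.
Qed.

Lemma obs_loglik_consistency : {ae P ts, forall e, forall eps : R, (0 < eps)%R ->
  exists N, forall n t, (N <= n)%N -> Theta t -> ~ ball ts eps t ->
    (obs_loglik t n (past_obs e n%:Z) < obs_loglik ts n (past_obs e n%:Z))%R}.
Proof.
apply: (wald_consistency (qgP ThetaS) (PpiT ThetaS) (PM ThetaS) (pi_unique ThetaS)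
  cTheta ThetaS measurable_obs_bound obs_bound_ge0 integrable_obs_bound log_kappa_ge0
  measurable_obs_loglik obs_loglik_bound obs_loglik_sub obs_loglik_super
  obs_loglik_cvg loglik_identified).
Qed.

End bounded_model.

(** * The law of the two-sided chain *)

Section path_law.
Context {R : realType} {dX dY d : measure_display}.
Context {X : measurableType dX} {Y : measurableType dY} {Omega : measurableType d} {s : nat}.
Variables (mu : probability X R) (nu : {sigma_finite_measure set Y -> \bar R}).
Variables (q : X -> X -> R) (g : s.+1.-tuple Y -> X -> Y -> R).
Hypothesis qgP : ar_density mu nu q g.
Variables (Xs : int -> {mfun Omega >-> X}) (Ys : int -> {mfun Omega >-> Y}).

Local Notation Z := (X * s.+1.-tuple Y)%type.
Local Notation E := (paths int (X * Y)%type).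
Local Notation stZ := (@stateZ _ _ X Y s).

Definition chain_path (w : Omega) : E := fun k => (Xs k w, Ys k w).

Lemma measurable_chain_path : measurable_fun setT chain_path.
Proof. by apply: measurable_to_paths => k; exact: measurable_fun_pair. Qed.

(** (A3) pairs the observation at time 1 with the lags at time 0, which in the backward history at
    time 1 are the entries from index 1 on. *)
Lemma lag_chain_path m w :
  lag m (dropp 1 (past_obs (chain_path w) 1%R)) = lagged m (fun j => Ys j w) 0%R.
Proof.
apply: eq_from_tnth => i; rewrite !tnth_mktuple /past_obs /dropp/=.
by congr (Ys _ w); lia.
Qed.

Definition path_law (P : probability Omega R) : probability E R :=
  distribution P (mfun_Sub (mem_set measurable_chain_path)).

Lemma ge0_integral_path_law P D (f : E -> \bar R) : measurable D -> measurable_fun setT f ->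
  (forall e, 0 <= f e) ->
  \int[path_law P]_(e in D) f e = \int[P]_(w in chain_path @^-1` D) f (chain_path w).
Proof.
move=> mD mf f0.
rewrite -(ge0_integral_pushforward measurable_chain_path P mD (measurable_funTS mf))//.
Qed.

Lemma ae_path_law (P : probability Omega R) (Q : E -> Prop) :
  {ae path_law P, forall e, Q e} -> {ae P, forall w, Q (chain_path w)}.
Proof.
move=> [N [mN N0 QN]]; exists (chain_path @^-1` N); split => //.
  by rewrite -[X in measurable X]setTI; exact: measurable_chain_path.
by move=> w /= nQ; apply: QN.
Qed.

Variables (P : probability Omega R) (pi : probability Z R).
Let Zs (k : int) (w : Omega) : Z := (Xs k w, lagged s.+1 (fun j => Ys j w) k).
Hypothesis chainP : stationary_chain (kerZ mu nu q g) pi P Zs.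

Lemma path_law_marginal k A : measurable A -> path_law P (stZ k @^-1` A) = pi A.
Proof. by move=> mA; exact: (chainP.1 k A mA). Qed.

Lemma past_chain_path k C : <<s past_gen k >> C -> past Zs k (chain_path @^-1` C).
Proof.
suff H : <<s past_gen k >> `<=` image_set_system setT chain_path (past Zs k).
  by move=> /H; rewrite /image_set_system/= setTI.
apply: smallest_sub.
  apply: sigma_algebra_image; exact: smallest_sigma_algebra.
move=> _ [j [A [jk mA ->]]]; rewrite /image_set_system/= setTI.
apply: sub_sigma_algebra; exists j, [set z : Z | A (z.1, thead z.2)]; split => //.
  rewrite -[X in measurable X]setTI.
  apply: (measurable_fun_pair measurable_fst
    (measurableT_comp (measurable_thead (s := s)) measurable_snd)) => //.
apply/seteqP; split => w /=; rewrite /Zs /chain_path /thead tnth_mktuple/= subr0//.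
Qed.

Lemma path_law_markov : markov mu nu q g (path_law P).
Proof.
move=> k C A Ck mA; have mC := past_measurable Ck.
rewrite ge0_integral_path_law//; last 2 first.
- exact: (measurableT_comp (measurable_kerZ_mass qgP mA) (measurable_stateZ k)).
- by move=> e; exact: kerZ_mass_ge0.
exact: (chainP.2 k A _ mA (past_chain_path Ck)).
Qed.

End path_law.

Lemma ae_exists {R : realType} {d} {T : measurableType d} (P : probability T R) (Q : T -> Prop) :
  {ae P, forall x, Q x} -> exists x, Q x.
Proof.
move=> [N [mN N0 QN]]; apply: contrapT => /forallNP nQ.
have NT : N = setT by apply/seteqP; split => // x _; apply: QN => /= Qx; exact: (nQ x).
move: N0; rewrite NT => /eqP; rewrite [X in X == _](probability_setT P).
by rewrite eqe oner_eq0.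
Qed.

Lemma lee_fin_fine {R : realType} (x : R) (y : \bar R) : x%:E <= y -> y < +oo -> (x <= fine y)%R.
Proof. by case: y => [r| |]. Qed.

Theorem theorem1 (R : realType)
  (* state space: compact, separable, metrizable *)
  (X : pseudoPMetricType R)
  (hausdorffX : hausdorff_space X)
  (compactX : compact [set: X])
  (separableX : separable_space X)
  (mu : probability (borel X) R)
  (* observation space: separable, metrizable by a complete metric *)
  (Y : completePseudoMetricType R)
  (hausdorffY : hausdorff_space Y)
  (separableY : separable_space Y)
  (nu : {sigma_finite_measure set (borel Y) -> \bar R})
  (s : nat) (s_gt0 : (0 < s)%N)
  (* parameters *)
  (p : nat) (Theta : set 'rV[R]_p) (compactTheta : compact Theta)
  (theta_star : 'rV[R]_p) (theta_starP : Theta theta_star)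
  (* model *)
  (q : 'rV[R]_p -> borel X -> borel X -> R)
  (g : 'rV[R]_p -> s.-tuple (borel Y) -> borel X -> borel Y -> R)
  (qP : transition_densities mu Theta q)
  (gP : observation_densities nu Theta g)
  (* invariant distributions *)
  (pi : 'rV[R]_p -> probability (borel X * s.-tuple (borel Y))%type R)
  (piP : forall theta, Theta theta ->
     unique_invariant (ar_kernel mu nu q g theta) (pi theta))
  (* two-sided stationary chain *)
  (d : measure_display) (Omega : measurableType d)
  (Xs : int -> {mfun Omega >-> borel X})
  (Ys : int -> {mfun Omega >-> borel Y})
  (P : 'rV[R]_p -> probability Omega R)
  (PP : forall theta, Theta theta ->
     stationary_chain (ar_kernel mu nu q g theta) (pi theta) (P theta)
       (fun k w => (Xs k w, lagged s (fun j => Ys j w) k)))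
  (* (A1) *)
  (A1a : 0 < sigma_minus mu Theta q /\ sigma_plus mu Theta q < +oo)
  (A1b : forall (y : borel Y) (yb : s.-tuple (borel Y)),
     0 < ereal_inf [set g_bar mu g theta yb y | theta in Theta] /\
     ereal_sup [set g_bar mu g theta yb y | theta in Theta] < +oo)
  (* (A2) *)
  (A2 : forall theta, Theta theta ->
     positive_harris_recurrent (ar_kernel mu nu q g theta) (pi theta) /\
     aperiodic (ar_kernel mu nu q g theta) (pi theta))
  (* (A3) *)
  (A3a : b_plus mu Theta g < +oo)
  (A3b : \int[P theta_star]_w
     `| lne (b_minus mu Theta g (lagged s (fun j => Ys j w) 0%R) (Ys 1%R w)) | < +oo)
  (* (A4) *)
  (A4q : forall x x' : borel X,
     {within Theta, continuous (fun theta => q theta x x')})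
  (A4g : forall (x : borel X) (yb : s.-tuple (borel Y)) (y : borel Y),
     {within Theta, continuous (fun theta => g theta yb x y)})
  (* (A5) *)
  (A5 : forall theta, Theta theta ->
     (theta = theta_star <->
      same_process_law (P theta) (P theta_star) (fun k => Ys k)))
  (x0 : borel X)
  (theta_hat : nat -> Omega -> 'rV[R]_p)
  (theta_hatP : forall n w, (1 <= n)%N ->
     is_mle mu Theta q g (fun k => Ys k w) n x0 (theta_hat n w)) :
  {ae P theta_star, forall w, theta_hat n w @[n --> \oo] --> theta_star}.
Proof.
(* With [s'.+1] lags the latest observation is always part of the state. *)
case: s s_gt0 g gP pi piP PP A1b A2 A3a A3b A4g theta_hatP => [//|s'] _ g gP pi piP PP A1b A2 A3a A3b
  A4g theta_hatP.
set ts := theta_star in PP A3b *.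
have ThetaS : Theta ts by exact: theta_starP.
have cTheta : cover_compact Theta by move: compactTheta; rewrite compact_cover.
have qgP t : Theta t -> ar_density mu nu (q t) (g t).
  by move=> Tt; have [? ? ?] := qP t Tt; have [? ? ?] := gP t Tt; split.
have sm_le t x : Theta t -> {ae mu, forall x', sigma_minus mu Theta q <= (q t x x')%:E}.
  move=> Tt; apply: filterS (ess_inf_le mu (fun x' => (q t x x')%:E)) => x'; apply: le_trans.
  by apply: ereal_inf_lbound; exists t, x.
have le_sp t x : Theta t -> {ae mu, forall x', (q t x x')%:E <= sigma_plus mu Theta q}.
  move=> Tt; apply: filterS (ess_sup_ge mu (fun x' => (q t x x')%:E)) => x' /le_trans; apply.
  by apply: ereal_sup_ubound; exists t, x.
have le_bp t yb y : Theta t -> {ae mu, forall x, (g t yb x y)%:E <= b_plus mu Theta g}.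
  move=> Tt; apply: filterS (ess_sup_ge mu (fun x => (g t yb x y)%:E)) => x /le_trans; apply.
  by apply: ereal_sup_ubound; exists t, yb, y.
pose sm := fine (sigma_minus mu Theta q); pose sp := fine (sigma_plus mu Theta q).
(* The maximum with 1 makes the bound positive before its logarithm is taken. *)
pose bp := Num.max 1%R (fine (b_plus mu Theta g)).
(* A point where both essential bounds hold shows that [sigma_minus] is finite and at most
   [sigma_plus]. *)
have [x1 [smx spx]] : exists x', sigma_minus mu Theta q <= (q ts x0 x')%:E /\
    (q ts x0 x')%:E <= sigma_plus mu Theta q.
  apply: (@ae_exists _ _ _ mu); move: (sm_le _ x0 ThetaS) (le_sp _ x0 ThetaS).
  by apply: filterS2.
have smE : sm%:E = sigma_minus mu Theta q.
  rewrite fineK// ge0_fin_numE; last exact: ltW A1a.1.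
  by rewrite (le_lt_trans smx)// ltry.
have sm0 : (0 < sm)%R by rewrite -lte_fin smE A1a.1.
have smq t x : Theta t -> {ae mu, forall x', (sm <= q t x x')%R}.
  by move=> Tt; apply: filterS (sm_le t x Tt) => x'; rewrite -smE lee_fin.
have qsp t x : Theta t -> {ae mu, forall x', (q t x x' <= sp)%R}.
  by move=> Tt; apply: filterS (le_sp t x Tt) => x' qx; apply: lee_fin_fine A1a.2.
have smsp : (sm <= sp)%R.
  by apply: lee_fin_fine A1a.2; rewrite smE (le_trans smx).
have bp1 : (1 <= bp)%R by rewrite le_max lexx.
have gbp t yb y : Theta t -> {ae mu, forall x, (g t yb x y <= bp)%R}.
  move=> Tt; apply: filterS (le_bp t yb y Tt) => x gx; rewrite le_max; apply/orP; right.
  exact: lee_fin_fine A3a.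
have b_minus_gt0 yb y : 0 < b_minus mu Theta g yb y by exact: (A1b y yb).1.
pose PE t := path_law Xs Ys (P t).
have PpiE t k A : Theta t -> measurable A -> PE t (stateZ k @^-1` A) = pi t A.
  by move=> Tt mA; exact: (path_law_marginal (PP t Tt)).
have PME t : Theta t -> markov mu nu (q t) (g t) (PE t).
  by move=> Tt; exact: (path_law_markov (qgP t Tt) (PP t Tt)).
have int_lb : (PE ts).-integrable setT
    (fun e => (ln (obs_lb mu Theta g (past_obs e 0%R)))%:E).
  have mlb : measurable_fun setT (fun h : paths nat (borel Y) => ln (obs_lb mu Theta g h)).
    apply: (measurableT_comp (@measurable_ln R)).
    exact: (measurable_obs_lb cTheta ThetaS qgP gbp A4g).
  have mF : measurable_fun setT (fun u : borel X * paths nat (borel Y) =>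
      `|(ln (obs_lb mu Theta g u.2))%:E|).
    apply: measurableT_comp => //; apply/measurable_EFinP.
    exact: (measurableT_comp mlb measurable_snd).
  apply/integrableP; split.
    by apply/measurable_EFinP; exact: (measurable_obs mlb).
  have PpiS k A (mA : measurable A) := PpiE ts k A ThetaS mA.
  (* Stationarity moves the integral from time 0 to time 1, where (A3) bounds it. *)
  rewrite -(stationary_ge0 (qgP ts ThetaS) PpiS (PME ts ThetaS) 1%R mF)//.
  rewrite ge0_integral_path_law//; last first.
    exact: (measurableT_comp mF (measurable_stateS 1%R)).
  apply: le_lt_trans A3b; rewrite le_eqVlt; apply/orP; left; apply/eqP.
  apply: eq_integral => w _; congr (`| _ |).
  rewrite -lne_EFin; last exact: (obs_lb_gt0 ThetaS qgP bp1 gbp b_minus_gt0).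
  rewrite fineK; last exact: (b_minus_fin ThetaS qgP bp1 gbp b_minus_gt0).
  by rewrite lag_chain_path.
have identifiable t : Theta t ->
    (forall A, measurable (A : set (paths int (borel Y))) ->
       PE t ((fun e => (fun k => (e k).2) : paths int (borel Y)) @^-1` A) =
       PE ts ((fun e => (fun k => (e k).2) : paths int (borel Y)) @^-1` A)) -> t = ts.
  by move=> Tt H; apply/(A5 t Tt) => A mA; exact: H.
have := obs_loglik_consistency cTheta ThetaS qgP sm0 smsp bp1 smq qsp gbp A4q A4g
  b_minus_gt0 x0 PpiE PME piP (fun t Tt => (A2 t Tt).1.1) int_lb identifiable.
move=> /ae_path_law; apply: filterS => w Hw.
(* Maximizers are given for [n >= 1] only. One outside the ball would have a log-likelihood strictly
   below that of [ts]. *)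
apply/cvg_ballP => eps /Hw [N HN]; exists (maxn N 1) => // n /=.
rewrite geq_max => /andP[Nn n1].
have [Tt mle] := theta_hatP n w n1.
apply: contrapT => /(HN n _ Nn Tt); apply/negP; rewrite -leNgt -lee_fin.
have llE t : Theta t -> log_likelihood mu q g (Ys^~ w) n t x0 =
    (obs_loglik mu q g x0 t n (past_obs (chain_path Xs Ys w) n%:Z))%:E.
  move=> Tt'; rewrite /log_likelihood (likelihood_beta (qgP t Tt')) /obs_loglik.
  rewrite -lne_EFin ?fineK//.
  - exact: (obs_beta_fin qgP bp1 gbp).
  - exact: (fine_beta_gt0 ThetaS qgP sm0 bp1 smq gbp b_minus_gt0).
by rewrite -!llE//; exact: mle.
Qed.
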